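(* Let $F$ be a commutative field, let $0<h'<N'$ and $0<h<N$ be integers, and put $n'=\binom{N'+1}{h'+1}-1$, $n=\binom{N+1}{h+1}-1$. Let $\Gamma'=\Gamma^{h'}(\mathbb{P}_{N',F})$ and $\Gamma=\Gamma^{h}(\mathbb{P}_{N,F})$ be the Grassmann spaces, let $\overline{\mathbb{P}}$ be the projective space over $F$ of dimension $(n'+1)(n+1)-1$, and let $\phi:\Gamma'\times\Gamma\to\overline{\mathbb{P}}$ be the standard embedding. Let $\mathbb{P}'$ be a projective space and let $\eta:\Gamma'\times\Gamma\to\mathbb{P}'$ be an embedding such that $\operatorname{rk}\eta\geq\operatorname{rk}\phi$ and $[\operatorname{im}\eta]=\mathbb{P}'$. Then there are $\alpha\in\operatorname{Aut}(\Gamma)$ and a collineation $\psi:\overline{\mathbb{P}}\to\mathbb{P}'$ such that $$\eta=(\operatorname{id}_{\Gamma'}\times\alpha)\,\phi\,\psi$$ (maps are composed from left to right: first $\operatorname{id}_{\Gamma'}\times\alpha$, then $\phi$, then $\psi$). Furthermore, $\operatorname{im}\eta$ is projectively equivalent to $\operatorname{im}\phi$, the image of the standard embedding of $\Gamma'\times\Gamma$.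
   Context: Maps are written on the right of their arguments. A semilinear space is a pair $\Sigma=(\mathcal P,\mathcal G)$, where $\mathcal P$ is a set (of points) and $\mathcal G\subseteq 2^{\mathcal P}$ (the set of lines), such that: every line has at least two points; the union of all lines is $\mathcal P$; two distinct lines meet in at most one point. Points $X,Y$ are collinear, $X\sim Y$, if some line contains both; for $X\neq Y$ this line is denoted $XY$. An isomorphism of semilinear spaces is a bijection of the point sets such that both it and its inverse map lines onto lines; $\operatorname{Aut}(\Sigma)$ is the group of isomorphisms of $\Sigma$ onto itself. The join of $\mathcal M_1,\mathcal M_2\subset\mathcal P$ is $\mathcal M_1\vee\mathcal M_2:=\mathcal M_1\cup\mathcal M_2\cup\bigcup\{X_1X_2 : X_i\in\mathcal M_i,\ X_1\sim X_2,\ X_1\neq X_2\}$; a point $X$ is identified with $\{X\}$. The product $\Sigma'\times\Sigma''$ of two semilinear spaces is the semilinear space whose points are the pairs $(P',P'')$ with $P'$ a point of $\Sigma'$ and $P''$ a point of $\Sigma''$, and whose lines are the sets $\{P'\}\times\ell''$ and $\ell'\times\{P''\}$ with $\ell',\ell''$ lines of $\Sigma',\Sigma''$ respectively. A g-map $f:S\to T$ is a map into $T$ defined on a subset $\mathbf D(f)$ of $S$; if $X\in S\setminus\mathbf D(f)$ one writes $Xf=\emptyset$. It is global if $\mathbf D(f)=S$. For a semilinear space $\Sigma$ with point set $\mathcal P$ and a projective space $\mathbb P'$, a linear morphism $\chi:\Sigma\to\mathbb P'$ is a g-map from $\mathcal P$ to the point set of $\mathbb P'$ such that: (L1) $(X\vee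 Y)\chi=X\chi\vee Y\chi$ for all $X,Y\in\mathcal P$ with $X\sim Y$; (L2) if $X,Y\in\mathbf D(\chi)$, $X\chi=Y\chi$, $X\neq Y$ and $X\sim Y$, then there is $A\in XY$ with $A\chi=\emptyset$. An embedding is a linear morphism that is global and injective. Square brackets $[\,\cdot\,]$ denote the projective closure (the subspace spanned), and $\operatorname{rk}\chi$ is the projective dimension of $[\mathcal P\chi]$. $\mathbb P_{m,F}$ is the $m$-dimensional projective space over $F$. The Grassmann space $\Gamma^{h}(\mathbb P_{N,F})$ is the semilinear space whose points are the $h$-dimensional (projective dimension) subspaces of $\mathbb P_{N,F}$ and whose lines are the pencils $\{X : A\subset X\subset B,\ \dim X=h\}$, with $A\subset B$ subspaces of projective dimensions $h-1$ and $h+1$. Let $\wp':\Gamma'\to\mathbb P_{n',F}$ and $\wp:\Gamma\to\mathbb P_{n,F}$ be the Plücker embeddings and $\gamma:\mathbb P_{n',F}\times\mathbb P_{n,F}\to\overline{\mathbb P}$ the Segre embedding, $\dim\overline{\mathbb P}=(n'+1)(n+1)-1$. The standard embedding of $\Gamma'\times\Gamma$ is $\phi:=(\wp'\times\wp)\gamma$ (first $\wp'\times\wp$, then $\gamma$). A collineation is an isomorphism of projective spaces (bijection on points mapping lines onto lines in both directions). Two sets of points in projective spaces over $F$ of the same dimension are projectively equivalent if one is mapped onto the other by a projectivity, i.e. a collineation induced by a linear bijection of the underlying $F$-vector spaces. (The existence of the collineation $\psi$ makes $\mathbb P'$ a projective space over $F$ of the same dimension as $\overline{\mathbb P}$.)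 *)

(* Defs.v *)
From mathcomp Require Import all_boot all_order all_algebra.
From mathcomp Require Import boolp classical_sets functions constructive_ereal.
From mathcomp Require Import zify.

Set Implicit Arguments.
Unset Strict Implicit.
Unset Printing Implicit Defensive.

Import Order.TTheory GRing.Theory Num.Theory.
Local Open Scope classical_set_scope.
Local Open Scope ring_scope.

Record geometry := Geometry {
  pt : Type;
  lines : set (set pt) }.

Arguments lines : clear implicits.

Definition semilinear_space (S : geometry) : Prop :=
  [/\ forall l, lines S l -> exists X Y : pt S, [/\ X <> Y, l X & l Y],
      \bigcup_(l in lines S) l = setT
    & forall l m, lines S l -> lines S m -> l <> m ->
        forall X Y, (l `&` m) X -> (l `&` m) Y -> X = Y].

Definition collinear (S : geometry) (X Y : pt S) : Prop :=
  exists l, [/\ lines S l, l X & l Y].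

(* In a semilinear space the union below runs over the lines X1X2 with
   X1 in M1 and X2 in M2 distinct and collinear. *)
Definition join (S : geometry) (M1 M2 : set (pt S)) : set (pt S) :=
  M1 `|` M2 `|`
  \bigcup_(l in [set l | lines S l /\
      exists X1 X2, [/\ M1 X1, M2 X2, X1 <> X2, l X1 & l X2]]) l.

Definition isomorphism (S T : geometry) (f : pt S -> pt T) : Prop :=
  exists g : pt T -> pt S,
    [/\ cancel f g, cancel g f,
        forall l, lines S l -> lines T (f @` l)
      & forall l, lines T l -> lines S (g @` l)].

Definition automorphism (S : geometry) (f : pt S -> pt S) : Prop :=
  @isomorphism S S f.

Definition prod_geometry (S T : geometry) : geometry :=
  @Geometry (pt S * pt T)
    [set l | (exists P' l'', lines T l'' /\ l = [set P'] `*` l'') \/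
             (exists l' P'', lines S l' /\ l = l' `*` [set P''])].

(* Veblen-Young axioms; no bound on the dimension, no coordinates. *)
Definition projective_space (P : geometry) : Prop :=
  [/\ forall X Y : pt P, X <> Y -> exists! l, [/\ lines P l, l X & l Y],
      forall l, lines P l -> exists X Y Z : pt P,
        [/\ l X, l Y, l Z & [/\ X <> Y, X <> Z & Y <> Z]]
    & forall (A B C D : pt P) (ab cd ac bd : set (pt P)),
        [/\ A <> B, C <> D, A <> C & B <> D] ->
        [/\ lines P ab, ab A & ab B] -> [/\ lines P cd, cd C & cd D] ->
        [/\ lines P ac, ac A & ac C] -> [/\ lines P bd, bd B & bd D] ->
        ab `&` cd !=set0 -> ac `&` bd !=set0].

Definition subspace (P : geometry) (U : set (pt P)) : Prop :=
  forall X Y l, U X -> U Y -> X <> Y -> lines P l -> l X -> l Y -> l `<=` U.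

Definition proj_span (P : geometry) (M : set (pt P)) : set (pt P) :=
  smallest (@subspace P) M.

Definition proj_basis (P : geometry) (U : set (pt P)) k (b : 'I_k -> pt P) : Prop :=
  (forall i, ~ proj_span (b @` [set j | j <> i]) (b i)) /\ proj_span (range b) = U.

(* One less than the size of a basis: -1 for the empty subspace, +oo when
   there is no finite basis. *)
Definition pdim (P : geometry) (U : set (pt P)) : \bar int :=
  let sizes := [set k | exists b : 'I_k -> pt P, proj_basis U b] in
  if `[< sizes !=set0 >] then ((xget 0%N sizes)%:Z - 1)%:E else +oo%E.

(* [f X = None] stands for "X f is empty". *)
Definition gmap (S T : Type) := S -> option T.

Definition gimage (S T : Type) (f : gmap S T) (M : set S) : set T :=
  [set Y | exists2 X, M X & f X = Some Y].

Definition gim (S T : Type) (f : gmap S T) : set T := gimage f setT.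

Definition global (S T : Type) (f : gmap S T) : Prop :=
  forall X, f X <> None.

Definition linear_morphism (S P : geometry) (chi : gmap (pt S) (pt P)) : Prop :=
  (forall X Y : pt S, collinear X Y ->
     gimage chi (join [set X] [set Y]) =
     join (gimage chi [set X]) (gimage chi [set Y])) /\
  (forall X Y : pt S, chi X <> None -> chi Y <> None -> chi X = chi Y ->
     X <> Y -> collinear X Y ->
     exists l A, [/\ lines S l, l X, l Y, l A & chi A = None]).

Definition embedding (S P : geometry) (chi : gmap (pt S) (pt P)) : Prop :=
  [/\ linear_morphism chi, global chi & injective chi].

Definition rk (S P : geometry) (chi : gmap (pt S) (pt P)) : \bar int :=
  pdim (proj_span (gim chi)).

(* The subspaces of vector dimension d, i.e. of projective dimension d - 1,
   of the m-dimensional projective space over F. *)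
Definition subsp (F : fieldType) (m d : nat) : Type :=
  {U : {vspace 'rV[F]_m.+1} | \dim U == d}.

Definition mk_subsp (F : fieldType) m d (U : {vspace 'rV[F]_m.+1})
  (dU : \dim U == d) : subsp F m d := exist _ U dU.

Definition PG (F : fieldType) (m : nat) : geometry :=
  @Geometry (subsp F m 1)
    [set l | exists L : subsp F m 2,
       l = [set X : subsp F m 1 | (val X <= val L)%VS]].

Definition grassmann (F : fieldType) (h N : nat) : geometry :=
  @Geometry (subsp F N h.+1)
    [set l | exists (A : subsp F N h) (B : subsp F N h.+2),
       (val A <= val B)%VS /\
       l = [set X : subsp F N h.+1 | (val A <= val X <= val B)%VS]].

Lemma vline_dim1 (F : fieldType) m (v : 'rV[F]_m.+1) :
  v != 0 -> \dim <[v]>%VS == 1%N.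
Proof. by move=> nz; rewrite dim_vline nz. Qed.

Definition vpoint (F : fieldType) m (v : 'rV[F]_m.+1) (nz : v != 0) :
  pt (PG F m) := exist _ <[v]>%VS (vline_dim1 nz).

Lemma vspace_out (F : fieldType) (vT : vectType F) (A B : {vspace vT}) :
  (\dim A < \dim B)%N -> exists2 v, v \in B & v \notin A.
Proof.
move=> lt; have /subvPn[v vB vA] : ~~ (B <= A)%VS.
  by apply: contraL lt => /dimvS; rewrite -leqNgt.
by exists v.
Qed.

Lemma dim_add_line (F : fieldType) (vT : vectType F) (A : {vspace vT}) v :
  v \notin A -> \dim (A + <[v]>)%VS = (\dim A).+1.
Proof.
move=> vA; rewrite dimv_disjoint_sum.
  by rewrite dim_vline (_ : v != 0) ?addn1 //; apply: contraNneq vA => ->; rewrite mem0v.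
apply/eqP; rewrite -subv0; apply/subvP => x /memv_capP[xA /vlineP[k xk]].
rewrite memv0; move: xA; rewrite xk; case: (eqVneq k 0) => [->|k0].
  by rewrite scale0r eqxx.
move=> kvA; case/negP: vA; rewrite -[v]scale1r -(mulVf k0) -scalerA.
exact: memvZ.
Qed.

Lemma dim_pred_sub (F : fieldType) (vT : vectType F) (X : {vspace vT}) h :
  \dim X = h.+1 -> exists2 A : {vspace vT}, (A <= X)%VS & \dim A = h.
Proof.
move=> dX; exists (X :\: <[vpick X]>)%VS; first exact: diffvSl.
have vX : (<[vpick X]> <= X)%VS by rewrite -memvE memv_pick.
have := dimv_cap_compl X <[vpick X]>; rewrite (capv_idPr vX) dim_vline.
by rewrite vpick0 -dimv_eq0 dX /= => -[].
Qed.

Lemma grassmann_semilinear (F : fieldType) h N :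
  (h < N)%N -> semilinear_space (grassmann F h N).
Proof.
move=> hN.
have dF : \dim {:'rV[F]_N.+1} = N.+1 by rewrite dimvf; exact: (etrans (dim_matrix _ _ _)) (mul1n _).
split.
- move=> _ [[A /= dA] [[B /= dB] [AB ->]]].
  have [v vB vA] : exists2 v, v \in B & v \notin A.
    by apply: vspace_out; rewrite (eqP dA) (eqP dB).
  have dX : \dim (A + <[v]>)%VS == h.+1 by rewrite dim_add_line ?(eqP dA).
  have [w wB wX] : exists2 w, w \in B & w \notin (A + <[v]>)%VS.
    by apply: vspace_out; rewrite (eqP dX) (eqP dB).
  have wA : w \notin A by apply: contra wX; apply: subvP; exact: addvSl.
  have dY : \dim (A + <[w]>)%VS == h.+1 by rewrite dim_add_line ?(eqP dA).
  exists (@mk_subsp _ _ _ _ dX), (@mk_subsp _ _ _ _ dY); split => /=.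
  + move=> /(congr1 val)/= e; case/negP: wX; rewrite e.
    by apply: (subvP (addvSr _ _)); exact: memv_line.
  + by rewrite addvSl subv_add AB.
  + by rewrite addvSl subv_add AB.
- apply/seteqP; split => // -[X dX] _.
  have [A AX dA] := dim_pred_sub (eqP dX).
  have [v _ vX] : exists2 v, v \in {:'rV[F]_N.+1}%VS & v \notin X.
    by apply: vspace_out; rewrite dF (eqP dX).
  have dB : \dim (X + <[v]>)%VS == h.+2 by rewrite dim_add_line ?(eqP dX).
  have {}dA : \dim A == h by apply/eqP.
  exists [set Z : subsp F N h.+1 | (A <= val Z <= X + <[v]>)%VS]; last first.
    by rewrite /= AX addvSl.
  by exists (@mk_subsp _ _ _ _ dA), (@mk_subsp _ _ _ _ dB); split; rewrite //= (subv_trans AX) ?addvSl.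
- move=> _ _ [[A dA] [[B dB] [AB ->]]] [[A' dA'] [[B' dB'] [AB' ->]]] ne.
  move=> [X dX] [Y dY] [] /= /andP[AX XB] /andP[A'X XB'] [] /andP[AY YB] /andP[A'Y YB'].
  apply: contrapT => XY; apply: ne.
  have lt : (\dim (X :&: Y) <= h)%N.
    rewrite leqNgt; apply/negP => lt; apply: XY.
    apply: val_inj => /=.
    have /eqP eX : (X :&: Y == X)%VS by rewrite eqEdim capvSl (eqP dX).
    have /eqP eY : (X :&: Y == Y)%VS by rewrite eqEdim capvSr (eqP dY).
    by rewrite -[LHS]eX.
  have gt : (h.+2 <= \dim (X + Y))%N.
    have := dimv_sum_cap X Y; rewrite (eqP dX) (eqP dY) => e.
    by move: e lt; set a := \dim _; set b := \dim _; lia.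
  have eA C (dC : \dim C == h) : (C <= X)%VS -> (C <= Y)%VS -> C = (X :&: Y)%VS.
    by move=> CX CY; apply/eqP; rewrite eqEdim subv_cap CX CY (eqP dC).
  have eB C (dC : \dim C == h.+2) : (X <= C)%VS -> (Y <= C)%VS -> C = (X + Y)%VS.
    by move=> CX CY; apply/eqP; rewrite eq_sym eqEdim subv_add CX CY (eqP dC).
  by rewrite /= (eA A) // (eA A') // (eB B) // (eB B').
Qed.

Lemma prod_semilinear S T :
  semilinear_space S -> semilinear_space T -> semilinear_space (prod_geometry S T).
Proof.
move=> [S2 Sc Sm] [T2 Tc Tm]; split.
- move=> _ [[P [l [/T2[X [Y [XY lX lY]]] ->]]]|[l [P [/S2[X [Y [XY lX lY]]] ->]]]].
    by exists (P, X), (P, Y); split => // -[].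
  by exists (X, P), (Y, P); split => // -[].
- apply/seteqP; split => // -[X Y] _.
  have [l lT lY] : (\bigcup_(l in lines T) l) Y by rewrite Tc.
  by exists ([set X] `*` l) => //; left; exists X, l.
- move=> _ _ [[P [l [Tl ->]]]|[l [P [Sl ->]]]] [[Q [m [Tm' ->]]]|[m [Q [Sm' ->]]]].
  + move=> ne [X1 X2] [Y1 Y2] [] [/= -> lX] [/= e mX] [] [/= -> lY] [/= _ mY].
    congr pair; apply: (Tm l m) => // lm; apply: ne; congr (_ `*` _) => //.
    by rewrite e.
  + by move=> _ [X1 X2] [Y1 Y2] [] [/= -> _] [/= _ ->] [] [/= -> _] [/= _ ->].
  + by move=> _ [X1 X2] [Y1 Y2] [] [/= _ ->] [/= -> _] [] [/= _ ->] [/= -> _].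
  + move=> ne [X1 X2] [Y1 Y2] [] [/= lX ->] [/= mX e] [] [/= lY ->] [/= mY _].
    congr pair; apply: (Sm l m) => // lm; apply: ne; congr (_ `*` _) => //.
    by rewrite e.
Qed.

Lemma PG_projective (F : fieldType) m : projective_space (PG F m).
Proof.
have dXY (X Y : subsp F m 1) : X <> Y -> \dim (val X + val Y)%VS == 2.
  case: X Y => [X dX] [Y dY] XY /=; rewrite dimv_disjoint_sum ?(eqP dX) ?(eqP dY) //.
  apply/eqP; rewrite -dimv_eq0 -leqn0 -ltnS ltnNge; apply/negP => lt; apply: XY.
  apply: val_inj => /=.
  have /eqP eX : (X :&: Y == X)%VS by rewrite eqEdim capvSl (eqP dX).
  have /eqP eY : (X :&: Y == Y)%VS by rewrite eqEdim capvSr (eqP dY).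
  by rewrite -[LHS]eX.
have un (X Y : subsp F m 1) (L : subsp F m 2) : X <> Y ->
    (val X <= val L)%VS -> (val Y <= val L)%VS -> (val X + val Y)%VS = val L.
  move=> /dXY d XL YL; apply/eqP; rewrite eqEdim subv_add XL YL (eqP d).
  by rewrite (eqP (valP L)).
split.
- move=> X Y XY; exists [set Z : subsp F m 1 | (val Z <= val X + val Y)%VS]; split.
    by split; rewrite /= ?addvSl ?addvSr //; exists (@mk_subsp _ _ _ _ (dXY _ _ XY)).
  by move=> _ [[L ->] /= XL YL]; rewrite (un X Y L).
- move=> _ [[L dL] ->].
  have [v vL] : exists2 v, v \in L & v \notin 0%VS.
    by apply: vspace_out; rewrite dimv0 (eqP dL).
  rewrite memv0 => v0.
  have [w wL wv] : exists2 w, w \in L & w \notin <[v]>%VS.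
    by apply: vspace_out; rewrite dim_vline v0 (eqP dL).
  have w0 : w != 0 by apply: contraNneq wv => ->; rewrite mem0v.
  have vw0 : v + w != 0.
    apply: contraNneq wv => /eqP; rewrite addrC addr_eq0 => /eqP->.
    by rewrite memvN memv_line.
  exists (vpoint v0), (vpoint w0), (vpoint vw0).
  split; rewrite /= -?memvE ?memvD //; split.
  + by move=> /(congr1 val)/= e; move: wv; rewrite e memv_line.
  + move=> /(congr1 val)/= e; case/negP: wv.
    by rewrite -[w](addrK v) memvB ?memv_line // addrC e memv_line.
  + move=> /(congr1 val)/= e; have : v \in <[w]>%VS.
      by rewrite -[v](addrK w) memvB ?memv_line // e memv_line.
    case/vlineP => k vk; case/negP: wv; apply/vlineP; exists k^-1.
    rewrite vk scalerA mulVf ?scale1r //.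
    by apply: contraNneq v0 => k0; rewrite vk k0 scale0r.
- move=> A B C D ab0 cd0 ac0 bd0 [AB CD AC BD] [[ab ->] Aab Bab] [[cd ->] Ccd Dcd].
  move=> [[ac ->] Aac Cac] [[bd ->] Bbd Dbd] [X [/= Xab Xcd]].
  have X1 : (0 < \dim (val ab :&: val cd))%N.
    apply: (@leq_trans (\dim (val X))); first by rewrite (eqP (valP X)).
    by rewrite dimvS // subv_cap Xab.
  have le3 : (\dim (val ac + val bd) <= \dim (val ab + val cd))%N.
    apply: dimvS; rewrite -(un A C ac) // -(un B D bd) // !subv_add.
    by rewrite !(subv_trans Aab, subv_trans Bab, subv_trans Ccd, subv_trans Dcd)
         ?addvSl ?addvSr.
  have : (0 < \dim (val ac :&: val bd))%N.
    have := dimv_sum_cap (val ac) (val bd); have := dimv_sum_cap (val ab) (val cd).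
    rewrite (eqP (valP ab)) (eqP (valP cd)) (eqP (valP ac)) (eqP (valP bd)).
    move: X1 le3; set a := \dim _; set b := \dim _; set c := \dim _.
    set d := \dim _; lia.
  move=> dpos.
  have nz : vpick (val ac :&: val bd)%VS != 0.
    by rewrite vpick0 -dimv_eq0 -lt0n.
  exists (vpoint nz); have := memv_pick (val ac :&: val bd)%VS.
  by rewrite memv_cap => /andP[].
Qed.

(* The projective dimension of the ambient space. *)
Definition plucker_dim (h N : nat) : nat := 'C(N.+1, h.+1).-1.

(* The i-th set of k column indices, for i < 'C(N.+1, k). *)
Definition nth_subset (N k i : nat) : {set 'I_N.+1} :=
  nth finset.set0 (enum [set A : {set 'I_N.+1} | #|A| == k]%SET) i.

Definition basis_mx (F : fieldType) N h (U : {vspace 'rV[F]_N.+1}) :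
  'M[F]_(h.+1, N.+1) := \matrix_(i, j) (vbasis U)`_i 0 j.

(* The maximal minors of a basis of U, whose choice only affects the vector by
   a nonzero factor. *)
Definition plucker_vec (F : fieldType) h N (U : subsp F N h.+1) :
  'rV[F]_(plucker_dim h N).+1 :=
  \row_i \det (colsub (fun j : 'I_h.+1 => nth ord0 (enum (nth_subset N h.+1 i)) j)
                      (basis_mx h (val U))).

Lemma basis_mx_free (F : fieldType) h N (U : subsp F N h.+1) :
  row_free (basis_mx h (val U)).
Proof.
case: U => U dU /=; apply/inj_row_free => v.
have /freeP fr : free (vbasis U) := basis_free (vbasisP U).
have e := eqP dU.
move=> v0; apply/rowP => i; rewrite mxE.
have := fr (fun i => v 0 (cast_ord e i)).
move=> /(_ _ (cast_ord (esym e) i)); rewrite cast_ordKV; apply.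
apply/rowP => j; have /rowP/(_ j) := v0; rewrite !mxE => sv0.
rewrite -[RHS]sv0.
rewrite summxE (reindex (cast_ord (esym e))) /=; last first.
  by exists (cast_ord e) => x _; rewrite ?cast_ordK ?cast_ordKV.
by apply: eq_bigr => k _; rewrite !mxE cast_ordKV.
Qed.

Lemma plucker_vec_neq0 (F : fieldType) h N (U : subsp F N h.+1) :
  plucker_vec U != 0.
Proof.
set A := basis_mx h (val U).
have fullA : row_full A^T by rewrite /row_full mxrank_tr; exact: basis_mx_free.
set f := fullrankfun fullA.
have f_inj : injective f := @fullrankfun_inj _ _ _ _ fullA.
have rfA : row_full (rowsub f A^T) by apply: fullrowsub_full.
pose S : {set 'I_N.+1} := [set f i | i in 'I_h.+1]%SET.
have cS : #|S| = h.+1 by rewrite card_imset ?card_ord.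
pose e := enum [set B : {set 'I_N.+1} | #|B| == h.+1]%SET.
have Se : S \in e by rewrite mem_enum inE cS.
have sze : size e = 'C(N.+1, h.+1) by rewrite -cardE card_draws card_ord.
have lt_i : (index S e < (plucker_dim h N).+1)%N.
  rewrite /plucker_dim -sze; move: Se; rewrite -index_mem => lt.
  by rewrite (ltn_predK lt).
apply/negP => /eqP/rowP/(_ (Ordinal lt_i)); rewrite !mxE /= /nth_subset.
rewrite nth_index // => /eqP; apply/negP.
rewrite -unitfE -[_ \is a _]/(_ \in unitmx) -unitmx_tr -row_full_unit.
set B := (X in row_full X).
rewrite -sub1mx; apply: submx_trans (_ : (rowsub f A^T <= B)%MS); first by rewrite sub1mx.
apply/row_subP => i.
have fS : f i \in enum S by rewrite mem_enum imset_f.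
have lt_k : (index (f i) (enum S) < h.+1)%N 
  by move: (fS); rewrite -index_mem -cardE cS.
suff -> : row i (rowsub f A^T) = row (Ordinal lt_k) B by exact: row_sub.
by apply/rowP => j; rewrite !mxE /= nth_index.
Qed.

Definition plucker (F : fieldType) h N (U : pt (grassmann F h N)) :
  pt (PG F (plucker_dim h N)) := vpoint (plucker_vec_neq0 U).

(* The projective dimension of the ambient space, (m' + 1)(m + 1) - 1. *)
Definition segre_dim (m' m : nat) : nat := (m'.+1 * m.+1).-1.

Definition segre_vec (F : fieldType) m' m
    (X : pt (prod_geometry (PG F m') (PG F m))) :
  'rV[F]_(segre_dim m' m).+1 :=
  mxvec ((vpick (val X.1))^T *m vpick (val X.2)).

Lemma segre_vec_neq0 (F : fieldType) m' m
    (X : pt (prod_geometry (PG F m') (PG F m))) : segre_vec X != 0.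
Proof.
case: X => [[U dU] [V dV]]; rewrite /segre_vec /=.
have uz k (W : {vspace 'rV[F]_k}) (dW : \dim W == 1%N) : vpick W != 0.
  by rewrite vpick0 -dimv_eq0 (eqP dW).
have /rV0Pn[i ui] := uz _ _ dU.
have /rV0Pn[j vj] := uz _ _ dV.
rewrite (_ : _ == _ = (mxvec ((vpick U)^T *m vpick V) == 0)) // mxvec_eq0.
apply/negP => /eqP/matrixP/(_ i j); rewrite !mxE big_ord1 !mxE => /eqP.
by rewrite mulf_eq0 (negPf ui) (negPf vj).
Qed.

Definition segre (F : fieldType) m' m
    (X : pt (prod_geometry (PG F m') (PG F m))) :
  pt (PG F (segre_dim m' m)) := vpoint (segre_vec_neq0 X).

Definition std_embedding (F : fieldType) h' N' h N
    (X : pt (prod_geometry (grassmann F h' N') (grassmann F h N))) :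
  pt (PG F (segre_dim (plucker_dim h' N') (plucker_dim h N))) :=
  @segre F (plucker_dim h' N') (plucker_dim h N) (plucker X.1, plucker X.2).

Definition projectivity (F : fieldType) m (pi : pt (PG F m) -> pt (PG F m)) :
  Prop :=
  exists2 g : 'End('rV[F]_m.+1), lker g == 0%VS &
    forall X, val (pi X) = (g @: val X)%VS.

(* Projective equivalence of a point set A of an abstract projective space P
   with a point set B of PG(m, F).  Speaking of projectivities between the two
   presupposes a structure of projective space over F on P, i.e. a collineation
   theta from PG(m, F) onto P. *)
Definition proj_equiv (F : fieldType) m (P : geometry)
    (theta : pt (PG F m) -> pt P) (A : set (pt P)) (B : set (pt (PG F m))) :
  Prop :=
  exists2 pi, projectivity pi & A = (theta \o pi) @` B.

(* Main.v *)
(** The product [Gamma' x Gamma] is generated by finitely many points, and the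
    image of the hyperplanes of an [h+2]-dimensional subspace is a projective
    space over [F] of dimension at least 2 in [P'].  Homogeneous coordinates over
    [F] on a subspace of dimension at least 2 extend to its join with a further
    point, so [P'] has coordinates over [F].  With respect to these, on each
    factor [eta] is [X |-> s(pl X) L], for the Plücker map [pl], a field
    automorphism [s] acting coordinatewise and a matrix [L]: on the hyperplanes of
    an [h+2]-dimensional subspace this is the fundamental theorem of projective
    geometry, and the formula extends from the subspaces of [F^m] to those of
    [F^(m+1)].  The automorphism on the second factor does not depend on the point
    of the first one, because the images of [{P} x l] and [{Q} x l] are skew lines
    for a line [l] and distinct collinear points [P], [Q].  Hence, after a
    normalisation, the matrix on the second factor is semilinear in [pl X'], and
    [eta (X', X) = (s(pl X') (x) t(pl X)) L].  The condition on the rank makes [L]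
    invertible, and [alpha] is the coordinatewise action of [s^-1 t].  Finally, the
    image of the standard embedding is invariant under coordinatewise
    automorphisms of [F], so changing the collineation [theta] by a field
    automorphism does not affect projective equivalence. *)
Require Import Defs.
From mathcomp Require Import all_boot all_order all_algebra.
From mathcomp Require Import boolp classical_sets functions constructive_ereal.
From HB Require Import structures.
From mathcomp Require Import zify ring.

(** The space [P'] is given by incidence axioms alone, without coordinates and without a dimension
    bound, so the field has to be carried into it; three homogeneous coordinates suffice to start,
    and [0 < h] supplies them.

    Plücker vectors are determined only up to a factor, so the formulas are proved for functions on
    free sequences, where a change of basis multiplies both sides by a definite scalar. Such a
    function, if additive in its first entry, is fixed by its values on unit vectors; this one
    principle ([alternating_ext]) yields the matrix for hyperplanes, the rows added with a new
    coordinate, and the matrix-valued function of the first factor.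

    Additivity is the recurring obstacle, since a coordinate vector carries a free factor. Within
    one factor it comes from fixing the factor at a reference point and comparing coefficients on
    two lines; a coefficient left unknown is settled by exchanging the summands.

    Of the two automorphisms [s] and [t] one can be absorbed into [psi], which acts on both factors
    at once; only their quotient is left for [alpha]. *)

Module GrassmannProducts.
Set Implicit Arguments.
Unset Strict Implicit.
Unset Printing Implicit Defensive.
Import Order.TTheory GRing.Theory Num.Theory.
Local Open Scope classical_set_scope.
Local Open Scope ring_scope.

(** * Homogeneous coordinates *)

Section LinearIndependence.
Variables (F : fieldType) (vT : vectType F).
Implicit Types (x y z : vT) (a b c : F).

Lemma free2E x y : free [:: x; y] = (y != 0) && (x \notin <[y]>%VS).
Proof. by rewrite free_cons span_seq1 seq1_free andbC. Qed.

Lemma lc_free2 x y a b : free [:: x; y] -> a *: x + b *: y = 0 -> a = 0 /\ b = 0.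
Proof.
move=> /freeP fr e; have := fr (fun i : 'I_2 => if i == ord0 then a else b).
rewrite !big_ord_recl big_ord0 /= addr0 => /(_ e) h.
by split; [exact: (h ord0) | exact: (h ord_max)].
Qed.

Lemma lc_free3 x y z a b c : free [:: x; y; z] ->
  a *: x + b *: y + c *: z = 0 -> [/\ a = 0, b = 0 & c = 0].
Proof.
move=> /freeP fr e.
have := fr (fun i : 'I_3 => if i == ord0 then a else if i == ord_max then c else b).
rewrite !big_ord_recl big_ord0 /= addr0 addrA => /(_ e) h.
by split; [exact: (h ord0) | exact: (h (lift ord0 ord0)) | exact: (h ord_max)].
Qed.

Lemma free2C x y : free [:: x; y] = free [:: y; x].
Proof. exact: perm_free (permEl (perm_catC [:: x] [:: y])). Qed.

Lemma free2I x y :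
  (forall a b, a *: x + b *: y = 0 -> a = 0 /\ b = 0) -> free [:: x; y].
Proof.
move=> h; apply/freeP => k; rewrite !big_ord_recl big_ord0 /= addr0 => /h[e1 e2] i.
have [->|] := eqVneq i ord0; first exact: e1.
by case: i => -[|[|]] // i _; rewrite -[RHS]e2; congr k; apply: val_inj.
Qed.

Lemma mem_span2P x y u :
  reflect (exists a b, u = a *: x + b *: y) (u \in <<[:: x; y]>>%VS).
Proof.
rewrite span_cons span_seq1; apply: (iffP memv_addP).
  by move=> [_ /vlineP[a ->]] [_ /vlineP[b ->]] ->; exists a, b.
move=> [a [b ->]]; exists (a *: x); first by rewrite memvZ ?memv_line.
by exists (b *: y); rewrite ?memvZ ?memv_line.
Qed.

End LinearIndependence.

Section ProjectiveGeometry.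
Variables (P : geometry) (hP : projective_space P).
Implicit Types X Y Z W : pt P.

Definition col3 X Y Z := exists l, [/\ lines P l, l X, l Y & l Z].

Lemma line_uniq X Y l m : X <> Y -> lines P l -> l X -> l Y ->
  lines P m -> m X -> m Y -> l = m.
Proof.
move=> XY hl lX lY hm mX mY; have [h _ _] := hP.
by have [k [_ u]] := h _ _ XY; rewrite -(u l) // -(u m).
Qed.

Lemma col3C12 X Y Z : col3 X Y Z -> col3 Y X Z.
Proof. by move=> [l [? ? ? ?]]; exists l. Qed.

Lemma col3C23 X Y Z : col3 X Y Z -> col3 X Z Y.
Proof. by move=> [l [? ? ? ?]]; exists l. Qed.

Lemma col3C13 X Y Z : col3 X Y Z -> col3 Z Y X.
Proof. by move=> [l [? ? ? ?]]; exists l. Qed.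

Lemma col3_id X Y : X <> Y -> col3 X Y Y.
Proof.
have [h _ _] := hP => XY; have [l [[? ? ?] _]] := h _ _ XY; by exists l.
Qed.

Lemma col3_trans X Y Z W : X <> Y -> col3 X Y Z -> col3 X Y W -> col3 X Z W.
Proof.
move=> XY [l [hl lX lY lZ]] [m [hm mX mY mW]].
by exists l; split=> //; rewrite (line_uniq XY hl lX lY hm mX mY).
Qed.

Lemma col3_four X Y Z W : X <> Y -> col3 X Y Z -> col3 X Y W ->
  col3 Z W X /\ col3 Z W Y.
Proof.
move=> XY [l [hl lX lY lZ]] [m [hm mX mY mW]].
by split; exists l; split=> //; rewrite (line_uniq XY hl lX lY hm mX mY).
Qed.

Lemma veblen A B C D O : A <> B -> C <> D -> A <> C -> B <> D ->
  col3 A B O -> col3 C D O -> exists Z, col3 A C Z /\ col3 B D Z.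
Proof.
move=> AB CD AC BD [ab [hab abA abB abO]] [cd [hcd cdC cdD cdO]].
have [h _ v] := hP.
have [ac [[hac acA acC] _]] := h _ _ AC.
have [bd [[hbd bdB bdD] _]] := h _ _ BD.
have [] := v A B C D ab cd ac bd; do ?by [].
  by exists O.
by move=> Z [acZ bdZ]; exists Z; split; [exists ac | exists bd].
Qed.

End ProjectiveGeometry.

(** * Affine coordinates around a point outside a coordinatised subspace *)

Section Extension.
Variables (P : geometry) (hP : projective_space P) (F : fieldType) (n : nat).

(* Coordinates on a subspace of [P]; the value of [phi] at [0] is junk. *)
Definition pemb m (phi : 'rV[F]_m -> pt P) :=
 [/\ forall v w, v != 0 -> w != 0 -> phi v = phi w -> w \in <[v]>%VS,
     forall c v, c != 0 -> phi (c *: v) = phi v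
   & forall L : {vspace 'rV[F]_m}, \dim L = 2%N -> exists2 l, lines P l &
       forall z, l z <-> exists u, [/\ u \in L, u != 0 & z = phi u] ].

Variables (phi : 'rV[F]_n -> pt P) (hphi : pemb phi).
Implicit Types (v w u e : 'rV[F]_n) (x y z p q : pt P).

Lemma pemb_eq v w : v != 0 -> w != 0 -> (phi v = phi w) <-> (w \in <[v]>%VS).
Proof.
have [h1 h2 _] := hphi => v0 w0; split; first exact: h1.
by case/vlineP=> c wc; rewrite wc h2 //; apply: contraNneq w0 => c0; rewrite wc c0 scale0r.
Qed.

Lemma pemb_scale c v : c != 0 -> phi (c *: v) = phi v.
Proof. by have [_ h _] := hphi; apply: h. Qed.

Lemma pemb_neq v w : free [:: w; v] -> phi v <> phi w.
Proof.
move=> fr e; have := fr; rewrite free2E => /andP[v0] /negP; apply.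
by have [h1 _ _] := hphi; apply: h1 => //; apply: free_not0 fr _; rewrite inE eqxx.
Qed.

Lemma pemb_line v w : free [:: v; w] -> exists2 l, lines P l &
  forall z, l z <-> exists u, [/\ u \in <<[:: v; w]>>%VS, u != 0 & z = phi u].
Proof. by move=> /eqP fr; have [_ _] := hphi; apply. Qed.

Lemma pemb_col v w u : free [:: v; w] -> u != 0 -> u \in <<[:: v; w]>>%VS ->
  col3 (phi v) (phi w) (phi u).
Proof.
move=> fr u0 uL; have [l hl lP] := pemb_line fr; exists l; split=> //; apply/lP.
- by exists v; rewrite memv_span ?inE ?eqxx // (free_not0 fr) ?inE ?eqxx.
- by exists w; rewrite memv_span ?inE ?eqxx ?orbT // (free_not0 fr) ?inE ?eqxx ?orbT.
- by exists u.
Qed.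

Lemma pemb_colP v w z : free [:: v; w] -> col3 (phi v) (phi w) z ->
  exists u, [/\ u \in <<[:: v; w]>>%VS, u != 0 & z = phi u].
Proof.
move=> fr [m [hm mv mw mz]]; have [l hl lP] := pemb_line fr.
apply/lP; rewrite (_ : l = m) //; apply: (line_uniq hP (X := phi v) (Y := phi w)) => //.
- by apply: pemb_neq; rewrite free2C.
- by apply/lP; exists v; rewrite memv_span ?inE ?eqxx // (free_not0 fr) ?inE ?eqxx.
- by apply/lP; exists w; rewrite memv_span ?inE ?eqxx ?orbT // (free_not0 fr) ?inE ?eqxx ?orbT.
Qed.

Definition inU z := exists2 v, v != 0 & z = phi v.

Lemma inU_col v w x : v != 0 -> w != 0 -> phi v <> phi w ->
  col3 (phi v) (phi w) x -> inU x.
Proof.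
move=> v0 w0 vw /pemb_colP[|u [_ u0 ->]]; last by exists u.
rewrite free2E w0 /=; apply: contra_notN vw => /(pemb_eq w0 v0).2 //.
Qed.

(** A coordinatised subspace contains every line joining two of its points, so a line through an
    outside point meets it at most once. *)
Lemma outU_col v w x : ~ inU x -> v != 0 -> w != 0 -> col3 x (phi v) (phi w) ->
  phi v = phi w.
Proof.
move=> xU v0 w0 c; apply: contrapT => vw; apply: xU.
by apply: (@inU_col v w) => //; apply/col3C23/col3C12.
Qed.

Lemma outU_uniq v w x y : ~ inU x -> v != 0 -> w != 0 -> x <> y ->
  col3 x y (phi v) -> col3 x y (phi w) -> phi v = phi w.
Proof. by move=> xU v0 w0 xy cv cw; apply: (@outU_col v w x) => //; apply: col3_trans xy _ _. Qed.

Variable p : pt P.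
Hypothesis pU : ~ inU p.

Lemma p_neq v : v != 0 -> p <> phi v.
Proof. by move=> v0 e; apply: pU; exists v. Qed.

(* [q] plays the role of the affine point with coordinate vector [e], with [p]
   as the origin; [affpt e q v x] says that [x] has coordinate vector [v]. *)
Definition affbase e q := [/\ e != 0, q <> p, q <> phi e & col3 p (phi e) q].
Definition affpt e q v x := col3 p (phi v) x /\ col3 q (phi (v - e)) x.

Section OneBase.
Variables (e : 'rV[F]_n) (q : pt P).
Hypothesis hb : affbase e q.

Lemma base_outU : ~ inU q.
Proof.
have [e0 qp qe c] := hb => -[w w0 qw]; apply: qe.
rewrite qw in c *; symmetry; exact: (outU_col pU) c.
Qed.

Lemma notin_neq0 v : v \notin <[e]>%VS -> v != 0.
Proof. by apply: contraNneq => ->; rewrite mem0v. Qed.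

Lemma notin_sub v : v \notin <[e]>%VS -> v - e \notin <[e]>%VS.
Proof. by apply: contra => h; rewrite -(subrK e v) memvD ?memv_line. Qed.

Lemma notin_phi_neq v : v \notin <[e]>%VS -> phi v <> phi (v - e).
Proof.
move=> ve h; have v0 := notin_neq0 ve; have w0 := notin_neq0 (notin_sub ve).
have [h1 _ _] := hphi; have /vlineP[c] := h1 _ _ v0 w0 h => ec.
have [c1|c1] := eqVneq c 1.
  move: ec; rewrite c1 scale1r => /eqP; rewrite -subr_eq0 addrAC subrr sub0r oppr_eq0.
  by have [/negPf->] := hb.
case/negP: ve; apply/vlineP; exists (1 - c)^-1; rewrite -[e in RHS](subKr v) ec.
rewrite -{2}[v]scale1r -scalerBl scalerA mulVf ?scale1r //.
by rewrite subr_eq0 eq_sym.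
Qed.

(** The lines [p q] and [phi v phi (v - e)] meet in [phi e], so Veblen's axiom makes the two lines
    that define the affine point meet. *)
Lemma affpt_ex v : v \notin <[e]>%VS -> exists x, affpt e q v x.
Proof.
have [e0 qp qe c] := hb; move=> ve.
have v0 := notin_neq0 ve; have w0 := notin_neq0 (notin_sub ve).
apply: (@veblen P hP p q (phi v) (phi (v - e)) (phi e)).
- by move=> pq; apply: qp.
- exact: notin_phi_neq.
- exact: p_neq.
- by move=> qv; apply: base_outU; exists (v - e).
- exact: col3C23.
apply: pemb_col => //.
  rewrite free2E w0; apply: contra_notN (notin_phi_neq ve) => h.
  by apply/esym/pemb_eq.
by apply/mem_span2P; exists 1, (-1); rewrite scale1r scaleN1r opprB addrC subrK.
Qed.

Lemma affpt_neq_p v x : v \notin <[e]>%VS -> affpt e q v x -> x <> p.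
Proof.
have [e0 qp qe c] := hb; move=> ve [_ c2] xp; rewrite xp in c2.
have v0 := notin_neq0 ve; have w0 := notin_neq0 (notin_sub ve).
have h : phi (v - e) = phi e.
  apply: (outU_uniq pU w0 e0 (y := q)); last exact: col3C23.
    by move=> pq; apply: qp.
  by apply/col3C23/col3C13.
by have := (pemb_eq w0 e0).1 h => /vlineP[k]; have := notin_sub ve;
   move=> + ek; apply/negP/negPn; have [h1 _ _] := hphi; exact: h1.
Qed.

Lemma affpt_outU v x : v \notin <[e]>%VS -> affpt e q v x -> ~ inU x.
Proof.
move=> ve [c1 c2] [u u0 xu]; rewrite xu in c1 c2.
have v0 := notin_neq0 ve; have w0 := notin_neq0 (notin_sub ve).
apply: (notin_phi_neq ve); rewrite (outU_col pU v0 u0 c1).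
by rewrite (outU_col base_outU w0 u0 c2).
Qed.

Lemma affpt_neq_q v x : v \notin <[e]>%VS -> affpt e q v x -> x <> q.
Proof.
have [e0 qp qe c] := hb; move=> ve [c1 _] xq; rewrite xq in c1.
have v0 := notin_neq0 ve.
have h : phi e = phi v.
  apply: (outU_uniq pU e0 v0 (y := q)); first by move=> pq; apply: qp.
    exact: col3C23.
  exact: col3C23.
by case/negP: ve; apply/pemb_eq.
Qed.

(** The point [x] fixes the direction of [v] as seen from [p] and that of [v - e] as seen from [q].
    Hence [w = c v] and [w - e = d (v - e)], and [c = d = 1] because [v] and [e] are independent. *)
Lemma affpt_inj v w x : v \notin <[e]>%VS -> w \notin <[e]>%VS ->
  affpt e q v x -> affpt e q w x -> v = w.
Proof.
move=> ve we Av Aw; have [[c1 c2] [c3 c4]] := (Av, Aw).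
have v0 := notin_neq0 ve; have w0 := notin_neq0 we.
have v'0 := notin_neq0 (notin_sub ve); have w'0 := notin_neq0 (notin_sub we).
have px : p <> x by move=> px; apply: (affpt_neq_p ve Av).
have qx : q <> x by move=> qx; apply: (affpt_neq_q ve Av).
have := outU_uniq pU v0 w0 px (col3C23 c1) (col3C23 c3).
move=> /(pemb_eq v0 w0).1 /vlineP[c wc].
have := outU_uniq base_outU v'0 w'0 qx (col3C23 c2) (col3C23 c4).
move=> /(pemb_eq v'0 w'0).1 /vlineP[d wd].
have fr : free [:: v; e] by rewrite free2E ve andbT; have [] := hb.
have [cd d1] : c - d = 0 /\ d - 1 = 0.
  apply: (lc_free2 fr); move/eqP: wd; rewrite -subr_eq0 wc => /eqP <-.
  by apply/rowP => i; rewrite !mxE; ring.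
by rewrite wc (subr0_eq cd) (subr0_eq d1) scale1r.
Qed.

(** Veblen's axiom with common point [o]: in the plane of [o], [x], [y] the line [x y] meets the
    line at infinity [phi v phi w]. *)
Lemma meet_line o v w x y : ~ inU o -> ~ inU x -> ~ inU y -> x <> y ->
  free [:: v; w] -> col3 o (phi v) x -> col3 o (phi w) y ->
  exists u, [/\ u \in <<[:: v; w]>>%VS, u != 0 & col3 x y (phi u)].
Proof.
move=> oU xU yU xy fr cx cy.
have v0 : v != 0 by apply: free_not0 fr _; rewrite inE eqxx.
have w0 : w != 0 by apply: free_not0 fr _; rewrite !inE eqxx orbT.
have vw : phi v <> phi w.
  by move/esym; apply: pemb_neq.
have [Z [c1 c2]] : exists Z, col3 x y Z /\ col3 (phi v) (phi w) Z.
  apply: (@veblen P hP x (phi v) y (phi w) o) => //.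
  - by move=> xv; apply: xU; exists v.
  - by move=> yw; apply: yU; exists w.
  - exact: col3C13.
  - exact: col3C13.
by have [u [uL u0 Zu]] := pemb_colP fr c2; exists u; rewrite -Zu.
Qed.

Lemma free_sub_tail v : v \notin <[e]>%VS -> free [:: v; e].
Proof. by move=> ve; rewrite free2E ve andbT; have [] := hb. Qed.

(** Seen from [p], the point at infinity of [x y] has its vector in the span of [v] and [w]; seen
    from [q], in the span of [v - e] and [w - e]. For independent [v], [w], [e] these two spans
    share only the multiples of [v - w]. *)
Lemma affpt_sub_gen v w x y : free [:: w; v; e] ->
  affpt e q v x -> affpt e q w y -> col3 x y (phi (v - w)).
Proof.
move=> fr Av Aw; have [[c1 c2] [c3 c4]] := (Av, Aw).
have /andP[wL frv] : (w \notin <<[:: v; e]>>%VS) && free [:: v; e] by rewrite -free_cons.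
have ve : v \notin <[e]>%VS by move: frv; rewrite free2E => /andP[].
have we : w \notin <[e]>%VS.
  by apply: contra wL; rewrite -span_seq1; apply/subvP/sub_span => z; rewrite !inE => ->; rewrite orbT.
have xy : x <> y.
  move=> xy; rewrite -xy in Aw; case/negP: wL.
  by rewrite -(affpt_inj ve we Av Aw) memv_span // inE eqxx.
have xU := affpt_outU ve Av; have yU := affpt_outU we Aw.
have indep a b c : a *: v + b *: w + c *: e = 0 -> [/\ a = 0, b = 0 & c = 0].
  by rewrite (addrC (a *: v)) => /(lc_free3 fr)[].
have frvw : free [:: v; w].
  by apply: free2I => a b h; have [] := indep a b 0; rewrite ?h ?scale0r ?addr0.
have [u [/mem_span2P[a [b uab]] u0 cu]] := meet_line pU xU yU xy frvw c1 c3.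
have frvw' : free [:: v - e; w - e].
  apply: free2I => a' b' h; have [] := indep a' b' (- a' - b') => //.
  by rewrite -[RHS]h; apply/rowP => i; rewrite !mxE; ring.
have [u' [/mem_span2P[a' [b' uab']] u'0 cu']] := meet_line base_outU xU yU xy frvw' c2 c4.
have /(pemb_eq u0 u'0).1/vlineP[c u'c] := outU_uniq xU u0 u'0 xy cu cu'.
have [ea eb ec] : [/\ a' - c * a = 0, b' - c * b = 0 & - a' - b' = 0].
  apply: indep; move/eqP: u'c; rewrite -subr_eq0 uab' uab => /eqP <-.
  by apply/rowP => i; rewrite !mxE; ring.
have eu' : u' = a' *: (v - w).
  have -> : u' = a' *: (v - w) + (- a' - b') *: (e - w).
    by rewrite uab'; apply/rowP => i; rewrite !mxE; ring.
  by rewrite ec scale0r addr0.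
rewrite eu' in cu' u'0; rewrite -(pemb_scale (c := a')) //.
by apply: contraNneq u'0 => ->; rewrite scale0r.
Qed.

Hypothesis n3 : (3 <= n)%N.

(** In the remaining position, [w] in the span of [v] and [e], a vector [z] outside that span (here
    [3 <= n] enters) gives a point [r] that replaces [q] as second centre: the direction of [x y]
    then lies in the spans of [v], [w] and of [v - z], [w - z]. If [w] is proportional to [v], both
    points lie on the line [p phi v]. *)
Lemma affpt_sub v w x y : v \notin <[e]>%VS -> w \notin <[e]>%VS -> v != w ->
  affpt e q v x -> affpt e q w y -> col3 x y (phi (v - w)).
Proof.
move=> ve we vw Av Aw.
have frv := free_sub_tail ve; have frw := free_sub_tail we.
have [wL|wL] := boolP (w \in <<[:: v; e]>>%VS); last first.
  by apply: affpt_sub_gen => //; rewrite free_cons wL.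
have v0 := notin_neq0 ve; have w0 := notin_neq0 we.
have xy : x <> y by move=> xy; rewrite -xy in Aw; move: vw; rewrite (affpt_inj ve we Av Aw) eqxx.
have [z _ zL] : exists2 z, z \in {:'rV[F]_n}%VS & z \notin <<[:: v; e]>>%VS.
  apply: vspace_out; rewrite (eqP frv) dimvf; apply: leq_trans n3 _.
  by rewrite /dim /= mul1n.
have frz : free [:: z; v; e] by rewrite free_cons zL.
have wLv : (<<[:: w; e]>> <= <<[:: v; e]>>)%VS.
  by apply/span_subvP => t; rewrite !inE => /orP[/eqP->//|/eqP->]; rewrite memv_span ?inE ?eqxx ?orbT.
have frz' : free [:: z; w; e] by rewrite free_cons frw andbT; apply: contra zL; apply/subvP.
have ze : z \notin <[e]>%VS.
  by apply: contra zL => /vlineP[k ->]; apply/memvZ/memv_span; rewrite !inE eqxx orbT.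
have [r Ar] := affpt_ex ze.
have c1 := col3C12 (affpt_sub_gen frz Av Ar).
have c2 := col3C12 (affpt_sub_gen frz' Aw Ar).
have [xU yU rU] := And3 (affpt_outU ve Av) (affpt_outU we Aw) (affpt_outU ze Ar).
have [a [b wab]] := mem_span2P _ _ _ wL.
have indep c d : c *: (v - z) + d *: (w - z) = 0 -> c = 0 /\ d = 0.
  move=> h; have e1 : (- c - d) *: z + (c + d * a) *: v + (d * b) *: e = 0.
    by rewrite -[RHS]h wab; apply/rowP => i; rewrite !mxE; ring.
  have [d1 d2 d3] := lc_free3 frz e1.
  have e4 : d *: (w - v) = 0.
    rewrite wab; have -> : d *: (a *: v + b *: e - v) = (- c - d + (c + d * a)) *: v + (d * b) *: e.
      by apply/rowP => i; rewrite !mxE; ring.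
    by rewrite d1 d2 d3 addr0 !scale0r addr0.
  have d0 : d = 0.
    by move/eqP: e4; rewrite scaler_eq0 subr_eq0 (eq_sym w) (negPf vw) orbF => /eqP.
  by move: d1; rewrite d0 subr0 => /eqP; rewrite oppr_eq0 => /eqP.
have [u [/mem_span2P[c [d ucd]] u0 cu]] := meet_line rU xU yU xy (free2I indep) (col3C23 c1) (col3C23 c2).
have [[c3 _] [c4 _]] := (Av, Aw).
have [wv|wv] := boolP (w \in <[v]>%VS).
  have e1 := (pemb_eq v0 w0).2 wv; rewrite -e1 in c4.
  have [k wk] := vlineP _ _ wv.
  rewrite wk -{1}[v]scale1r -scalerBl pemb_scale; last first.
    by apply: contraNneq vw => /eqP; rewrite subr_eq0 => /eqP k1; rewrite wk -k1 scale1r.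
  exact: (col3_four hP (p_neq v0) c3 c4).2.
have frvw : free [:: v; w] by rewrite free2C free2E v0.
have [u' [/mem_span2P[a' [b' uab']] u'0 cu']] := meet_line pU xU yU xy frvw c3 c4.
have /(pemb_eq u'0 u0).1/vlineP[k uk] := outU_uniq xU u'0 u0 xy cu' cu.
have eu : u = c *: (v - w) + (c + d) *: (w - z).
  by rewrite ucd; apply/rowP => i; rewrite !mxE; ring.
have [cd _ _] : [/\ - (c + d) = 0, c + d * a - k * a' - k * (b' * a) = 0
    & d * b - k * (b' * b) = 0].
  apply: (lc_free3 frz); move/eqP: uk; rewrite -subr_eq0 ucd uab' wab => /eqP <-.
  by apply/rowP => i; rewrite !mxE; ring.
move/eqP: cd; rewrite oppr_eq0 => /eqP cd; rewrite cd scale0r addr0 in eu.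
rewrite eu in cu u0; rewrite -(pemb_scale (c := c)) //.
by apply: contraNneq u0 => ->; rewrite scale0r.
Qed.

End OneBase.

Hypothesis n3 : (3 <= n)%N.

(** By [affpt_sub] the line [q2 x] has direction [v - e2], so the new base constructs the same
    affine points wherever both bases apply. *)
Lemma affbase_change e1 q1 e2 q2 : affbase e1 q1 -> e2 \notin <[e1]>%VS ->
  affpt e1 q1 e2 q2 -> affbase e2 q2 /\
  forall v x, v \notin <[e1]>%VS -> v \notin <[e2]>%VS -> affpt e1 q1 v x -> affpt e2 q2 v x.
Proof.
move=> hb e21 A2; have e20 := notin_neq0 e21; have [c1 c2] := A2; split.
  split=> //; first exact: affpt_neq_p e21 A2.
  by move=> h; apply: (affpt_outU hb e21 A2); exists e2.
move=> v x v1 v2 Av; split; first by case: Av.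
have vn : v != e2 by apply: contraNneq v2 => ->; rewrite memv_line.
exact: col3C23 (col3C12 (affpt_sub hb n3 v1 e21 vn Av A2)).
Qed.

Lemma affbase_ex e : e != 0 -> exists q, affbase e q.
Proof.
move=> e0; have pe := p_neq e0; have [h1 h2 _] := hP.
have [l [[hl lp le] _]] := h1 _ _ pe.
suff [q [lq qp qe]] : exists q, [/\ l q, q <> p & q <> phi e].
  by exists q; split=> //; exists l.
have [X [Y [Z [lX lY lZ [XY XZ YZ]]]]] := h2 _ hl.
have [Xp|Xp] := pselect (X = p).
  have [Ye|Ye] := pselect (Y = phi e).
    by exists Z; split=> // h; [apply: XZ; rewrite h|apply: YZ; rewrite h].
  by exists Y; split=> // h; apply: XY; rewrite h.
have [Xe|Xe] := pselect (X = phi e); last by exists X.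
have [Yp|Yp] := pselect (Y = p); last by exists Y; split=> // h; apply: XY; rewrite h.
by exists Z; split=> // h; [apply: YZ; rewrite h|apply: XZ; rewrite h].
Qed.

(* [affpt e q] is only defined outside the line of [e]; three independent [e]
   are enough for any two nonzero vectors to lie in the domain of one of them. *)
Lemma affine_coordinates : exists a : 'rV[F]_n -> pt P,
  [/\ a 0 = p, forall v, ~ inU (a v), forall v w, v != w -> a v <> a w &
   forall v w, v != w -> col3 (a v) (a w) (phi (v - w))].
Proof.
have [e1 [e2 [e3 fr]]] : exists e1 e2 e3 : 'rV[F]_n, free [:: e1; e2; e3].
  have dV : \dim {:'rV[F]_n} = n by rewrite dimvf /dim /= mul1n.
  have [e1 _ h1] : exists2 e, e \in {:'rV[F]_n}%VS & e \notin 0%VS.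
    by apply: vspace_out; rewrite dimv0 dV; apply: leq_trans n3.
  have fr1 : free [:: e1] by rewrite seq1_free -memv0.
  have [e2 _ h2] : exists2 e, e \in {:'rV[F]_n}%VS & e \notin <<[:: e1]>>%VS.
    by apply: vspace_out; rewrite (eqP fr1) dV; apply: leq_trans n3.
  have fr2 : free [:: e2; e1] by rewrite free_cons h2.
  have [e3 _ h3] : exists2 e, e \in {:'rV[F]_n}%VS & e \notin <<[:: e2; e1]>>%VS.
    by apply: vspace_out; rewrite (eqP fr2) dV; apply: leq_trans n3.
  by exists e3, e2, e1; rewrite free_cons h3.
have nn (x y v : 'rV[F]_n) : free [:: x; y] -> v != 0 -> v \in <[x]>%VS -> v \in <[y]>%VS -> False.
  move=> frxy v0 /vlineP[k vk] /vlineP[l vl].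
  have [k0 _] : k = 0 /\ - l = 0.
    by apply: (lc_free2 frxy); rewrite scaleNr -vk -vl subrr.
  by move: v0; rewrite vk k0 scale0r eqxx.
have f12 : free [:: e1; e2].
  by apply: free2I => a b h; have [] := lc_free3 (a := a) (b := b) (c := 0) fr; rewrite ?scale0r ?addr0.
have f13 : free [:: e1; e3].
  by apply: free2I => a b h; have [] := lc_free3 (a := a) (b := 0) (c := b) fr; rewrite ?scale0r ?addr0.
have f23 : free [:: e2; e3].
  by apply: free2I => a b h; have [] := lc_free3 (a := 0) (b := a) (c := b) fr; rewrite ?scale0r ?add0r.
have n21 : e2 \notin <[e1]>%VS by move: f12; rewrite free2C free2E => /andP[].
have n31 : e3 \notin <[e1]>%VS by move: f13; rewrite free2C free2E => /andP[].
have n32 : e3 \notin <[e2]>%VS by move: f23; rewrite free2C free2E => /andP[].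
have e10 : e1 != 0 by move: f12; rewrite free2C free2E => /andP[].
have [q1 b1] := affbase_ex e10.
have [q2 A2] := affpt_ex b1 n21; have [b2 h12] := affbase_change b1 n21 A2.
have [q3 A3] := affpt_ex b1 n31; have [b3 h13] := affbase_change b1 n31 A3.
(* The third base is compared with the second as well, because on the line of [e1] the first base
   constructs nothing. *)
have [_ h23] := affbase_change b2 n32 (h12 _ _ n31 n32 A3).
pose AA v x := [/\ v = 0 -> x = p, v \notin <[e1]>%VS -> affpt e1 q1 v x,
  v \notin <[e2]>%VS -> affpt e2 q2 v x & v \notin <[e3]>%VS -> affpt e3 q3 v x].
have exA v : exists x, AA v x.
  have [->|v0] := eqVneq v 0; first by exists p; split; rewrite ?mem0v.
  have [v1|v1] := boolP (v \in <[e1]>%VS).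
    have v2 : v \notin <[e2]>%VS by apply/negP => v2; exact: (nn _ _ _ f12 v0).
    have v3 : v \notin <[e3]>%VS by apply/negP => v3; exact: (nn _ _ _ f13 v0).
    have [x Ax] := affpt_ex b2 v2; exists x; split=> [vv|h|//|_].
    - by rewrite vv eqxx in v0.
    - by rewrite v1 in h.
    - exact: h23.
  have [x Ax] := affpt_ex b1 v1; exists x; split=> [vv|//|v2|v3].
  - by rewrite vv eqxx in v0.
  - exact: h12.
  - exact: h13.
have [a ha] := choice exA.
have a0 : a 0 = p by case: (ha 0) => /(_ erefl).
have one v : v != 0 -> exists e q, [/\ affbase e q, v \notin <[e]>%VS & affpt e q v (a v)].
  move=> v0; have [_ h1 h2 h3] := ha v.
  have [v1|v1] := boolP (v \in <[e1]>%VS); last by exists e1, q1; split=> //; apply: h1.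
  have v2 : v \notin <[e2]>%VS by apply/negP => v2; exact: (nn _ _ _ f12 v0).
  by exists e2, q2; split=> //; apply: h2.
have two v w : v != 0 -> w != 0 -> exists e q, [/\ affbase e q, v \notin <[e]>%VS,
    w \notin <[e]>%VS & affpt e q v (a v) /\ affpt e q w (a w)].
  move=> v0 w0; have [_ h1 h2 h3] := ha v; have [_ k1 k2 k3] := ha w.
  have [vw1|] := boolP ((v \notin <[e1]>%VS) && (w \notin <[e1]>%VS)).
    by case/andP: vw1 => v1 w1; exists e1, q1; split=> //; split; [apply: h1|apply: k1].
  have [vw1 _|] := boolP ((v \notin <[e2]>%VS) && (w \notin <[e2]>%VS)).
    by case/andP: vw1 => v1 w1; exists e2, q2; split=> //; split; [apply: h2|apply: k2].
  have [vw1 _ _|] := boolP ((v \notin <[e3]>%VS) && (w \notin <[e3]>%VS)).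
    by case/andP: vw1 => v1 w1; exists e3, q3; split=> //; split; [apply: h3|apply: k3].
  (* A nonzero vector lies on at most one of the three lines, so two vectors exclude at most two
     bases; what remains is Boolean. *)
  have := nn _ _ v f12 v0; have := nn _ _ v f13 v0; have := nn _ _ v f23 v0.
  have := nn _ _ w f12 w0; have := nn _ _ w f13 w0; have := nn _ _ w f23 w0.
  case: (v \in <[e1]>%VS); case: (v \in <[e2]>%VS); case: (v \in <[e3]>%VS);
  case: (w \in <[e1]>%VS); case: (w \in <[e2]>%VS); case: (w \in <[e3]>%VS) => //= g1 g2 g3 g4 g5 g6;
  exfalso; auto.
have aU v : ~ inU (a v).
  have [->|v0] := eqVneq v 0; first by rewrite a0.
  by have [e [q [b ve Av]]] := one _ v0; exact (affpt_outU b ve Av).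
exists a; split=> // v w vw.
  have [v0|v0] := eqVneq v 0; have [w0|w0] := eqVneq w 0.
  - by rewrite v0 w0 eqxx in vw.
  - have [e [q [b ve Av]]] := one _ w0; rewrite v0 a0 => h.
    by apply: (affpt_neq_p b ve Av).
  - have [e [q [b ve Av]]] := one _ v0; rewrite w0 a0 => h.
    by apply: (affpt_neq_p b ve Av).
  - have [e [q [b ve we [Av Aw]]]] := two _ _ v0 w0 => h; rewrite -h in Aw.
    by rewrite (affpt_inj b ve we Av Aw) eqxx in vw.
have [v0|v0] := eqVneq v 0; have [w0|w0] := eqVneq w 0.
- by rewrite v0 w0 eqxx in vw.
- have [e [q [b ve [c _]]]] := one _ w0; rewrite v0 a0 sub0r -scaleN1r pemb_scale ?oppr_eq0 ?oner_eq0 //.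
  exact: col3C23.
- have [e [q [b ve [c _]]]] := one _ v0; rewrite w0 a0 subr0.
  exact/col3C13/col3C12.
- have [e [q [b ve we [Av Aw]]]] := two _ _ v0 w0.
  exact: (affpt_sub b n3 ve we vw Av Aw).
Qed.

End Extension.

(** * Homogeneous coordinates on the join of a subspace and a point *)

Section ExtensionByAPoint.
Variables (P : geometry) (hP : projective_space P) (F : fieldType) (n : nat).
Variables (phi : 'rV[F]_n -> pt P) (hphi : pemb phi).
Hypothesis n3 : (3 <= n)%N.
Variable a : 'rV[F]_n -> pt P.
Hypothesis aU : forall v, ~ inU phi (a v).
Hypothesis a_inj : forall v w, v != w -> a v <> a w.
Hypothesis a_dir : forall v w, v != w -> col3 (a v) (a w) (phi (v - w)).
Implicit Types (v w u : 'rV[F]_n) (x y z : pt P).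

Lemma dir_fwd v w c : w != 0 -> c != 0 -> col3 (a v) (phi w) (a (v + c *: w)).
Proof.
move=> w0 c0; have vv : v != v + c *: w.
  by rewrite -subr_eq0 opprD addrA subrr sub0r oppr_eq0 scaler_eq0 negb_or c0.
have := a_dir vv; rewrite opprD addrA subrr sub0r -scaleNr (pemb_scale hphi) ?oppr_eq0 //.
exact: col3C23.
Qed.

(** The danger is a line with more points than parameters in [F]. Joining [z] to an affine point
    [a (v + w2)] off the line gives a second line through [z] whose direction is a combination of
    [w] and [w2], and this combination reveals the parameter. *)
Lemma dir_bwd v w z : w != 0 -> col3 (a v) (phi w) z -> z = phi w \/ exists c, z = a (v + c *: w).
Proof.
move=> w0 cz; have [?|zw] := pselect (z = phi w); [by left|right].
have [zv|zv] := pselect (z = a v); first by exists 0; rewrite scale0r addr0.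
have zU : ~ inU phi z.
  move=> [u u0 zu]; apply: zw; rewrite zu in cz *; symmetry.
  exact: (outU_col hP hphi (@aU v) w0 u0 cz).
have [w2 _ w2w] : exists2 w2, w2 \in {:'rV[F]_n}%VS & w2 \notin <[w]>%VS.
  apply: vspace_out; rewrite dimvf /dim /= mul1n dim_vline w0.
  by apply: leq_trans n3.
have w20 : w2 != 0 by apply: contraNneq w2w => ->; rewrite mem0v.
have fr : free [:: w2; w] by rewrite free2E w0.
have phiw : phi w <> phi w2 by move/(pemb_eq hphi w0 w20).1; apply/negP.
have c2 : col3 (a v) (phi w2) (a (v + w2)).
  by rewrite -[w2 in v + w2]scale1r; apply: dir_fwd => //; rewrite oner_eq0.
have vx : a v <> a (v + w2).
  by apply: a_inj; rewrite -subr_eq0 opprD addrA subrr sub0r oppr_eq0.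
have zx : z <> a (v + w2).
  move=> zx; rewrite zx in cz; apply: phiw.
  by apply: (outU_uniq hP hphi (@aU v) w0 w20 vx); exact: col3C23.
rewrite free2C in fr.
have [u [/mem_span2P[c [d ucd]] u0 cu]] :=
  meet_line hP hphi (@aU v) zU (@aU (v + w2)) zx fr cz c2.
have uw : phi w <> phi u.
  move=> uw; rewrite -uw in cu; apply: phiw.
  have c4 := (col3_four hP zw (col3C23 cu) (col3C13 cz)).2.
  by apply: (outU_uniq hP hphi (@aU v) w0 w20 vx); [exact: col3C12|exact: col3C23].
have d0 : d != 0.
  apply: contra_notN uw => /eqP d0; apply/(pemb_eq hphi w0 u0); apply/vlineP; exists c.
  by rewrite ucd d0 scale0r addr0.
(* With this [t], [v + t *: w] equals [v + w2 - d^-1 *: u], so its point lies on both lines through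
   [z]; these differ, hence the point is [z]. *)
exists (- (c / d)); set t := - (c / d).
have cy : col3 (a v) (phi w) (a (v + t *: w)).
  have [t0|t0] := eqVneq t 0; last exact: dir_fwd.
  rewrite t0 scale0r addr0; apply/col3C12.
  by apply: (col3_id hP) => h; apply: (@aU v); exists w.
have cyu : col3 (a (v + w2)) (phi u) (a (v + t *: w)).
  have -> : v + t *: w = v + w2 + (- d^-1) *: u.
    by rewrite ucd /t; apply/rowP => i; rewrite !mxE; field.
  by apply: dir_fwd => //; rewrite oppr_eq0 invr_eq0.
apply: contrapT => zy; apply: uw.
apply: (outU_uniq hP hphi zU w0 u0 zy).
  apply: (col3_four hP (X := a v) _ cz cy).2.
  by move=> h; apply: (@aU v); exists w.
apply: (col3_four hP (X := a (v + w2)) _ (col3C12 (col3C13 cu)) cyu).2.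
by move=> h; apply: (@aU (v + w2)); exists u.
Qed.

(** Homogenisation: vectors with first entry 0 are the directions, that is, the old subspace; all
    others are affine points, scaled to first entry 1. *)
Definition ext_phi (x : 'rV[F]_(1 + n)) : pt P :=
  let t := lsubmx x 0 0 in
  if t == 0 then phi (rsubmx x) else a (t^-1 *: rsubmx x).

Lemma ext_phi0 v : ext_phi (row_mx 0 v) = phi v.
Proof. by rewrite /ext_phi row_mxKl row_mxKr mxE eqxx. Qed.

Lemma ext_phi1 v : ext_phi (row_mx 1%:M v) = a v.
Proof. by rewrite /ext_phi row_mxKl row_mxKr mxE eqxx oner_eq0 invr1 scale1r. Qed.

Lemma ext_phiZ c (x : 'rV[F]_(1 + n)) : c != 0 -> ext_phi (c *: x) = ext_phi x.
Proof.
move=> c0; rewrite /ext_phi !linearZ /= mxE mulf_eq0 (negPf c0) /=.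
case: eqVneq => [_|t0]; first exact: (pemb_scale hphi).
by rewrite scalerA invfM mulrA mulfV // mul1r.
Qed.

Lemma rV_split (x : 'rV[F]_(1 + n)) :
  (exists v, x = row_mx 0 v) \/ (exists c v, c != 0 /\ x = c *: row_mx 1%:M v).
Proof.
have lx : lsubmx x = (lsubmx x 0 0)%:M by rewrite -mx11_scalar.
have [t0|t0] := eqVneq (lsubmx x 0 0) 0.
  left; exists (rsubmx x); rewrite -[LHS]hsubmxK lx t0; congr row_mx.
  by apply/matrixP => i j; rewrite !mxE mul0rn.
right; exists (lsubmx x 0 0), ((lsubmx x 0 0)^-1 *: rsubmx x); split=> //.
rewrite scale_row_mx scalerA mulfV // scale1r scale_scalar_mx mulr1 -lx.
by rewrite hsubmxK.
Qed.

Lemma dim2_span (vT : vectType F) (L : {vspace vT}) (x y : vT) : \dim L = 2%N ->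
  x \in L -> y \in L -> free [:: x; y] -> L = <<[:: x; y]>>%VS.
Proof.
move=> dL xL yL fr; apply/eqP; rewrite eq_sym eqEdim (eqP fr) dL leqnn andbT.
by apply/span_subvP => z; rewrite !inE => /orP[]/eqP->.
Qed.

Lemma pemb_ext : pemb ext_phi.
Proof.
split.
- move=> x y; case: (rV_split x) => [[v ->]|[c [v [c0 ->]]]];
    case: (rV_split y) => [[w ->]|[d [w [d0 ->]]]];
    rewrite ?scaler_eq0 ?negb_or ?ext_phiZ // ?ext_phi0 ?ext_phi1 !row_mx_eq0 ?eqxx /=.
  + move=> v0 w0 /(pemb_eq hphi v0 w0).1/vlineP[k ->].
    by apply/vlineP; exists k; rewrite scale_row_mx scaler0.
  + move=> v0 _ h; by case: (@aU w); exists v.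
  + move=> _ w0 h; by case: (@aU v); exists w.
  + move=> _ _ h; have [<-|vw] := eqVneq v w; last by case: (a_inj vw).
    apply/vlineP; exists (d / c); rewrite scalerA divfK //.
- by move=> c v; exact: ext_phiZ.
have row10 v : row_mx 1%:M v != 0 :> 'rV[F]_(1 + n).
  rewrite row_mx_eq0 negb_and; apply/orP; left; apply/eqP => /matrixP/(_ 0 0)/eqP.
  by rewrite !mxE eqxx oner_eq0.
have ex2 (L : {vspace 'rV[F]_(1 + n)}) (x : 'rV[F]_(1 + n)) : \dim L = 2%N -> x != 0 ->
    exists2 y, y \in L & free [:: x; y].
  move=> dL x0; have [y yL yx] : exists2 y, y \in L & y \notin <[x]>%VS.
    by apply: vspace_out; rewrite dL dim_vline x0.
  by exists y; rewrite // free2C free2E x0.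
(* Either [L] contains a vector with first entry 1 and describes an affine line together with its
   direction, or it lies within the old coordinates. *)
move=> L dL; have [[v xL]|hL] := pselect (exists v, row_mx 1%:M v \in L).
  have [w [w0 yL]] : exists w, w != 0 /\ row_mx 0 w \in L.
    have [y yL fr] := ex2 _ _ dL (row10 v).
    have y0 : y != 0 by apply: free_not0 fr _; rewrite !inE eqxx orbT.
    case: (rV_split y) => [[w yw]|[c [w [c0 yw]]]].
      by exists w; rewrite -yw yL; move: y0; rewrite yw row_mx_eq0 eqxx.
    exists (w - v); have e : row_mx 0 (w - v) = c^-1 *: y - row_mx 1%:M v.
      by rewrite yw scalerA mulVf // scale1r opp_row_mx add_row_mx subrr.
    rewrite e memvB ?memvZ //; split=> //; apply/eqP => wv.
    have : c^-1 *: y - row_mx 1%:M v = 0 by rewrite -e wv row_mx0.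
    move=> /eqP; rewrite addrC -scaleN1r => /eqP h.
    by have [/eqP] := lc_free2 fr h; rewrite oppr_eq0 oner_eq0.
  have fr : free [:: row_mx 1%:M v; row_mx 0 w].
    apply: free2I => c d /eqP; rewrite !scale_row_mx add_row_mx row_mx_eq0 scaler0 addr0.
    case/andP => /eqP/matrixP/(_ 0 0)/eqP; rewrite !mxE mulr1 => /eqP ->.
    by rewrite scale0r add0r scaler_eq0 (negPf w0) orbF => /eqP.
  have eL := dim2_span dL xL yL fr.
  have aw : a v <> phi w by move=> h; apply: (@aU v); exists w.
  have [l [hl la lw _]] := col3_id hP aw; exists l => // z; split.
    move=> lz; have cz : col3 (a v) (phi w) z by exists l.
    have [->|[c ->]] := dir_bwd w0 cz.
      by exists (row_mx 0 w); rewrite ext_phi0 row_mx_eq0 eqxx.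
    exists (row_mx 1%:M (v + c *: w)); rewrite ext_phi1 row10; split=> //.
    rewrite (_ : row_mx _ _ = row_mx 1%:M v + c *: row_mx 0 w) ?memvD ?memvZ //.
    by rewrite scale_row_mx add_row_mx scaler0 addr0.
  move=> [u [uL u0 ->]]; move: uL; rewrite eL => /mem_span2P[c [d uE]].
  have [c0|c0] := eqVneq c 0.
    move: u0; rewrite uE c0 scale0r add0r scaler_eq0 negb_or => /andP[d0 _].
    by rewrite ext_phiZ // ext_phi0.
  have -> : ext_phi u = a (v + (d / c) *: w).
    rewrite -ext_phi1 -[RHS](ext_phiZ _ c0); congr ext_phi.
    rewrite uE !scale_row_mx add_row_mx scaler0 addr0 scalerDr scalerA mulrCA mulfV //.
    by rewrite mulr1.
  have [t0|t0] := eqVneq (d / c) 0; first by rewrite t0 scale0r addr0.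
  have [m [hm ma mw mz]] := dir_fwd v w0 t0.
  by rewrite (line_uniq hP aw hl la lw hm ma mw).
have in0 (u : 'rV[F]_(1 + n)) : u \in L -> exists v, u = row_mx 0 v.
  move=> uL; case: (rV_split u) => // -[c [v [c0 uE]]]; case: hL; exists v.
  by rewrite (_ : row_mx _ _ = c^-1 *: u) ?memvZ // uE scalerA mulVf // scale1r.
have [x xL x0] : exists2 x, x \in L & x \notin 0%VS.
  by apply: vspace_out; rewrite dimv0 dL.
rewrite memv0 in x0; have [y yL fr] := ex2 _ _ dL x0.
have eL := dim2_span dL xL yL fr.
have [[v xE] [w yE]] := (in0 _ xL, in0 _ yL).
have frvw : free [:: v; w].
  apply: free2I => c d h; apply: (lc_free2 fr).
  by rewrite xE yE !scale_row_mx add_row_mx !scaler0 addr0 h row_mx0.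
have [l hl lP] := pemb_line hphi frvw; exists l => // z; split.
  move=> /lP[u [/mem_span2P[c [d uE]] u0 ->]]; exists (row_mx 0 u).
  rewrite ext_phi0 row_mx_eq0 eqxx u0 eL; split=> //; apply/mem_span2P; exists c, d.
  by rewrite xE yE !scale_row_mx add_row_mx !scaler0 addr0 uE.
move=> [u [uL u0 ->]]; move: uL u0; rewrite eL => /mem_span2P[c [d ->]].
rewrite xE yE !scale_row_mx add_row_mx !scaler0 addr0 row_mx_eq0 eqxx /= => u0.
by apply/lP; exists (c *: v + d *: w); rewrite ext_phi0; split=> //; apply/mem_span2P; exists c, d.
Qed.
End ExtensionByAPoint.

Section Coordinatization.
Variables (P : geometry) (hP : projective_space P) (F : fieldType).

Lemma pemb_extend n (phi : 'rV[F]_n -> pt P) p : (3 <= n)%N -> pemb phi ->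
  exists m (psi : 'rV[F]_m -> pt P), [/\ (3 <= m)%N, pemb psi,
    forall z, inU phi z -> inU psi z & inU psi p].
Proof.
move=> n3 hphi; have [pU|pU] := pselect (inU phi p); first by exists n, phi.
have [a [a0 aU a_inj a_dir]] := affine_coordinates hP hphi pU n3.
exists (1 + n)%N, (ext_phi phi a); split; first exact: leqW.
- exact: pemb_ext.
- move=> _ [v v0 ->]; exists (row_mx 0 v); last by rewrite ext_phi0.
  by rewrite row_mx_eq0 eqxx.
- exists (row_mx 1%:M 0); last by rewrite ext_phi1.
  rewrite row_mx_eq0 negb_and; apply/orP; left; apply/eqP => /matrixP/(_ 0 0)/eqP.
  by rewrite !mxE eqxx oner_eq0.
Qed.

Lemma pemb_extend_seq n (phi : 'rV[F]_n -> pt P) (b : nat -> pt P) r :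
  (3 <= n)%N -> pemb phi ->
  exists m (psi : 'rV[F]_m -> pt P), [/\ (3 <= m)%N, pemb psi &
    forall i, (i < r)%N -> inU psi (b i)].
Proof.
move=> n3 hphi; elim: r => [|r [m [psi [m3 hpsi hb]]]]; first by exists n, phi.
have [m' [psi' [m3' hpsi' sub br]]] := pemb_extend (b r) m3 hpsi.
exists m', psi'; split=> // i; rewrite ltnS leq_eqVlt => /orP[/eqP->//|/hb].
exact: sub.
Qed.

Lemma inU_subspace n (phi : 'rV[F]_n -> pt P) : pemb phi -> subspace (inU phi).
Proof.
move=> hphi _ _ l [v v0 ->] [w w0 ->] vw hl lv lw z lz.
by apply: (inU_col hP hphi v0 w0 vw); exists l.
Qed.

End Coordinatization.

(** * The fundamental theorem of projective geometry *)

Section Representatives.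
Variables (F : fieldType) (d : nat).
Implicit Types (A B Z : pt (PG F d)) (z : 'rV[F]_d.+1).

Definition rep Z : 'rV[F]_d.+1 := vpick (val Z).

Lemma rep_neq0 Z : rep Z != 0.
Proof. by rewrite /rep vpick0 -dimv_eq0 (eqP (valP Z)). Qed.

Lemma val_rep Z : val Z = <[rep Z]>%VS.
Proof.
by apply/eqP; rewrite eq_sym eqEdim dim_vline rep_neq0 (eqP (valP Z)) -memvE memv_pick.
Qed.

Lemma pt_eq A B : val A = val B -> A = B.
Proof. exact: val_inj. Qed.

Lemma vline_eq (V : vectType F) (x y : V) : y != 0 -> y \in <[x]>%VS -> <[x]>%VS = <[y]>%VS.
Proof.
move=> y0 h; apply/eqP; rewrite eq_sym eqEdim -memvE h !dim_vline y0.
by case: eqP.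
Qed.

(* [z] is a vector of homogeneous coordinates of [Z]. *)
Definition hc Z z := val Z = <[z]>%VS.

Lemma hc_rep Z : hc Z (rep Z). Proof. exact: val_rep. Qed.

Lemma hc_neq0 Z z : hc Z z -> z != 0.
Proof.
move=> h; have := valP Z; rewrite /= [proj1_sig Z]h dim_vline.
by case: (z != 0).
Qed.

Lemma hcI Z z y : z != 0 -> z \in <[y]>%VS -> hc Z y -> hc Z z.
Proof. by move=> z0 zy h; rewrite /hc [val Z]h; apply: vline_eq. Qed.

Lemma hc_mem Z z y : hc Z z -> hc Z y -> z \in <[y]>%VS.
Proof. by move=> h1 h2; rewrite -[<[y]>%VS]h2 [val Z]h1 memv_line. Qed.

Lemma hc_scale Z z y : hc Z z -> hc Z y -> exists2 c, c != 0 & y = c *: z.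
Proof.
move=> h1 h2; have /vlineP[c yE] := hc_mem h2 h1; exists c => //.
by apply: contraNneq (hc_neq0 h2) => c0; rewrite yE c0 scale0r.
Qed.

Lemma hc_inj A B z y : hc A z -> hc B y -> z \in <[y]>%VS -> A = B.
Proof.
by move=> hA hB h; apply: pt_eq; rewrite [val A]hA [val B]hB (vline_eq (hc_neq0 hA) h).
Qed.

Lemma hc_free2 A B z y : A <> B -> hc A z -> hc B y -> free [:: z; y].
Proof.
move=> AB hA hB; rewrite free2E (hc_neq0 hB); apply: contra_notN AB.
exact: hc_inj.
Qed.

Lemma hc_line l A B z y : A <> B -> lines (PG F d) l -> l A -> l B -> hc A z -> hc B y ->
  forall Z x, hc Z x -> (l Z <-> x \in <<[:: z; y]>>%VS).
Proof.
move=> AB [L ->] /= AL BL hA hB Z x hZ.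
have fr := hc_free2 AB hA hB.
have -> : <<[:: z; y]>>%VS = val L.
  apply/eqP; rewrite eqEdim (eqP fr) (eqP (valP L)) leqnn andbT span_cons span_seq1.
  by rewrite subv_add -[<[z]>%VS]hA -[<[y]>%VS]hB; apply/andP.
by rewrite memvE -[<[x]>%VS]hZ.
Qed.

End Representatives.

Lemma make_rmorphism (F : fieldType) (s : F -> F) : {morph s : x y / x + y} ->
  {morph s : x y / x * y} -> s 1 = 1 -> exists r : {rmorphism F -> F}, forall x, r x = s x.
Proof.
move=> sD sM s1.
have sB : {morph s : x y / x - y}.
  move=> x y; have s0 : s 0 = 0 by apply: (addrI (s 0)); rewrite -sD !addr0.
  rewrite sD; congr (_ + _); apply/eqP; rewrite -addr_eq0 -sD addNr s0 //.
have M1 := GRing.isZmodMorphism.Build F F s sB.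
have M2 := GRing.isMonoidMorphism.Build F F s (s1, sM).
pose r : {rmorphism F -> F} := HB.pack s M1 M2.
by exists r.
Qed.

Section FundamentalTheorem.
Variables (F : fieldType) (n' d : nat).
Let n := n'.+1.
Variables (phi : 'rV[F]_n -> pt (PG F d)) (hphi : pemb phi).
Hypothesis n3 : (3 <= n)%N.
Implicit Types (u v w : 'rV[F]_n).

Let R u z := hc (phi u) z.

Lemma R_line u v w x y z : free [:: u; v] -> w != 0 -> w \in <<[:: u; v]>>%VS ->
  R u x -> R v y -> R w z -> z \in <<[:: x; y]>>%VS.
Proof.
move=> fr w0 wL hx hy hz; have [l [hl lu lv lw]] := pemb_col hphi fr w0 wL.
have uv : phi u <> phi v by apply: (pemb_neq hphi); rewrite free2C.
exact: ((hc_line uv hl lu lv hx hy hz).1 lw).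
Qed.

Lemma R_lineP u v x y z : free [:: u; v] -> R u x -> R v y -> z != 0 -> z \in <<[:: x; y]>>%VS ->
  exists w, [/\ w \in <<[:: u; v]>>%VS, w != 0 & R w z].
Proof.
move=> fr hx hy z0 zL; have [l hl lP] := pemb_line hphi fr.
have u0 : u != 0 by apply: free_not0 fr _; rewrite inE eqxx.
have v0 : v != 0 by apply: free_not0 fr _; rewrite !inE eqxx orbT.
have lu : l (phi u) by apply/lP; exists u; rewrite memv_span ?inE ?eqxx.
have lv : l (phi v) by apply/lP; exists v; rewrite memv_span ?inE ?eqxx ?orbT.
have uv : phi u <> phi v by apply: (pemb_neq hphi); rewrite free2C.
have hZ : hc (vpoint z0) z by [].
have /lP[w [wL w0 e]] := (hc_line uv hl lu lv hx hy hZ).2 zL.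
by exists w; rewrite /R -e.
Qed.

Lemma R_free2 u v x y : free [:: u; v] -> R u x -> R v y -> free [:: x; y].
Proof. by move=> fr; apply: hc_free2; apply: (pemb_neq hphi); rewrite free2C. Qed.

Lemma R_inj u v x y : u != 0 -> v != 0 -> R u x -> R v y -> x \in <[y]>%VS -> u \in <[v]>%VS.
Proof. by move=> u0 v0 hx hy /(hc_inj hx hy)/esym/(pemb_eq hphi v0 u0). Qed.

(** Lines go onto lines: a dependent [x] would represent the image of some point of the line of [v]
    and [w], and by injectivity [u] would be on that line. *)
Lemma R_free3 u v w x y z : free [:: u; v; w] -> R u x -> R v y -> R w z -> free [:: x; y; z].
Proof.
move=> fr hx hy hz; have [nL fr'] : u \notin <<[:: v; w]>>%VS /\ free [:: v; w].
  by move: fr; rewrite free_cons => /andP[].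
rewrite free_cons (R_free2 fr' hy hz) andbT; apply: contra nL => xL.
have [t [tL t0 ht]] := R_lineP fr' hy hz (hc_neq0 hx) xL.
have u0 : u != 0 by apply: free_not0 fr _; rewrite inE eqxx.
by have /vlineP[c ->] := R_inj u0 t0 hx ht (memv_line _); rewrite memvZ.
Qed.

(** The argument runs in the affine chart [e0 + H], with [e0] as origin and the hyperplane [H] as
    its space of translations. *)
Let e0 : 'rV[F]_n := delta_mx 0 0.
Let H v := v 0 0 = 0.

Lemma e0_free v w : H v -> H w -> free [:: v; w] -> free [:: e0; v; w].
Proof.
move=> hv hw fr; rewrite free_cons fr andbT; apply/negP => /mem_span2P[a [b /matrixP/(_ 0 0)]].
by rewrite !mxE hv hw !eqxx !mulr0 addr0 => /eqP; rewrite oner_eq0.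
Qed.

(** The factor left free in a coordinate vector of [phi v] is fixed by the point of [e0 + v], which
    lies on the line of [e0] and [v]: the ratio of its two coefficients is the required scaling. *)
Lemma exists_affine_part : exists (w0 : 'rV[F]_d.+1) (g : 'rV[F]_n -> 'rV[F]_d.+1), R e0 w0 /\ forall v, H v ->
  [/\ v = 0 -> g v = 0, v != 0 -> R v (g v) & R (e0 + v) (w0 + g v)].
Proof.
pose w0 := rep (phi e0); have h0 : R e0 w0 by exact: hc_rep.
exists w0.
have : forall v, exists y, H v ->
    [/\ v = 0 -> y = 0, v != 0 -> R v y & R (e0 + v) (w0 + y)].
  move=> v; have [hv|] := pselect (H v); last by exists 0.
  have [->|v0] := eqVneq v 0; first by exists 0; rewrite !addr0.
  have e1 : e0 + v != 0.
    by apply/eqP => /matrixP/(_ 0 0)/eqP; rewrite !mxE hv !eqxx addr0 oner_eq0.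
  have fr : free [:: e0; v].
    apply: free2I => a b h; have := h => /matrixP/(_ 0 0); rewrite !mxE hv !eqxx mulr1 mulr0 addr0 => a0.
    by move/eqP: h; rewrite a0 scale0r add0r scaler_eq0 (negPf v0) orbF => /eqP.
  have hv1 := hc_rep (phi v); have h1 := hc_rep (phi (e0 + v)).
  have [|a [b ab]] := mem_span2P _ _ _ (R_line fr e1 _ h0 hv1 h1).
    by apply/mem_span2P; exists 1, 1; rewrite !scale1r.
  have a0 : a != 0.
    apply/eqP => a0; move: ab; rewrite a0 scale0r add0r => ab.
    have /vlineP[c cE] : e0 + v \in <[v]>%VS.
      by apply: (R_inj e1 v0 h1 hv1); rewrite ab memvZ ?memv_line.
    by move/matrixP: cE => /(_ 0 0)/eqP; rewrite !mxE hv !eqxx mulr0 addr0 oner_eq0.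
  have b0 : b != 0.
    apply/eqP => b0; move: ab; rewrite b0 scale0r addr0 => ab.
    have e00 : e0 != 0 by apply: free_not0 fr _; rewrite inE eqxx.
    have /vlineP[c cE] : e0 + v \in <[e0]>%VS.
      by apply: (R_inj e1 e00 h1 h0); rewrite ab memvZ ?memv_line.
    have [_ /eqP] : 1 - c = 0 /\ (1 : F) = 0.
      by apply: (lc_free2 fr); rewrite scalerBl !scale1r addrAC cE subrr.
    by rewrite oner_eq0.
  exists ((b / a) *: rep (phi v)) => _; split=> [vE|_|].
  - by rewrite vE eqxx in v0.
  - apply: (hcI _ _ hv1); last by rewrite memvZ ?memv_line.
    by rewrite scaler_eq0 negb_or rep_neq0 mulf_neq0 ?invr_eq0.
  - have e : w0 + (b / a) *: rep (phi v) = a^-1 *: rep (phi (e0 + v)).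
      by rewrite ab scalerDr !scalerA mulVf // scale1r mulrC.
    rewrite e; apply: (hcI _ _ h1); last by rewrite memvZ ?memv_line.
    by rewrite scaler_eq0 negb_or rep_neq0 invr_eq0 a0.
by case/choice => g hg; exists g.
Qed.

Lemma R_scale c v x : c != 0 -> R v x -> R (c *: v) x.
Proof. by move=> c0; rewrite /R pemb_scale. Qed.

Lemma exists_indep v : v != 0 -> exists2 u, H u & free [:: v; u].
Proof.
move=> v0; pose U := <<[:: v; e0]>>%VS.
have dU : (\dim U < \dim {:'rV[F]_n})%N.
  rewrite dimvf /dim /= mul1n; apply: leq_trans n3; rewrite ltnS.
  exact: dim_span.
have [u _ uU] := vspace_out dU.
exists (u - u 0 0 *: e0); first by rewrite /H !mxE !eqxx mulr1 subrr.
rewrite free2C free2E v0; apply: contra uU => h.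
rewrite -(subrK (u 0 0 *: e0) u) memvD //; last by rewrite memvZ ?memv_span ?inE ?eqxx ?orbT.
by case/vlineP: h => c ->; rewrite memvZ ?memv_span ?inE ?eqxx.
Qed.

Theorem fundamental_theorem : exists (s : {rmorphism F -> F}) (L : 'M[F]_(n, d.+1)),
  bijective s /\ forall v, v != 0 -> hc (phi v) (map_mx s v *m L).
Proof.
have [w0 [g [hw0 hg]]] := exists_affine_part.
have g0 : g 0 = 0 by case: (hg 0) => [|/(_ erefl)]; rewrite // /H mxE.
have gR v : H v -> v != 0 -> R v (g v) by move=> hv; case: (hg v hv).
have gA v : H v -> R (e0 + v) (w0 + g v) by move=> hv; case: (hg v hv).
have HD v w : H v -> H w -> H (v + w) by rewrite /H !mxE => -> ->; rewrite addr0.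
have HZ c v : H v -> H (c *: v) by rewrite /H !mxE => ->; rewrite mulr0.
(* The point of [v + w] lies on the line of [v] and [w], that of [e0 + (v + w)] on the line of
   [e0 + v] and [w]. Comparing the coefficients of [w0] and [g v] gives 1 for [g v]; the coefficient
   of [g w] is found in [gD2] by exchanging [v] and [w]. *)
have gD1 v w : H v -> H w -> free [:: v; w] -> exists b, g (v + w) = g v + b *: g w.
  move=> hv hw fr.
  have v0 : v != 0 by apply: free_not0 fr _; rewrite inE eqxx.
  have ww0 : w != 0 by apply: free_not0 fr _; rewrite !inE eqxx orbT.
  have fr3 := e0_free hv hw fr.
  have frg := R_free3 fr3 hw0 (gR _ hv v0) (gR _ hw ww0).
  have vw0 : v + w != 0.
    apply/eqP => h; have [/eqP] : (1 : F) = 0 /\ (1 : F) = 0.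
      by apply: (lc_free2 fr); rewrite !scale1r.
    by rewrite oner_eq0.
  have [|a [b ab]] := mem_span2P _ _ _ (R_line fr vw0 _ (gR _ hv v0) (gR _ hw ww0) (gR _ (HD _ _ hv hw) vw0)).
    by apply/mem_span2P; exists 1, 1; rewrite !scale1r.
  have fr' : free [:: e0 + v; w].
    apply: free2I => k l h; have [] := lc_free3 (a := k) (b := k) (c := l) fr3; last by [].
    by rewrite -scalerDr.
  have e1 : e0 + (v + w) != 0.
    by apply/eqP => /matrixP/(_ 0 0)/eqP; rewrite !mxE hv hw !eqxx !addr0 oner_eq0.
  have [|a' [b' ab']] := mem_span2P _ _ _ (R_line fr' e1 _ (gA _ hv) (gR _ hw ww0) (gA _ (HD _ _ hv hw))).
    by apply/mem_span2P; exists 1, 1; rewrite !scale1r addrA.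
  have [a1 a2 _] : [/\ 1 - a' = 0, a - a' = 0 & b - b' = 0].
    apply: (lc_free3 frg); move/eqP: ab'; rewrite -subr_eq0 ab => /eqP <-.
    by apply/rowP => i; rewrite !mxE; ring.
  by exists b; rewrite ab (subr0_eq a2) -(subr0_eq a1) scale1r.
have gD2 v w : H v -> H w -> free [:: v; w] -> g (v + w) = g v + g w.
  move=> hv hw fr; have [b hb] := gD1 _ _ hv hw fr.
  have [|a ha] := gD1 _ _ hw hv; first by rewrite free2C.
  have v0 : v != 0 by apply: free_not0 fr _; rewrite inE eqxx.
  have ww0 : w != 0 by apply: free_not0 fr _; rewrite !inE eqxx orbT.
  have frg := R_free2 fr (gR _ hv v0) (gR _ hw ww0).
  have [_ b1] : 1 - a = 0 /\ b - 1 = 0.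
    apply: (lc_free2 frg); have : g (v + w) - g (w + v) = 0 by rewrite (addrC w) subrr.
    by rewrite hb ha => <-; apply/rowP => i; rewrite !mxE; ring.
  by rewrite hb (subr0_eq b1) scale1r.
have ndep v w : v != 0 -> ~~ free [:: v; w] -> exists c, w = c *: v.
  by move=> v0; rewrite free2C free2E v0 /= negbK => /vlineP.
have frD v w u : v != 0 -> ~~ free [:: v; w] -> free [:: v; u] -> free [:: v; w + u].
  move=> v0 /ndep-/(_ v0)[c ->] fr; apply: free2I => a b h.
  have [] := lc_free2 (a := a + b * c) (b := b) fr.
    by rewrite -[RHS]h; apply/rowP => i; rewrite !mxE; ring.
  by move=> + b0; rewrite b0 mul0r addr0.
(* For proportional [v] and [w] a third vector [u] of [H], independent of [v], allows
   [g (v + w + u)] to be expanded in two ways. *)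
have gD v w : H v -> H w -> g (v + w) = g v + g w.
  move=> hv hw; have [->|v0] := eqVneq v 0; first by rewrite g0 !add0r.
  have [fr|fr] := boolP (free [:: v; w]); first exact: gD2.
  have [u hu fru] := exists_indep v0.
  have [->|ww0] := eqVneq w 0; first by rewrite g0 !addr0.
  have fruw : free [:: w; u].
    have [c wE] := ndep _ _ v0 fr; have c0 : c != 0 by apply: contraNneq ww0 => c0; rewrite wE c0 scale0r.
    apply: free2I => a b; rewrite wE scalerA => /(lc_free2 fru)[/eqP].
    by rewrite mulf_eq0 (negPf c0) orbF => /eqP.
  have e1 : g (v + (w + u)) = g v + (g w + g u).
    by rewrite gD2 ?frD //; [rewrite gD2|exact: HD].
  have [vw|vw] := eqVneq (v + w) 0.
    apply: (addIr (g u)); rewrite -addrA -e1 addrA vw add0r g0 add0r //.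
  apply: (addIr (g u)); rewrite -addrA -e1 addrA [RHS]gD2 //; first exact: HD.
  have [c wE] := ndep _ _ v0 fr; apply: free2I => a b.
  have -> : v + w = (1 + c) *: v by rewrite wE scalerDl scale1r.
  rewrite scalerA => /(lc_free2 fru)[/eqP]; rewrite mulf_eq0 => /orP[/eqP//|/eqP c0].
  by rewrite wE -{1}[v]scale1r -scalerDl c0 scale0r eqxx in vw.
have gZ v x : H v -> exists c, g (x *: v) = c *: g v.
  move=> hv; have [->|v0] := eqVneq v 0; first by exists 0; rewrite scaler0 g0 scaler0.
  have [->|x0] := eqVneq x 0; first by exists 0; rewrite !scale0r.
  have xv0 : x *: v != 0 by rewrite scaler_eq0 negb_or x0.
  have h1 := gR _ (HZ x _ hv) xv0; rewrite /R pemb_scale // in h1.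
  by have /vlineP[c ->] := hc_mem h1 (gR _ hv v0); exists c.
have g_neq0 v : H v -> v != 0 -> g v != 0 by move=> hv v0; exact: (hc_neq0 (gR _ hv v0)).
(* Since [x *: (v + w)] is also [x *: v + x *: w], independent vectors share the factor that [g]
   attaches to [x]; [s x] is this common factor. *)
have gS1 v w x c : H v -> H w -> free [:: v; w] -> g (x *: w) = c *: g w -> g (x *: v) = c *: g v.
  move=> hv hw fr hc1; have [a ha] := gZ _ x hv.
  have [b hb] := gZ _ x (HD _ _ hv hw).
  have v0 : v != 0 by apply: free_not0 fr _; rewrite inE eqxx.
  have ww0 : w != 0 by apply: free_not0 fr _; rewrite !inE eqxx orbT.
  have frg := R_free2 fr (gR _ hv v0) (gR _ hw ww0).
  have [a1 a2] : a - b = 0 /\ c - b = 0.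
    apply: (lc_free2 frg); have e : g (x *: v) + g (x *: w) = b *: (g v + g w).
      by rewrite -(gD _ _ hv hw) -hb scalerDr gD //; exact: HZ.
    rewrite ha hc1 in e; move/eqP: e; rewrite -subr_eq0 => /eqP <-.
    by apply/rowP => i; rewrite !mxE; ring.
  by rewrite ha (subr0_eq a1) (subr0_eq a2).
have e00 : e0 != 0.
  by apply/eqP => /matrixP/(_ 0 0)/eqP; rewrite !mxE !eqxx oner_eq0.
have [v1 hv1 frv1] := exists_indep e00.
have v10 : v1 != 0 by apply: free_not0 frv1 _; rewrite !inE eqxx orbT.
have [s hs] := choice (fun x => gZ v1 x hv1).
have gS v x : H v -> g (x *: v) = s x *: g v.
  move=> hv; have [->|v0] := eqVneq v 0; first by rewrite scaler0 g0 scaler0.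
  have [u hu fru] := exists_indep v10.
  have [fr|fr] := boolP (free [:: v1; v]).
    by apply: (gS1 v v1) => //; rewrite free2C.
  have frvu : free [:: v; u].
    have [c vE] := ndep _ _ v10 fr; have c0 : c != 0 by apply: contraNneq v0 => c0; rewrite vE c0 scale0r.
    apply: free2I => a b; rewrite vE scalerA => /(lc_free2 fru)[/eqP].
    by rewrite mulf_eq0 (negPf c0) orbF => /eqP.
  apply: (gS1 v u) => //; apply: (gS1 u v1) => //; by rewrite free2C.
have gv1 := g_neq0 _ hv1 v10.
have sI a b : a *: g v1 = b *: g v1 -> a = b.
  by move=> h; apply/eqP; move/eqP: h; rewrite -subr_eq0 -scalerBl scaler_eq0 (negPf gv1) orbF subr_eq0.
have [r rE] : exists r : {rmorphism F -> F}, forall x, r x = s x.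
  apply: make_rmorphism.
  - by move=> x y; apply: sI; rewrite -hs !scalerDl gD ?hs //; exact: HZ.
  - by move=> x y; apply: sI; rewrite -hs -scalerA gS ?hs ?scalerA //; exact: HZ.
  - by apply: sI; rewrite -hs !scale1r.
(* The point [w0 + c *: g v1] lies on the line of [e0] and [v1], whose image is a full line, so it
   comes from some [a *: e0 + b *: v1]; then [b / a] is the preimage of [c]. *)
have r_surj c : exists x, r x = c.
  have fr : free [:: e0; v1] by [].
  have z0 : w0 + c *: g v1 != 0.
    apply/eqP => h; have frz := R_free2 fr hw0 (gR _ hv1 v10).
    have [/eqP] : (1 : F) = 0 /\ c = 0 by apply: (lc_free2 frz); rewrite scale1r.
    by rewrite oner_eq0.
  have [|w [wL ww0 hw]] := R_lineP fr hw0 (gR _ hv1 v10) z0.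
    by apply/mem_span2P; exists 1, c; rewrite scale1r.
  move/mem_span2P: wL => [a [b wE]].
  have a0 : a != 0.
    apply/eqP => a0; have frz := R_free2 fr hw0 (gR _ hv1 v10).
    have : R v1 (w0 + c *: g v1).
      rewrite wE a0 scale0r add0r in hw ww0; have b0 : b != 0.
        by apply: contraNneq ww0 => ->; rewrite scale0r.
      by rewrite /R pemb_scale // in hw.
    move=> /hc_mem/(_ (gR _ hv1 v10))/vlineP[k kE].
    have [/eqP] : (1 : F) = 0 /\ c - k = 0.
      apply: (lc_free2 frz); rewrite scale1r scalerBl addrA kE subrr //.
    by rewrite oner_eq0.
  exists (b / a); rewrite rE.
  have hw' : R (e0 + (b / a) *: v1) (w0 + c *: g v1).
    rewrite (_ : _ + _ = a^-1 *: w); first by apply: R_scale; rewrite ?invr_eq0.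
    by rewrite wE scalerDr !scalerA mulVf // scale1r mulrC.
  have h2 := gA _ (HZ (b / a) _ hv1); rewrite hs in h2.
  have [k k0 kE] := hc_scale hw' h2.
  have frz := R_free2 fr hw0 (gR _ hv1 v10).
  have [k1 k2] : 1 - k = 0 /\ s (b / a) - k * c = 0.
    apply: (lc_free2 frz); move/eqP: kE; rewrite -subr_eq0 => /eqP <-.
    by apply/rowP => i; rewrite !mxE; ring.
  by rewrite (subr0_eq k2) -(subr0_eq k1) mul1r.
have r_bij : bijective r.
  have [q hq] := choice r_surj.
  by exists q => x //; apply: (fmorph_inj r); rewrite hq.
(* The semilinear extension of [g] with [G e0 = w0]; the rows of the matrix are its values on unit
   vectors. *)
pose G v := r (v 0 0) *: w0 + g (v - v 0 0 *: e0).
have HG v : H (v - v 0 0 *: e0) by rewrite /H !mxE !eqxx mulr1 subrr.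
have GD v w : G (v + w) = G v + G w.
  rewrite /G mxE rmorphD scalerDl addrACA -gD //; congr (_ + g _).
  by apply/rowP => i; rewrite !mxE; ring.
have GZ c v : G (c *: v) = r c *: G v.
  rewrite /G mxE rmorphM scalerDr scalerA rE -gS //; congr (_ + g _).
  by apply/rowP => i; rewrite !mxE; ring.
have GR v : v != 0 -> R v (G v).
  move=> v0; have vE : v = v 0 0 *: e0 + (v - v 0 0 *: e0) by rewrite addrC subrK.
  have [t0|t0] := eqVneq (v 0 0) 0.
    rewrite /G t0 rmorph0 !scale0r subr0 add0r; exact: gR.
  set t := v 0 0 in vE t0 *; set v' := v - _ in vE *.
  have h1 : R v (w0 + g (t^-1 *: v')).
    rewrite vE (_ : _ + _ = t *: (e0 + t^-1 *: v')); last first.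
      by rewrite scalerDr scalerA mulfV // scale1r.
    by apply: R_scale => //; apply/gA/HZ/HG.
  have e : G v = r t *: (w0 + g (t^-1 *: v')).
    rewrite /G -/t -/v' scalerDr rE -gS ?scalerA ?mulfV ?scale1r //; exact/HZ/HG.
  rewrite e; apply: (hcI _ _ h1); last by rewrite memvZ ?memv_line.
  by rewrite scaler_eq0 negb_or fmorph_eq0 t0 (hc_neq0 h1).
exists r, (\matrix_i G (delta_mx 0 i)); split=> // v v0.
suff <- : G v = map_mx r v *m \matrix_i G (delta_mx 0 i) by exact: GR.
have G0 : G 0 = 0 by rewrite -(scale0r 0) GZ rmorph0 scale0r.
rewrite mulmx_sum_row {1}(row_sum_delta v) (big_morph G GD G0).
by apply: eq_bigr => i _; rewrite GZ rowK mxE.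
Qed.

End FundamentalTheorem.

(** * Alternating functions on free sequences and their values on generators *)

Section Generation.
Variables (F : fieldType) (vT : vectType F).
Implicit Types (x y z : vT) (xs ys ts ds es : seq vT).

Lemma span_exchange x z ds : x \in <<z :: ds>>%VS -> x \notin <<ds>>%VS ->
  <<x :: ds>>%VS = <<z :: ds>>%VS.
Proof.
move=> xz xd; apply/eqP; rewrite eqEsubv; apply/andP; split; apply/span_subvP => t.
  rewrite inE => /orP[/eqP->//|td]; rewrite memv_span // inE td orbT //.
rewrite inE => /orP[/eqP->|td]; last by rewrite memv_span // inE td orbT.
move: xz; rewrite !span_cons => /memv_addP[_ /vlineP[c ->]] [w wd xE].
have c0 : c != 0 by apply: contraNneq xd => c0; rewrite xE c0 scale0r add0r.
have -> : z = c^-1 *: (x - w) by rewrite xE addrK scalerA mulVf // scale1r.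
by rewrite memvZ // memv_add ?memv_line // memvN.
Qed.

Lemma dim_free_cons x ds k : free (x :: ds) -> size ds = k -> \dim <<x :: ds>>%VS = k.+1.
Proof. by move=> /eqP -> /= ->. Qed.

Lemma free_consr x y ds : free (x :: y :: ds) -> free (x :: ds) /\ free (y :: ds).
Proof.
rewrite free_cons => /andP[xn fy]; split=> //.
move: (fy); rewrite free_cons => /andP[_ fd]; rewrite free_cons fd andbT.
by apply: contra xn => h1; rewrite span_cons (subvP (addvSr _ _)).
Qed.

Lemma free_consC x y ds : free (x :: y :: ds) = free (y :: x :: ds).
Proof. exact: perm_free (permEl (perm_catCA [:: x] [:: y] ds)). Qed.

Lemma span_consC x y ds : <<x :: y :: ds>>%VS = <<y :: x :: ds>>%VS.
Proof. by apply: eq_span => t; rewrite !inE orbCA. Qed.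

Lemma span_addl x y ds : <<(x + y)%R :: y :: ds>>%VS = <<x :: y :: ds>>%VS.
Proof.
apply/eqP; rewrite eqEsubv; apply/andP; split; apply/span_subvP => t;
  rewrite inE => /predU1P[->|td].
- by rewrite memvD // memv_span // !inE eqxx ?orbT.
- by rewrite memv_span // inE td orbT.
- by rewrite -[X in X \in _](addrK y) memvB // memv_span // !inE eqxx ?orbT.
- by rewrite memv_span // inE td orbT.
Qed.

Lemma span_subl x y ds : <<(x - y)%R :: y :: ds>>%VS = <<x :: y :: ds>>%VS.
Proof. by rewrite -[in RHS](subrK y x) span_addl. Qed.

Lemma span_free xs ys : <<xs>>%VS = <<ys>>%VS -> size xs = size ys -> free ys -> free xs.
Proof. by rewrite /free => -> ->. Qed.

Lemma span_ind es (R : vT -> Prop) : R 0 -> (forall x y, R x -> R y -> R (x + y)) ->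
  (forall c e, e \in es -> R (c *: e)) -> forall x, x \in <<es>>%VS -> R x.
Proof.
move=> R0 RD RZ x; elim: es x RZ => [|e es IH] x RZ.
  by rewrite span_nil memv0 => /eqP->.
rewrite span_cons => /memv_addP[_ /vlineP[c ->]] [w wd ->].
by apply: RD; [apply: RZ; rewrite inE eqxx|apply: IH => // d f fe; apply: RZ; rewrite inE fe orbT].
Qed.

(** The entries of [xs] are traded one at a time for generators: [ts] holds those already traded,
    and the head of [xs] is expanded over [es] while the other entries stay fixed. Scalars need no
    hypothesis, as they do not change a span. *)
Lemma generation es (Q : {vspace vT} -> Prop) j :
  (forall ts, {subset ts <= es} -> free ts -> size ts = j -> Q <<ts>>%VS) ->
  (forall x y ds, free (x :: y :: ds) -> {subset x :: y :: ds <= <<es>>%VS} ->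
     (size ds).+1 = j -> Q <<x :: ds>>%VS -> Q <<y :: ds>>%VS -> Q <<(x + y)%R :: ds>>%VS) ->
  forall xs, free xs -> {subset xs <= <<es>>%VS} -> size xs = j -> Q <<xs>>%VS.
Proof.
move=> Q1 Q2 xs; rewrite -[xs]cats0; have : {subset [::] <= es} by [].
move: [::] => ts; elim: xs ts => [|x xs IH] ts tsub fr sub sz; first exact: Q1.
have xE : x \in <<es>>%VS by apply: sub; rewrite inE eqxx.
have tsub' : {subset ts <= <<es>>%VS} by move=> t /tsub; apply: memv_span.
have rsub : {subset xs ++ ts <= <<es>>%VS} by move=> t th; apply: sub; rewrite inE th orbT.
set ds := xs ++ ts in rsub *.
have frd : free ds by move: fr; rewrite /= free_cons => /andP[].
have szd : (size ds).+1 = j by [].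
suff R y : y \in <<es>>%VS -> y \in <<es>>%VS /\ (y \notin <<ds>>%VS -> Q <<y :: ds>>%VS).
  by case: (R _ xE) => _; apply; move: fr; rewrite /= free_cons => /andP[].
apply: (span_ind (R := fun y => y \in <<es>>%VS /\ (y \notin <<ds>>%VS -> Q <<y :: ds>>%VS))).
- by rewrite !mem0v.
- move=> y1 y2 [y1E R1] [y2E R2]; split=> [|h]; first exact: memvD.
  (* If [y1] and [y2] are dependent modulo [ds], the span of [y1 + y2] and [ds] is one of the two
     old spans; only the independent case uses the pencil hypothesis. *)
  have [y12|y12] := boolP (y1 \in <<y2 :: ds>>%VS).
    have e : <<(y1 + y2)%R :: ds>>%VS = <<y2 :: ds>>%VS.
      by apply: span_exchange => //; rewrite memvD // memv_span // inE eqxx.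
    rewrite e; apply: R2; apply: contra h => h2.
    suff e2 : <<y2 :: ds>>%VS = <<ds>>%VS by rewrite memvD // -e2.
    apply/eqP; rewrite eqEsubv span_cons addvSr subv_add -memvE h2 subvv //.
  have [y2d|y2d] := boolP (y2 \in <<ds>>%VS).
    have e : <<(y1 + y2)%R :: ds>>%VS = <<y1 :: ds>>%VS.
      apply: span_exchange => //; rewrite span_cons memv_add ?memv_line //.
    rewrite e; apply: R1; apply: contra y12; rewrite span_cons => ?.
    by rewrite (subvP (addvSr _ _)).
  apply: Q2 => //.
  + by rewrite free_cons y12 free_cons y2d.
  + by move=> t; rewrite !inE => /or3P[/eqP->|/eqP->|/rsub].
  + apply: R1; apply: contra y12; rewrite span_cons => ?.
    by rewrite (subvP (addvSr _ _)).
  + exact: R2.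
- move=> c e eE; have eE' := memv_span eE; split=> [|h]; first exact: memvZ.
  have c0 : c != 0 by apply: contraNneq h => ->; rewrite scale0r mem0v.
  have e_ds : e \notin <<ds>>%VS by apply: contra h => ?; rewrite memvZ.
  rewrite (@span_exchange _ e) //; last by rewrite memvZ // memv_span // inE eqxx.
  have pe : perm_eq (e :: ds) (xs ++ e :: ts) := permEl (perm_catCA [:: e] xs ts).
  rewrite (eq_span (perm_mem pe)); apply: IH.
  + by move=> t; rewrite inE => /orP[/eqP->//|/tsub].
  + by rewrite -(perm_free pe) free_cons e_ds.
  + move=> t; rewrite mem_cat inE => /or3P[th|/eqP->//|th]; apply: rsub;
    by rewrite mem_cat th ?orbT.
  + by rewrite -(perm_size pe).
Qed.

(** [theta] is abstract because two instances occur: the Plücker vector of [xs], and that of [xs]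
    with a fixed unit vector in front. Row [i] of [L] is read off at any sequence of generators
    whose [theta] is a multiple of the unit vector [i]; the last hypothesis and the behaviour under
    change of basis make it independent of that sequence. An index that is never reached gets the
    row 0. *)
Lemma alternating_ext es j q w (s : {rmorphism F -> F}) (theta : seq vT -> 'rV[F]_q)
    (u : seq vT -> 'rV[F]_w) :
  (forall xs ys, free xs -> free ys -> {subset xs <= <<es>>%VS} -> {subset ys <= <<es>>%VS} ->
     size xs = j -> size ys = j -> <<xs>>%VS = <<ys>>%VS ->
     exists c, [/\ c != 0, theta ys = c *: theta xs & u ys = s c *: u xs]) ->
  (forall x y ds, free (x :: y :: ds) -> {subset x :: y :: ds <= <<es>>%VS} ->
     (size ds).+1 = j -> theta (x + y :: ds) = theta (x :: ds) + theta (y :: ds)) ->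
  (forall x y ds, free (x :: y :: ds) -> {subset x :: y :: ds <= <<es>>%VS} ->
     (size ds).+1 = j -> u (x + y :: ds) = u (x :: ds) + u (y :: ds)) ->
  (forall ts, {subset ts <= es} -> free ts -> size ts = j ->
     exists i d, d != 0 /\ theta ts = d *: delta_mx 0 i) ->
  (forall ts ts' i d d', {subset ts <= es} -> free ts -> size ts = j ->
     {subset ts' <= es} -> free ts' -> size ts' = j -> d != 0 -> d' != 0 ->
     theta ts = d *: delta_mx 0 i -> theta ts' = d' *: delta_mx 0 i ->
     <<ts>>%VS = <<ts'>>%VS) ->
  exists L : 'M[F]_(q, w), forall xs, free xs -> {subset xs <= <<es>>%VS} -> size xs = j ->
    u xs = map_mx s (theta xs) *m L.
Proof.
move=> H1 H2 H3 H4 H5.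
have subE ts : {subset ts <= es} -> {subset ts <= <<es>>%VS}.
  by move=> h t /h; apply: memv_span.
have ex (i : 'I_q) : exists ri : 'rV[F]_w, forall ts d, {subset ts <= es} -> free ts ->
    size ts = j -> d != 0 -> theta ts = d *: delta_mx 0 i -> u ts = s d *: ri.
  have [[ts [d [h1 h2 h3 [h4 h5]]]]|hn] := pselect (exists ts d, [/\ {subset ts <= es},
      free ts, size ts = j & d != 0 /\ theta ts = d *: delta_mx 0 i]); last first.
    exists 0 => ts d h1 h2 h3 h4 h5; case: hn; by exists ts, d.
  exists ((s d)^-1 *: u ts) => ts' d' h1' h2' h3' h4' h5'.
  have e := H5 _ _ _ _ _ h1 h2 h3 h1' h2' h3' h4 h4' h5 h5'.
  have [c [c0 ct cu]] := H1 _ _ h2 h2' (subE _ h1) (subE _ h1') h3 h3' e.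
  rewrite cu scalerA; congr (_ *: _).
  have -> : d' = c * d.
    move: ct; rewrite h5 h5' scalerA => /matrixP/(_ 0 i).
    by rewrite !mxE !eqxx !mulr1.
  by rewrite rmorphM mulfK // fmorph_eq0.
have [r hr] := choice ex; exists (\matrix_i r i) => xs fr sub sz.
set L := \matrix_i r i.
pose Q X := forall xs, free xs -> {subset xs <= <<es>>%VS} -> size xs = j ->
  <<xs>>%VS = X -> u xs = map_mx s (theta xs) *m L.
have QI ys : free ys -> {subset ys <= <<es>>%VS} -> size ys = j ->
    u ys = map_mx s (theta ys) *m L -> Q <<ys>>%VS.
  move=> f1 s1 z1 e1 zs f2 s2 z2 e.
  have [c [c0 ct cu]] := H1 _ _ f1 f2 s1 s2 z1 z2 (esym e).
  by rewrite cu ct e1 map_mxZ scalemxAl.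
apply: (generation (Q := Q) (j := j) (es := es) _ _ fr sub sz) => //.
- move=> ts h1 h2 h3; apply: QI => //; first exact: subE.
  have [i [d [d0 td]]] := H4 _ h1 h2 h3.
  rewrite (hr _ _ _ h1 h2 h3 d0 td) td map_mxZ map_delta_mx -scalemxAl -rowE rowK //.
- move=> x y ds frxy sxy sz1 Qx Qy.
  have [xnot /andP[ynot frd]] : x \notin <<y :: ds>>%VS /\ (y \notin <<ds>>%VS) && free ds.
    by move: frxy; rewrite free_cons => /andP[-> ]; rewrite free_cons.
  have xnd : x \notin <<ds>>%VS.
    by apply: contra xnot; rewrite span_cons => ?; rewrite (subvP (addvSr _ _)).
  have sx : {subset x :: ds <= <<es>>%VS}.
    by move=> t; rewrite inE => th; apply: sxy; rewrite !inE; case/orP: th => ->; rewrite ?orbT.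
  have sy : {subset y :: ds <= <<es>>%VS}.
    by move=> t th; apply: sxy; rewrite inE th orbT.
  apply: QI => //.
  + rewrite free_cons frd andbT; apply: contra xnot => h.
    rewrite -(addrK y x) memvB //; last by rewrite memv_span // inE eqxx.
    by rewrite span_cons (subvP (addvSr _ _)).
  + move=> t; rewrite inE => /orP[/eqP->|th]; last by apply: sx; rewrite inE th orbT.
    by apply: memvD; [apply: sx|apply: sy]; rewrite mem_head.
  + rewrite H2 // H3 // map_mxD mulmxDl; congr (_ + _).
      by apply: Qx; rewrite // free_cons xnd.
    by apply: Qy; rewrite // free_cons ynot.
Qed.

End Generation.

(** * Plücker coordinates *)

Section PluckerVectors.
Variables (F : fieldType) (h N : nat).
Local Notation V := 'rV[F]_N.+1.
Local Notation pdim := (plucker_dim h N).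
Implicit Types (x y v : V) (xs ys ds : seq V).

Definition lmx k xs : 'M[F]_(k, N.+1) := \matrix_(i, j) xs`_i 0 j.

Definition plsel (i : 'I_pdim.+1) (j : 'I_h.+1) : 'I_N.+1 :=
  nth ord0 (enum (nth_subset N h.+1 i)) j.

(** Taken on sequences instead of subspaces, the vector has a definite scale: a change of basis
    multiplies it by the determinant. *)
Definition plv xs : 'rV[F]_pdim.+1 :=
  \row_i \det (colsub (plsel i) (lmx h.+1 xs)).

Lemma plucker_vecE (U : subsp F N h.+1) : plucker_vec U = plv (vbasis (val U)).
Proof. by []. Qed.

Hypothesis hN : (h <= N)%N.

Lemma pdimS : pdim.+1 = 'C(N.+1, h.+1).
Proof. by rewrite /plucker_dim prednK // bin_gt0 ltnS. Qed.

Lemma plv_linear (a b : F) x y ds :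
  plv (a *: x + b *: y :: ds) = a *: plv (x :: ds) + b *: plv (y :: ds).
Proof.
apply/rowP => i; rewrite !mxE; apply: (determinant_multilinear (i0 := ord0)).
- by apply/rowP => j; rewrite !mxE.
- by apply/matrixP => k j; rewrite !mxE.
- by apply/matrixP => k j; rewrite !mxE.
Qed.

Lemma plv_add x y ds : plv (x + y :: ds) = plv (x :: ds) + plv (y :: ds).
Proof. by rewrite -[x]scale1r -[y]scale1r plv_linear !scale1r. Qed.

Lemma plv_mul (P : 'M[F]_h.+1) xs ys : lmx h.+1 ys = P *m lmx h.+1 xs ->
  plv ys = \det P *: plv xs.
Proof.
move=> e; apply/rowP => i; rewrite !mxE e -det_mulmx; congr (\det _).
by apply/matrixP => r c; rewrite !mxE; apply: eq_bigr => k _; rewrite !mxE.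
Qed.

Lemma lmx_span k xs ys : size xs = k -> size ys = k -> {subset ys <= <<xs>>%VS} ->
  exists P : 'M[F]_k, lmx k ys = P *m lmx k xs.
Proof.
move=> sx sy sub; pose t := Tuple (introT eqP sx).
exists (\matrix_(i, j) coord t j ys`_i); apply/matrixP => i j.
have yi : ys`_i \in <<t>>%VS by apply: sub; rewrite mem_nth ?sy.
rewrite !mxE {1}(coord_span yi) summxE; apply: eq_bigr => l _.
by rewrite !mxE.
Qed.

Lemma plv_neq0 xs : free xs -> size xs = h.+1 -> plv xs != 0.
Proof.
move=> fr sx; have dU : \dim <<xs>>%VS == h.+1 by rewrite (eqP fr) sx.
have := plucker_vec_neq0 (mk_subsp dU); rewrite plucker_vecE /=.
have sv : size (vbasis <<xs>>%VS) = h.+1 by rewrite size_tuple (eqP dU).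
have [P e] := lmx_span sx sv (fun v => @vbasis_mem _ _ v <<xs>>%VS).
by rewrite (plv_mul e); apply: contraNneq => ->; rewrite scaler0.
Qed.

Lemma plv_span xs ys : free xs -> free ys -> size xs = h.+1 -> size ys = h.+1 ->
  <<xs>>%VS = <<ys>>%VS -> exists2 c, c != 0 & plv ys = c *: plv xs.
Proof.
move=> fx fy sx sy e; have ysub : {subset ys <= <<xs>>%VS} by move=> y yys; rewrite e memv_span.
have [P eP] := lmx_span sx sy ysub.
exists (\det P); last exact: plv_mul.
apply: contraNneq (plv_neq0 fy sy) => d0; rewrite (plv_mul eP) d0 scale0r //.
Qed.

Lemma plv_cons_mul (P : 'M[F]_h) xs ys : lmx h ys = P *m lmx h xs ->
  forall z, plv (z :: ys) = \det P *: plv (z :: xs).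
Proof.
move=> eP z.
have lcons t zs : lmx h.+1 (t :: zs) = col_mx t (lmx h zs) :> 'M_(1 + h, _).
  apply/matrixP => i j; rewrite mxE.
  by case: (split_ordP (i : 'I_(1 + h))) => k ->; rewrite ?col_mxEu ?col_mxEd ?mxE ?ord1.
pose P1 : 'M_(1 + h) := block_mx 1%:M 0 0 P.
have dP1 : \det P1 = \det P by rewrite det_ublock det1 mul1r.
rewrite (@plv_mul P1 (z :: xs)); first by congr (_ *: _); exact: dP1.
rewrite !lcons eP; symmetry.
have e2 : P1 *m (col_mx z (lmx h xs) : 'M_(1 + h, N.+1)) = col_mx z (P *m lmx h xs).
  by rewrite /P1 mul_block_col !mul0mx mul1mx addr0 add0r.
exact: e2.
Qed.

(** The constant is the determinant of the change of basis in the tail and hence the same for every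
    [x]; a vector outside the span, available because [h <= N], shows that it is not 0. *)
Lemma plv_cons_span xs ys : free xs -> free ys -> size xs = h -> size ys = h ->
  <<xs>>%VS = <<ys>>%VS -> exists2 c, c != 0 & forall x, plv (x :: ys) = c *: plv (x :: xs).
Proof.
move=> fx fy sx sy e.
have ysub : {subset ys <= <<xs>>%VS} by move=> y yys; rewrite e memv_span.
have [P eP] := lmx_span sx sy ysub.
exists (\det P); last exact: plv_cons_mul.
apply/eqP => d0; have [z _ zn] : exists2 z, z \in {:V}%VS & z \notin <<ys>>%VS.
  by apply: vspace_out; rewrite (eqP fy) sy dimvf /dim /= mul1n ltnS.
have fz : free (z :: ys) by rewrite free_cons zn.
by have := plv_neq0 fz (congr1 S sy); rewrite (plv_cons_mul eP) d0 scale0r eqxx.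
Qed.

Lemma plvZ (c : F) x ds : plv (c *: x :: ds) = c *: plv (x :: ds).
Proof. by have := plv_linear c 0 x 0 ds; rewrite !scale0r !addr0. Qed.

Lemma plv_cons_dep x ds : size ds = h -> x \in <<ds>>%VS -> plv (x :: ds) = 0.
Proof.
move=> sd; apply: (span_ind (R := fun x => plv (x :: ds) = 0)).
- by rewrite -(scale0r 0) plvZ scale0r.
- by move=> y z hy hz; rewrite plv_add hy hz addr0.
move=> c e eds; rewrite plvZ (_ : plv _ = 0) ?scaler0 //.
apply/rowP => i; rewrite !mxE; have lt : ((index e ds).+1 < h.+1)%N by rewrite ltnS -sd index_mem.
apply: (@determinant_alternate _ _ _ ord0 (Ordinal lt)) => // j.
by rewrite !mxE /= nth_index.
Qed.

Lemma plv_add2 z x y ds : (0 < h)%N ->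
  plv (z :: x + y :: ds) = plv (z :: x :: ds) + plv (z :: y :: ds).
Proof.
move=> h0; apply/rowP => i; rewrite !mxE -[RHS]mul1r mulrDr.
have i1 : (1 < h.+1)%N by [].
apply: (determinant_multilinear (i0 := Ordinal i1)).
- by apply/rowP => j; rewrite !mxE /= !mul1r.
- by apply/matrixP => -[[|k] hk] j; rewrite !mxE.
- by apply/matrixP => -[[|k] hk] j; rewrite !mxE.
Qed.

Local Notation Si := (fun i : 'I_pdim.+1 => nth_subset N h.+1 i).
Local Notation unitv := (fun s : 'I_N.+1 => delta_mx 0 s : V).

Lemma nth_subset_in (i : 'I_pdim.+1) :
  Si i \in enum [set A : {set 'I_N.+1} | #|A| == h.+1]%SET.
Proof. by rewrite mem_nth // -cardE card_draws card_ord -pdimS. Qed.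

Lemma card_nth_subset (i : 'I_pdim.+1) : #|Si i| = h.+1.
Proof. by have := nth_subset_in i; rewrite mem_enum inE => /eqP. Qed.

Lemma nth_subset_inj (i i' : 'I_pdim.+1) : Si i = Si i' -> i = i'.
Proof.
move/eqP; rewrite nth_uniq ?enum_uniq -?cardE ?card_draws ?card_ord -?pdimS //.
by move/eqP/val_inj.
Qed.

Lemma plsel_in i j : plsel i j \in Si i.
Proof. by rewrite -mem_enum mem_nth // -cardE card_nth_subset. Qed.

(** Together with [plv_zero_row] this splits the Plücker coordinates according to whether their
    index set contains [m]; the matrix for one more coordinate is glued along this splitting. *)
Lemma plv_zero_col xs i m : m \in Si i -> (forall x, x \in xs -> x 0 m = 0) -> plv xs 0 i = 0.
Proof.
move=> mS hx; rewrite mxE.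
have lt : (index m (enum (Si i)) < h.+1)%N.
  by rewrite -[X in (_ < X)%N](card_nth_subset i) cardE index_mem mem_enum.
rewrite (expand_det_col _ (Ordinal lt)) big1 // => k _.
rewrite !mxE /plsel /= nth_index ?mem_enum //.
have [lk|lk] := ltnP k (size xs); first by rewrite hx ?mul0r ?mem_nth.
by rewrite nth_default // mxE mul0r.
Qed.

Lemma plv_zero_row m ds i : m \notin Si i -> plv (unitv m :: ds) 0 i = 0.
Proof.
move=> mS; rewrite mxE (expand_det_row _ ord0) big1 // => k _.
rewrite !mxE /= ?eqxx /=; case: eqP => [e|]; last by rewrite mul0r.
by case/negP: mS; rewrite -e plsel_in.
Qed.

Lemma plv_unitv (ls : seq 'I_N.+1) i : uniq ls -> size ls = h.+1 ->
  plv (map unitv ls) 0 i != 0 -> ls =i Si i.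
Proof.
move=> uls sz nz.
have sub : {subset ls <= Si i}.
  move=> s sls; apply: contraNT nz => sS.
  have lt : (index s ls < h.+1)%N by rewrite -sz index_mem.
  rewrite mxE (expand_det_row _ (Ordinal lt)) big1 // => k _.
  rewrite !mxE /= (nth_map s) ?index_mem // nth_index // !mxE /=.
  case: eqP => [e|]; last by rewrite mul0r.
  by case/negP: sS; rewrite -e plsel_in.
have sub' : {subset ls <= enum (Si i)} by move=> s /sub; rewrite mem_enum.
have le : (size (enum (Si i)) <= size ls)%N by rewrite -cardE card_nth_subset sz.
have [_ eq_i] := uniq_min_size uls sub' le.
by move=> s; rewrite eq_i mem_enum.
Qed.

Definition units m : seq V := [seq unitv s | s : 'I_N.+1 <- enum 'I_N.+1 & (s < m)%N].

Lemma units_span m x : reflect (forall j : 'I_N.+1, (m <= j)%N -> x 0 j = 0) (x \in <<units m>>%VS).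
Proof.
apply: (iffP idP) => [|hx].
  apply: (span_ind (R := fun x => forall j : 'I_N.+1, (m <= j)%N -> x 0 j = 0)).
  - by move=> j _; rewrite mxE.
  - by move=> y z hy hz j mj; rewrite mxE hy ?hz ?addr0.
  move=> c _ /mapP[s + ->] j mj; rewrite mem_filter => /andP[sm _].
  rewrite !mxE eqxx /=; case: eqP => [e|_]; rewrite ?mulr0 //.
  by move: mj; rewrite e leqNgt sm.
rewrite (row_sum_delta x); apply: memv_suml => s _.
have [ms|sm] := leqP m s; first by rewrite hx // scale0r mem0v.
by apply/memvZ/memv_span/map_f; rewrite mem_filter sm mem_enum.
Qed.

Lemma sub_units m ts : {subset ts <= units m} ->
  exists2 ls : seq 'I_N.+1, ts = map unitv ls & all (fun s : 'I__ => (s < m)%N) ls.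
Proof.
elim: ts => [|t ts IH] sub; first by exists [::].
have [|ls -> al] := IH; first by move=> z zt; apply: sub; rewrite inE zt orbT.
have /mapP[s + ->] := sub t (mem_head _ _); rewrite mem_filter => /andP[sm _].
by exists (s :: ls); rewrite //= sm.
Qed.

Lemma free_unitv (ls : seq 'I_N.+1) : uniq ls -> free [seq (delta_mx 0 s : V) | s <- ls].
Proof.
elim: ls => [|t ls IH] /=; first by rewrite nil_free.
case/andP => tl ul; rewrite free_cons IH // andbT; apply/negP => tL.
suff /eqP : (delta_mx 0 t : V) 0 t = 0 by rewrite mxE !eqxx oner_eq0.
apply: (span_ind (R := fun x : V => x 0 t = 0)) tL; first by rewrite mxE.
  by move=> x y hx hy; rewrite mxE hx hy addr0.
move=> c _ /mapP[t' t'l ->]; rewrite !mxE eqxx /=.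
by case: eqP => [tt'|_]; rewrite ?mulr0 //; rewrite tt' t'l in tl.
Qed.

Lemma plv_unitv_coord (ls : seq 'I_N.+1) : free (map unitv ls) -> size ls = h.+1 ->
  exists i d, d != 0 /\ plv (map unitv ls) = d *: delta_mx 0 i.
Proof.
move=> fr sz; have uls : uniq ls by apply: (map_uniq (f := unitv)); exact: free_uniq.
have sz' : size (map unitv ls) = h.+1 by rewrite size_map.
have /rV0Pn[i nz] := plv_neq0 fr sz'.
move: (fun i => @plv_unitv ls i uls sz) nz; move: (plv _) => p hp nz.
exists i, (p 0 i); split=> //; apply/rowP => i'; rewrite !mxE eqxx /=.
case: eqP => [->|ne]; rewrite ?mulr1 ?mulr0 //; apply: contra_notP ne => /eqP nz'.
apply: nth_subset_inj; apply/setP => s.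
by rewrite -(hp _ nz) -(hp _ nz').
Qed.

Lemma span_unitv (ls ls' : seq 'I_N.+1) : ls =i ls' ->
  <<map unitv ls>>%VS = <<map unitv ls'>>%VS.
Proof. by move=> e; apply: eq_span => x; apply/mapP/mapP => -[s + ->]; exists s; rewrite ?e // -e. Qed.

Lemma plv_delta (i : 'I_pdim.+1) : exists xs c,
  [/\ free xs, size xs = h.+1, c != 0 & plv xs = c *: delta_mx 0 i].
Proof.
have sz : size (enum (Si i)) = h.+1 by rewrite -cardE card_nth_subset.
have fr := free_unitv (enum_uniq (Si i)).
have [i' [d [d0 e]]] := plv_unitv_coord fr sz.
exists (map unitv (enum (Si i))), d; rewrite size_map; split=> //.
rewrite e; congr (_ *: delta_mx _ _); apply: nth_subset_inj; apply/setP => t.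
rewrite -[RHS]mem_enum; apply/esym.
by apply: plv_unitv; rewrite ?enum_uniq // e !mxE !eqxx mulr1.
Qed.

(** Every unit vector is a Plücker vector up to a factor, so the images of Plücker vectors under [s]
    detect every row of [L]. *)
Lemma plv_separates w (s : {rmorphism F -> F}) (L : 'M[F]_(pdim.+1, w)) :
  (forall xs, free xs -> size xs = h.+1 -> map_mx s (plv xs) *m L = 0) -> L = 0.
Proof.
move=> hL; apply/row_matrixP => i; rewrite row0.
have [xs [c [fx zx c0 e]]] := plv_delta i.
have := hL _ fx zx; rewrite e map_mxZ map_delta_mx -scalemxAl -rowE.
by move/eqP; rewrite scaler_eq0 fmorph_eq0 (negPf c0) => /eqP.
Qed.

Lemma plv_ext w m (s : {rmorphism F -> F}) (u : seq V -> 'rV[F]_w) :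
  (forall xs ys c, free xs -> free ys -> {subset xs <= <<units m>>%VS} ->
     {subset ys <= <<units m>>%VS} -> size xs = h.+1 -> size ys = h.+1 ->
     <<xs>>%VS = <<ys>>%VS -> c != 0 -> plv ys = c *: plv xs -> u ys = s c *: u xs) ->
  (forall x y ds, free (x :: y :: ds) -> {subset x :: y :: ds <= <<units m>>%VS} ->
     size ds = h -> u (x + y :: ds) = u (x :: ds) + u (y :: ds)) ->
  exists L : 'M[F]_(pdim.+1, w), forall xs, free xs -> {subset xs <= <<units m>>%VS} ->
    size xs = h.+1 -> u xs = map_mx s (plv xs) *m L.
Proof.
move=> H1 H3; apply: alternating_ext.
- move=> xs ys fx fy sx sy zx zy e; have [c c0 hc] := plv_span fx fy zx zy e.
  by exists c; split=> //; apply: H1.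
- by move=> x y ds _ _ _; rewrite plv_add.
- by move=> x y ds fr sub [sz]; apply: H3.
- move=> ts /sub_units[ls -> _] fr; rewrite size_map; exact: plv_unitv_coord.
move=> ts ts' i d d' /sub_units[ls -> _] fr; rewrite size_map => sz.
move=> /sub_units[ls' -> _] fr'; rewrite size_map => sz' d0 d0' e e'.
have ul : uniq ls by apply: (map_uniq (f := unitv)); exact: free_uniq.
have ul' : uniq ls' by apply: (map_uniq (f := unitv)); exact: free_uniq.
apply: span_unitv => t; rewrite (plv_unitv (i := i) ul sz) ?(plv_unitv (i := i) ul' sz') //.
  by rewrite e' mxE [_ 0 i]mxE !eqxx mulr1.
by rewrite e mxE [_ 0 i]mxE !eqxx mulr1.
Qed.

(** Putting the unit vector of [m] in front of [h] vectors from the first [m] coordinates lets the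
    Plücker coordinates of degree [h.+1] serve as alternating coordinates of degree [h], without a
    second Plücker space. *)
Lemma plv_cons_ext w (m : 'I_N.+1) (s : {rmorphism F -> F}) (u : seq V -> 'rV[F]_w) :
  (forall xs ys c, free xs -> free ys -> {subset xs <= <<units m>>%VS} ->
     {subset ys <= <<units m>>%VS} -> size xs = h -> size ys = h ->
     <<xs>>%VS = <<ys>>%VS -> c != 0 -> (forall x, plv (x :: ys) = c *: plv (x :: xs)) ->
     u ys = s c *: u xs) ->
  (forall x y ds, free (x :: y :: ds) -> {subset x :: y :: ds <= <<units m>>%VS} ->
     (size ds).+1 = h -> u (x + y :: ds) = u (x :: ds) + u (y :: ds)) ->
  exists L : 'M[F]_(pdim.+1, w), forall xs, free xs -> {subset xs <= <<units m>>%VS} ->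
    size xs = h -> u xs = map_mx s (plv (unitv m :: xs)) *m L.
Proof.
move=> H1 H3.
have mE xs : free xs -> {subset xs <= <<units m>>%VS} -> free (unitv m :: xs).
  move=> fr sub; rewrite free_cons fr andbT; apply/negP => h1.
  have /span_subvP h2 : {subset xs <= <<units m>>%VS} by [].
  have /units_span/(_ m (leqnn _))/eqP := subvP h2 _ h1.
  by rewrite mxE !eqxx oner_eq0.
have subE (ts : seq V) : {subset ts <= units m} -> {subset ts <= <<units m>>%VS}.
  by move=> h1 t /h1; apply: memv_span.
apply: (alternating_ext (theta := fun xs => plv (unitv m :: xs))).
- move=> xs ys fx fy sx sy zx zy e; have [c c0 hc] := plv_cons_span fx fy zx zy e.
  by exists c; split=> //; apply: (H1 xs).
- by move=> x y ds _ _ sz; rewrite plv_add2 // -sz.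
- by move=> x y ds fr sub sz; apply: H3.
- move=> ts sub fr; have := mE _ fr (subE _ sub); move: sub => /sub_units[ls -> _] fm.
  by rewrite size_map => sz; apply: (@plv_unitv_coord (m :: ls)); rewrite //= sz.
move=> ts ts' i d d' sub fr + sub' fr'.
have := mE _ fr (subE _ sub); have := mE _ fr' (subE _ sub').
move: sub sub' => /sub_units[ls -> al] /sub_units[ls' -> al'] fm' fm.
rewrite !size_map => sz sz' d0 d0' e e'.
have ul : uniq (m :: ls) by apply: (map_uniq (f := unitv)); exact: (free_uniq fm).
have ul' : uniq (m :: ls') by apply: (map_uniq (f := unitv)); exact: (free_uniq fm').
have eqm : m :: ls =i m :: ls'.
  move=> t; rewrite (plv_unitv (i := i) ul) ?(plv_unitv (i := i) ul') //= ?sz ?sz' //.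
    by rewrite e' mxE [_ 0 i]mxE !eqxx mulr1.
  by rewrite e mxE [_ 0 i]mxE !eqxx mulr1.
apply: span_unitv => t; have := eqm t; rewrite !inE.
by case: (eqVneq t m) => //= -> _; move: ul ul' => /= /andP[/negPf-> _] /andP[/negPf->].
Qed.

End PluckerVectors.

(** * Embeddings of Grassmann spaces *)

Section GrassmannEmbeddings.

(* Embeddings of the Grassmann space of [k]-dimensional (vector dimension)
   subspaces, as total functions whose values in other dimensions are junk. *)
Definition gembed (F : fieldType) n (P : geometry) k (f : {vspace 'rV[F]_n} -> pt P) :=
  (forall X Y, \dim X = k -> \dim Y = k -> f X = f Y -> X = Y) /\
  (forall A B : {vspace 'rV[F]_n}, (A <= B)%VS -> (\dim A).+1 = k -> \dim B = k.+1 ->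
    exists2 l, lines P l & forall z, l z <-> exists X, [/\ (A <= X <= B)%VS, \dim X = k & z = f X]).

Variables (F : fieldType) (h N d : nat).
Local Notation V := 'rV[F]_N.+1.
Variable (T : {vspace V} -> pt (PG F d)).
Hypothesis hT : gembed h.+1 T.
Hypothesis hN : (h <= N)%N.
Implicit Types (x y v w : V) (xs ys ds a : seq V) (X Y : {vspace V}).

Let R X z := hc (T X) z.

Lemma T_lineE x y ds : free (x :: y :: ds) -> size ds = h -> exists l,
  [/\ lines (PG F d) l, l (T <<x :: ds>>%VS), l (T <<y :: ds>>%VS),
   T <<x :: ds>>%VS <> T <<y :: ds>>%VS &
   forall z, l z <-> exists X, [/\ (<<ds>> <= X <= <<x :: y :: ds>>)%VS, \dim X = h.+1 & z = T X]].
Proof.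
move=> fr sz; have [fx fy] := free_consr fr.
have dx := dim_free_cons fx sz; have dy := dim_free_cons fy sz.
have dd : (\dim <<ds>>%VS).+1 = h.+1.
  by move: fx; rewrite free_cons => /andP[_ /eqP->]; rewrite sz.
have dxy := dim_free_cons fr (congr1 S sz).
have [hi hl] := hT.
have sdx : (<<ds>> <= <<x :: ds>>)%VS by rewrite span_cons addvSr.
have sdy : (<<ds>> <= <<y :: ds>>)%VS by rewrite span_cons addvSr.
have syxy : (<<y :: ds>> <= <<x :: y :: ds>>)%VS by rewrite [X in (_ <= X)%VS]span_cons addvSr.
have sxxy : (<<x :: ds>> <= <<x :: y :: ds>>)%VS by rewrite span_consC [X in (_ <= X)%VS]span_cons addvSr.
have [l ll lP] := hl _ _ (subv_trans sdx sxxy) dd dxy.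
exists l; split=> //.
- by apply/lP; exists <<x :: ds>>%VS; rewrite sdx sxxy.
- by apply/lP; exists <<y :: ds>>%VS; rewrite sdy syxy.
move=> /(hi _ _ dx dy) e; move: fr; rewrite free_cons => /andP[/negP xn _]; apply: xn.
by rewrite -e memv_span // mem_head.
Qed.

Lemma T_free x y ds z1 z2 : free (x :: y :: ds) -> size ds = h ->
  R <<x :: ds>>%VS z1 -> R <<y :: ds>>%VS z2 -> free [:: z1; z2].
Proof. by move=> fr sz h1 h2; have [l [_ _ _ ne _]] := T_lineE fr sz; apply: hc_free2 ne h1 h2. Qed.

Lemma T_line x y w ds z1 z2 z : free (x :: y :: ds) -> size ds = h ->
  w \in <<x :: y :: ds>>%VS -> w \notin <<ds>>%VS ->
  R <<x :: ds>>%VS z1 -> R <<y :: ds>>%VS z2 -> R <<w :: ds>>%VS z -> z \in <<[:: z1; z2]>>%VS.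
Proof.
move=> fr sz wxy wd h1 h2 hz; have [l [ll lx ly ne lP]] := T_lineE fr sz.
apply/(hc_line ne ll lx ly h1 h2 hz)/lP; exists <<w :: ds>>%VS; split=> //.
  apply/andP; split; first by rewrite span_cons addvSr.
  apply/span_subvP => t; rewrite inE => /orP[/eqP->//|td].
  by rewrite memv_span // !inE td !orbT.
apply: dim_free_cons => //; rewrite free_cons wd.
by move: fr; rewrite !free_cons => /and3P[].
Qed.

Lemma T_lineP x y ds X z1 z2 z : free (x :: y :: ds) -> size ds = h -> \dim X = h.+1 ->
  R <<x :: ds>>%VS z1 -> R <<y :: ds>>%VS z2 -> R X z -> z \in <<[:: z1; z2]>>%VS ->
  (<<ds>> <= X <= <<x :: y :: ds>>)%VS.
Proof.
move=> fr sz dX h1 h2 hz zL; have [l [ll lx ly ne lP]] := T_lineE fr sz.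
have /lP[Y [YL dY /hT.1 e]] := (hc_line ne ll lx ly h1 h2 hz).2 zL.
by rewrite e.
Qed.

Lemma T_onto x y ds z1 z2 z : free (x :: y :: ds) -> size ds = h ->
  R <<x :: ds>>%VS z1 -> R <<y :: ds>>%VS z2 -> z != 0 -> z \in <<[:: z1; z2]>>%VS ->
  exists2 X, \dim X = h.+1 & R X z.
Proof.
move=> fr sz h1 h2 z0 zL; have [l [ll lx ly ne lP]] := T_lineE fr sz.
have hZ : hc (vpoint z0) z by [].
have /lP[X [_ dX e]] := (hc_line ne ll lx ly h1 h2 hZ).2 zL.
by exists X; rewrite // /R -e.
Qed.

Definition plform (s : {rmorphism F -> F}) q (L : 'M[F]_(_, q)) xs : 'rV[F]_q :=
  map_mx s (plv h xs) *m L.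

Lemma hc_plform s (L : 'M[F]_(_, d.+1)) xs ys : free xs -> free ys -> size xs = h.+1 ->
  size ys = h.+1 -> <<xs>>%VS = <<ys>>%VS ->
  R <<xs>>%VS (plform s L xs) -> R <<ys>>%VS (plform s L ys).
Proof.
move=> fx fy sx sy e; have [c c0 hc1] := plv_span fx fy sx sy e.
rewrite -e => h1; apply: (hcI _ _ h1); rewrite /plform hc1 map_mxZ -scalemxAl.
  by rewrite scaler_eq0 negb_or fmorph_eq0 c0 (hc_neq0 h1).
by rewrite memvZ ?memv_line.
Qed.

End GrassmannEmbeddings.

(** * Extending the matrix formula from the first [m] coordinates to [m.+1] *)

Section OneMoreCoordinate.
Variables (F : fieldType) (h N d : nat).
Local Notation V := 'rV[F]_N.+1.
Variable (T : {vspace V} -> pt (PG F d)).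
Hypothesis hT : gembed h.+1 T.
Hypothesis hN : (h <= N)%N.
Variables (m : 'I_N.+1) (s : {rmorphism F -> F}).
Variable L0 : 'M[F]_((plucker_dim h N).+1, d.+1).
Hypothesis hm : (h.+2 <= m)%N.
Implicit Types (x y v w : V) (xs ys ds a : seq V) (X Y : {vspace V}).

Let R X z := hc (T X) z.
Let Vm : {vspace V} := <<units F N m>>%VS.
Let e : V := delta_mx 0 m.
Let G xs := plform s L0 xs.

Hypothesis claim_m : forall xs, free xs -> {subset xs <= Vm} -> size xs = h.+1 ->
  R <<xs>>%VS (G xs).

Lemma e_out : e \notin Vm.
Proof.
by apply/negP => /units_span/(_ m (leqnn _))/eqP; rewrite mxE !eqxx oner_eq0.
Qed.

Lemma span_sub xs : {subset xs <= Vm} -> (<<xs>> <= Vm)%VS.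
Proof. by move=> sub; apply/span_subvP. Qed.

Lemma free_e xs : free xs -> {subset xs <= Vm} -> free (e :: xs).
Proof.
move=> fr sub; rewrite free_cons fr andbT; apply: contra e_out.
exact: (subvP (span_sub sub)).
Qed.

Lemma sub_cons x xs : x \in Vm -> {subset xs <= Vm} -> {subset x :: xs <= Vm}.
Proof. by move=> xV sub t; rewrite inE => /orP[/eqP->//|/sub]. Qed.

Lemma dim_Vm : (h.+2 <= \dim Vm)%N.
Proof.
pose ls := [seq widen_ord (ltnW (ltn_ord m)) i | i <- enum 'I_m].
have ul : uniq ls.
  rewrite map_inj_uniq ?enum_uniq // => i j /(congr1 val)/= ij.
  exact: val_inj.
have := free_unitv F ul => /eqP; rewrite [X in _ = X]size_map [X in _ = X]size_map size_enum_ord => dE.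
apply: (leq_trans hm); rewrite -dE; apply/dimvS/span_subvP => _ /mapP[_ /mapP[i _ ->] ->].
by apply/memv_span/map_f; rewrite mem_filter mem_enum /= ltn_ord.
Qed.

Lemma out_of_span xs : (size xs < h.+2)%N -> exists2 v, v \in Vm & v \notin <<xs>>%VS.
Proof.
move=> sz; apply: vspace_out; apply: leq_ltn_trans (dim_span _) _.
exact: leq_trans sz dim_Vm.
Qed.

Lemma G_add x y ds : G (x + y :: ds) = G (x :: ds) + G (y :: ds).
Proof. by rewrite /G /plform plv_add map_mxD mulmxDl. Qed.

Lemma GN x ds : G (- x :: ds) = - G (x :: ds).
Proof. by rewrite -scaleN1r /G /plform plvZ map_mxZ rmorphN1 -scalemxAl scaleN1r. Qed.

Lemma G_free v a u0 : free a -> {subset a <= Vm} -> size a = h -> v \in Vm ->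
  v \notin <<a>>%VS -> R <<e :: a>>%VS u0 -> free [:: G (v :: a); u0].
Proof.
move=> fa sa za vV va hu.
have fev : free (v :: e :: a).
  by rewrite free_consC; apply: free_e; [rewrite free_cons va|exact: sub_cons].
by apply: (T_free hT fev za) => //; apply: claim_m; [rewrite free_cons va|exact: sub_cons|rewrite /= za].
Qed.

Lemma G_free3 v v' a u0 : free (v :: v' :: a) -> {subset a <= Vm} -> size a = h -> v \in Vm ->
  v' \in Vm -> R <<e :: a>>%VS u0 -> free [:: u0; G (v :: a); G (v' :: a)].
Proof.
move=> fr sa za vV v'V hu; have [fv fv'] := free_consr fr.
have sub := sub_cons vV (sub_cons v'V sa).
have h1 : R <<v :: a>>%VS (G (v :: a)) by apply: claim_m; [|exact: sub_cons|rewrite /= za].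
have h2 : R <<v' :: a>>%VS (G (v' :: a)) by apply: claim_m; [|exact: sub_cons|rewrite /= za].
rewrite free_cons (T_free hT fr za h1 h2) andbT; apply/negP => uL.
have fe : free (e :: a) by apply: free_e => //; move: fv; rewrite free_cons => /andP[].
have := T_lineP hT fr za (dim_free_cons fe za) h1 h2 hu uL => /andP[_ ].
move/subv_trans/(_ (span_sub sub))/subvP/(_ e); rewrite memv_span ?mem_head // => /(_ isT).
exact/negP/e_out.
Qed.

(** [<<v + e :: a>>] lies in the pencil of [<<v :: a>>] and [<<e :: a>>] and differs from both, so
    both coefficients of its coordinate vector are nonzero; their ratio scales [u]. *)
Lemma exists_upart a v : free a -> {subset a <= Vm} -> size a = h -> v \in Vm ->
  v \notin <<a>>%VS -> exists u, R <<e :: a>>%VS u /\ R <<(v + e)%R :: a>>%VS (G (v :: a) + u).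
Proof.
move=> fa sa za vV va; have fva : free (v :: a) by rewrite free_cons va.
have fe := free_e fa sa.
have fev : free (v :: e :: a) by rewrite free_consC; apply: free_e => //; exact: sub_cons.
have ve_a : v + e \notin <<a>>%VS.
  apply: contra e_out => hh; rewrite -(addKr v e) memvD ?memvN //.
  exact: (subvP (span_sub sa)).
have fve : free (v + e :: a) by rewrite free_cons ve_a.
have hu0 : R <<e :: a>>%VS (rep (T <<e :: a>>%VS)) by exact: hc_rep.
have hz : R <<(v + e)%R :: a>>%VS (rep (T <<(v + e)%R :: a>>%VS)) by exact: hc_rep.
have hg : R <<v :: a>>%VS (G (v :: a)) by apply: claim_m => //; [exact: sub_cons|rewrite /= za].
move: (rep _) (rep _) hu0 hz => z u0 hu0 hz.
have veL : v + e \in <<v :: e :: a>>%VS by rewrite memvD // memv_span // !inE eqxx ?orbT.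
have [al [be zE]] := mem_span2P _ _ _ (T_line hT fev za veL ve_a hg hu0 hz).
have inj x y : free (x :: a) -> free (y :: a) -> forall t, R <<x :: a>>%VS t ->
    forall t', R <<y :: a>>%VS t' -> t \in <[t']>%VS -> x \in <<y :: a>>%VS.
  move=> fx fy t ht t' ht' /(hc_inj ht ht')/hT.1 => <- //; last first.
  - exact: dim_free_cons.
  - exact: dim_free_cons.
  - by rewrite memv_span // mem_head.
have al0 : al != 0.
  apply/eqP => a0; have : v + e \in <<e :: a>>%VS.
    by apply: (inj _ _ fve fe _ hz _ hu0); rewrite zE a0 scale0r add0r memvZ ?memv_line.
  move=> hh; have : v \in <<e :: a>>%VS by rewrite -(addrK e v) memvB // memv_span // mem_head.
  by move: fev; rewrite free_cons => /andP[/negP].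
have be0 : be != 0.
  apply/eqP => b0; have : v + e \in <<v :: a>>%VS.
    by apply: (inj _ _ fve fva _ hz _ hg); rewrite zE b0 scale0r addr0 memvZ ?memv_line.
  move=> hh; have : e \in <<v :: a>>%VS by rewrite -(addKr v e) memvD // memvN memv_span // mem_head.
  by move: fev; rewrite free_consC free_cons => /andP[/negP].
exists ((be / al) *: u0); split.
  apply: (hcI _ _ hu0); last by rewrite memvZ ?memv_line.
  by rewrite scaler_eq0 negb_or (hc_neq0 hu0) mulf_neq0 ?invr_eq0.
have eq1 : G (v :: a) + (be / al) *: u0 = al^-1 *: z.
  by rewrite zE scalerDr !scalerA mulVf // scale1r mulrC.
rewrite eq1; apply: (hcI _ _ hz); last by rewrite memvZ ?memv_line.
by rewrite scaler_eq0 negb_or (hc_neq0 hz) invr_eq0 al0.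
Qed.

(** The pencil of [<<v + e :: a>>] and [<<v' + e :: a>>] contains [<<v - v' :: a>>], where [e] has
    cancelled and the formula is already known; this forces the scalings belonging to [v] and [v']
    to agree. *)
Lemma upart_indep1 a v v' u : free (v :: v' :: a) -> {subset a <= Vm} -> size a = h ->
  v \in Vm -> v' \in Vm -> R <<e :: a>>%VS u ->
  R <<(v + e)%R :: a>>%VS (G (v :: a) + u) -> R <<(v' + e)%R :: a>>%VS (G (v' :: a) + u).
Proof.
move=> fr sa za vV v'V hu hv; have [fv fv'] := free_consr fr.
have [va fa] : v \notin <<a>>%VS /\ free a by move: fv; rewrite free_cons => /andP[].
have v'a : v' \notin <<a>>%VS by move: fv'; rewrite free_cons => /andP[].
have [u' [hu' hv']] := exists_upart fa sa za v'V v'a.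
have [k k0 u'E] := hc_scale hu hu'.
have fr3 := G_free3 fr sa za vV v'V hu.
have aV := subvP (span_sub sa).
have v'e_a : v' + e \notin <<a>>%VS.
  by apply: contra e_out => hh; rewrite -(addKr v' e) memvD ?memvN //; exact: aV.
have fee : free (v + e :: v' + e :: a).
  rewrite free_cons free_cons v'e_a fa !andbT; apply/negP; rewrite span_cons.
  move=> /memv_addP[_ /vlineP[c ->] [w wa hE]].
  have [c1|c1] := eqVneq c 1.
    move: fr; rewrite free_cons => /andP[/negP + _]; apply; rewrite span_cons.
    have -> : v = v' + w.
      apply: (addIr e); rewrite hE c1 scale1r; exact: addrAC.
    by rewrite memv_add ?memv_line.
  case/negP: e_out; have -> : e = (1 - c)^-1 *: (c *: v' + w - v).
    have -> : c *: v' + w - v = (1 - c) *: e.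
      apply: (addIr (v + c *: e)); rewrite scalerBl scale1r.
      have -> : e - c *: e + (v + c *: e) = v + e by rewrite addrCA subrK.
      by rewrite hE scalerDr addrA subrK addrAC.
    by rewrite scalerA mulVf ?scale1r // subr_eq0 eq_sym.
  by rewrite memvZ // memvB // memvD ?memvZ // aV.
have vv'a : v - v' \notin <<a>>%VS.
  move: fr; rewrite free_cons => /andP[+ _]; apply: contra => hh.
  by rewrite -(subrK v' v) span_cons addrC memv_add // memv_line.
have vvL : v - v' \in <<(v + e)%R :: (v' + e)%R :: a>>%VS.
  have -> : v - v' = (v + e) - (v' + e) by rewrite opprD addrACA subrr addr0.
  by rewrite memvB // memv_span // !inE eqxx ?orbT.
have hd : R <<(v - v')%R :: a>>%VS (G (v :: a) - G (v' :: a)).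
  rewrite -GN -G_add; apply: claim_m; rewrite /= ?za //.
    by rewrite free_cons vv'a.
  by apply: sub_cons => //; rewrite memvB.
have [al [be E]] := mem_span2P _ _ _ (T_line hT fee za vvL vv'a hv hv' hd).
have [e1 e2 e3] : [/\ al + be * k = 0, al - 1 = 0 & be + 1 = 0].
  apply: (lc_free3 fr3); move/eqP: E; rewrite eq_sym -subr_eq0 u'E => /eqP <-.
  by apply/rowP => i; rewrite !mxE; ring.
have k1 : k = 1.
  move: e1; rewrite (subr0_eq e2).
  have -> : be = -1 by apply/eqP; rewrite -addr_eq0 e3.
  by rewrite mulN1r => /subr0_eq.
by rewrite u'E k1 scale1r in hv'.
Qed.

(* [u] is the multiple of the coordinate vector of [<<e :: a>>] for which adding
   vectors corresponds to adding coordinate vectors; as it does not depend on [v],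
   it is semilinear and alternating in [a]. *)
Lemma upart a : free a -> {subset a <= Vm} -> size a = h -> exists u, R <<e :: a>>%VS u /\
  forall v, v \in Vm -> v \notin <<a>>%VS -> R <<(v + e)%R :: a>>%VS (G (v :: a) + u).
Proof.
move=> fa sa za; have [v0 v0V v0a] : exists2 v, v \in Vm & v \notin <<a>>%VS.
  by apply: out_of_span; rewrite za.
have [u [hu hv0]] := exists_upart fa sa za v0V v0a.
exists u; split=> // v vV va.
have fv : free (v :: a) by rewrite free_cons va.
have fv0 : free (v0 :: a) by rewrite free_cons v0a.
have [vL|vL] := boolP (v \in <<v0 :: a>>%VS); last first.
  by apply: (@upart_indep1 a v0 v u) => //; rewrite free_consC free_cons vL.
(* When [v] and [v0] are dependent modulo [a], the comparison passes through a third vector; [Vm]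
   has room for it because [h.+2 <= m]. *)
have [w wV wL] : exists2 w, w \in Vm & w \notin <<v0 :: a>>%VS.
  by apply: out_of_span; rewrite /= za.
have eL := span_exchange vL va.
have hw : R <<(w + e)%R :: a>>%VS (G (w :: a) + u).
  by apply: (@upart_indep1 a v0 w u) => //; rewrite free_consC free_cons wL.
by apply: (@upart_indep1 a w v u) => //; rewrite free_cons eL wL.
Qed.

Section UpPart.
Variable u : seq V -> 'rV[F]_d.+1.
Hypothesis hu : forall a, free a -> {subset a <= Vm} -> size a = h -> R <<e :: a>>%VS (u a) /\
  forall v, v \in Vm -> v \notin <<a>>%VS -> R <<(v + e)%R :: a>>%VS (G (v :: a) + u a).

(** The known summand [G (v :: a)] scales by [s c], and the point of [<<v + e :: a>>] fixes the
    ratio of the two summands, so [u] must scale alike. *)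
Lemma upart_span xs ys c : free xs -> free ys -> {subset xs <= Vm} -> {subset ys <= Vm} ->
  size xs = h -> size ys = h -> <<xs>>%VS = <<ys>>%VS -> c != 0 ->
  (forall x, plv h (x :: ys) = c *: plv h (x :: xs)) -> u ys = s c *: u xs.
Proof.
move=> fx fy sx sy zx zy exy c0 hc1.
have [v vV vx] : exists2 v, v \in Vm & v \notin <<xs>>%VS by apply: out_of_span; rewrite zx.
have [hx1 /(_ v vV vx) hx2] := hu fx sx zx.
have [hy1 hy2] := hu fy sy zy; have := hy2 v vV; rewrite -exy => /(_ vx) {}hy2.
rewrite span_cons -exy -span_cons in hy1.
rewrite span_cons -exy -span_cons /G /plform hc1 map_mxZ -scalemxAl in hy2.
have [k k0 kE] := hc_scale hx1 hy1; have [l l0 lE] := hc_scale hx2 hy2.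
have fr2 := G_free fx sx zx vV vx hx1.
have [e1 e2] : s c - l = 0 /\ k - l = 0.
  apply: (lc_free2 fr2); move/eqP: lE; rewrite -subr_eq0 kE => /eqP <-.
  by rewrite /G /plform; apply/rowP => i; rewrite !mxE; ring.
by rewrite kE (subr0_eq e2) (subr0_eq e1).
Qed.

(** The pencil of [<<x, y + e, ds>>] and [<<e, y, ds>>] contains [<<x - e, y + e, ds>>], which is
    also [<<y + e, x + y, ds>>]. With [g = G (y :: x :: ds)], this makes [g + u (x + y :: ds)] a
    combination of [g + u (x :: ds)] and [u (y :: ds)], and the coefficient of [g] yields the
    coefficient 1 of [u (x :: ds)]. *)
Lemma upart_add1 x y ds : free (x :: y :: ds) -> {subset x :: y :: ds <= Vm} ->
  (size ds).+1 = h -> exists b, u (x + y :: ds) = u (x :: ds) + b *: u (y :: ds).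
Proof.
move=> fr sub sz; have [fx fy] := free_consr fr.
have h0 : (0 < h)%N by rewrite -sz.
have xV : x \in Vm by apply: sub; rewrite mem_head.
have yV : y \in Vm by apply: sub; rewrite !inE eqxx orbT.
have sd : {subset ds <= Vm} by move=> t td; apply: sub; rewrite !inE td !orbT.
have dV := subvP (span_sub sd).
have [xn yn] : x \notin <<y :: ds>>%VS /\ y \notin <<x :: ds>>%VS.
  by move: (fr); rewrite free_consC free_cons => /andP[-> _]; move: fr; rewrite free_cons => /andP[->].
have xyd : x + y \notin <<ds>>%VS.
  apply: contra xn => hh; rewrite -(addrK y x) memvB //; last by rewrite memv_span // mem_head.
  by rewrite span_cons (subvP (addvSr _ _)).
have fd : free ds by move: fy; rewrite free_cons => /andP[].
have fxy : free (x + y :: ds) by rewrite free_cons xyd.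
have [hx1 hx2] := hu fx (sub_cons xV sd) sz.
have [hy1 hy2] := hu fy (sub_cons yV sd) sz.
have [hs1 hs2] := hu fxy (sub_cons (memvD xV yV) sd) sz.
have fed := free_e fd sd.
have fxye : free (x :: y :: e :: ds).
  rewrite free_consC -cat1s -[x :: _]cat1s catA.
  rewrite (perm_free (permEl (perm_catCA [:: y; x] [:: e] ds))) /= free_e //.
    by rewrite free_consC.
  by move=> t; rewrite !inE => /or3P[/eqP->|/eqP->|/sd].
have fxe := (free_consr fxye).1; have fye := (free_consr fxye).2.
have ed_sz : size (e :: ds) = h by [].
have xye : x + y \notin <<e :: ds>>%VS.
  move: fxye; rewrite free_cons => /andP[+ _]; apply: contra => hh.
  rewrite -(addrK y x) memvB //; last by rewrite memv_span // mem_head.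
  by rewrite span_cons (subvP (addvSr _ _)).
have hxe : R <<x :: e :: ds>>%VS (u (x :: ds)) by rewrite span_consC.
have hye : R <<y :: e :: ds>>%VS (u (y :: ds)) by rewrite span_consC.
have hse : R <<(x + y)%R :: e :: ds>>%VS (u (x + y :: ds)) by rewrite span_consC.
have xyL : x + y \in <<x :: y :: e :: ds>>%VS by rewrite memvD // memv_span // !inE eqxx ?orbT.
have [al [be sE]] := mem_span2P _ _ _ (T_line hT fxye ed_sz xyL xye hxe hye hse).
have yxy : y \notin <<(x + y)%R :: ds>>%VS.
  have : free (y :: x + y :: ds).
    by apply: (@span_free _ _ _ (x :: y :: ds)) => //; rewrite [LHS]span_consC span_addl.
  by rewrite free_cons => /andP[].
have hz := hs2 y yV yxy.
set g := G (y :: x :: ds).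
have gE : G (y :: x + y :: ds) = g.
  rewrite /g /G /plform plv_add2 // [plv _ (y :: y :: ds)]plv_cons_dep ?addr0 //.
  by rewrite memv_span // mem_head.
rewrite gE in hz.
have hg : R <<y :: x :: ds>>%VS g.
  apply: (@claim_m (y :: x :: ds)); [by rewrite free_consC| |by rewrite /= sz].
  by apply: sub_cons => //; exact: sub_cons.
have fr3 : free [:: g; u (x :: ds); u (y :: ds)].
  have frr : free [:: u (x :: ds); u (y :: ds)].
    by apply: (T_free hT fxye ed_sz); rewrite span_consC.
  rewrite free_cons frr andbT; apply/negP => gL.
  have dyx : \dim <<y :: x :: ds>>%VS = h.+1.
    by apply: dim_free_cons; [rewrite free_consC|rewrite /= sz].
  have := T_lineP hT fxye ed_sz dyx _ _ hg gL; rewrite -!(span_consC e).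
  case/(_ hx1 hy1)/andP => /subvP/(_ e); rewrite memv_span ?mem_head // => /(_ isT) eL _.
  move/negP: e_out; apply; apply: (subvP (span_sub _)) eL.
  by apply: sub_cons => //; exact: sub_cons.
have eye : <<e :: (y + e)%R :: ds>>%VS = <<e :: y :: ds>>%VS.
  by rewrite [LHS]span_consC span_addl span_consC.
have fq : free (x :: e :: y + e :: ds).
  apply: (@span_free _ _ _ (x :: y :: e :: ds)) => //.
  by rewrite [LHS]span_cons eye [in RHS]span_cons [in RHS]span_consC.
have := hy2 x xV xn; have := hx2 y yV yn => hyx _.
have xeE : <<(x - e)%R :: (y + e)%R :: ds>>%VS = <<(y + e)%R :: (x + y)%R :: ds>>%VS.
  have -> : x - e = (x + y) - (y + e) by rewrite opprD addrA addrK.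
  by rewrite span_subl [LHS]span_consC.
have xe_q : x - e \notin <<(y + e)%R :: ds>>%VS.
  have : free (x - e :: y + e :: ds).
    apply: (span_free xeE) => //; rewrite free_cons fxy andbT.
    apply: contra e_out => /(subvP (span_sub (sub_cons (memvD xV yV) sd))) hh.
    by rewrite -(addKr y e) memvD ?memvN.
  by rewrite free_cons => /andP[].
have xeL : x - e \in <<x :: e :: (y + e)%R :: ds>>%VS.
  by rewrite memvB // memv_span // !inE eqxx ?orbT.
have h1 : R <<x :: (y + e)%R :: ds>>%VS (g + u (x :: ds)) by rewrite span_consC.
have h2 : R <<e :: (y + e)%R :: ds>>%VS (u (y :: ds)) by rewrite eye.
have h3 : R <<(x - e)%R :: (y + e)%R :: ds>>%VS (g + u (x + y :: ds)) by rewrite xeE.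
have [al' [be' E]] := mem_span2P _ _ _ (T_line hT fq sz xeL xe_q h1 h2 h3).
have [e1 e2 _] : [/\ 1 - al' = 0, al - al' = 0 & be - be' = 0].
  apply: (lc_free3 fr3); move/eqP: E; rewrite -subr_eq0 sE => /eqP <-.
  by apply/rowP => i; rewrite !mxE; ring.
by exists be; rewrite sE (subr0_eq e2) -(subr0_eq e1) scale1r.
Qed.

Lemma upart_add x y ds : free (x :: y :: ds) -> {subset x :: y :: ds <= Vm} ->
  (size ds).+1 = h -> u (x + y :: ds) = u (x :: ds) + u (y :: ds).
Proof.
move=> fr sub sz; have [b hb] := upart_add1 fr sub sz.
have fr' : free (y :: x :: ds) by rewrite free_consC.
have sub' : {subset y :: x :: ds <= Vm}.
  by move=> t; rewrite !inE orbCA => ht; apply: sub; rewrite !inE.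
have [c hc1] := upart_add1 fr' sub' sz.
have [fx fy] := free_consr fr.
have sx : {subset x :: ds <= Vm} by move=> t; rewrite inE => ht; apply: sub; rewrite !inE orbCA ht orbT.
have sy : {subset y :: ds <= Vm} by move=> t ht; apply: sub; rewrite inE ht orbT.
have [hx _] := hu fx sx sz; have [hy _] := hu fy sy sz.
have sd : {subset ds <= Vm} by move=> t ht; apply: sub; rewrite !inE ht !orbT.
have fxye : free (x :: y :: e :: ds).
  rewrite free_consC -cat1s -[x :: _]cat1s catA.
  by rewrite (perm_free (permEl (perm_catCA [:: y; x] [:: e] ds))) /= free_e.
have frr : free [:: u (x :: ds); u (y :: ds)].
  by apply: (T_free hT fxye sz); rewrite span_consC.
have [_ b1] : 1 - c = 0 /\ b - 1 = 0.
  apply: (lc_free2 frr); have : u (x + y :: ds) - u (y + x :: ds) = 0 by rewrite (addrC y) subrr.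
  by rewrite hb hc1 => <-; apply/rowP => i; rewrite !mxE; ring.
by rewrite hb (subr0_eq b1) scale1r.
Qed.

End UpPart.

Lemma units_succ (v : V) : v \in <<units F N m.+1>>%VS -> v - v 0 m *: e \in Vm.
Proof.
move=> /units_span hv; apply/units_span => j; rewrite leq_eqVlt => /predU1P[mj|mj].
  by rewrite (_ : j = m) ?mxE ?eqxx ?mulr1 ?subrr //; apply: val_inj.
have jm : (j == m) = false by apply/negbTE; rewrite neq_ltn mj orbT.
by rewrite !mxE (hv j mj) jm andbF mulr0 subr0.
Qed.

Lemma one_more_coordinate : exists L : 'M[F]_((plucker_dim h N).+1, d.+1),
  forall xs, free xs -> {subset xs <= <<units F N m.+1>>%VS} -> size xs = h.+1 ->
  R <<xs>>%VS (plform s L xs).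
Proof.
have ex a : exists ua, free a -> {subset a <= Vm} -> size a = h -> R <<e :: a>>%VS ua /\
    forall v, v \in Vm -> v \notin <<a>>%VS -> R <<(v + e)%R :: a>>%VS (G (v :: a) + ua).
  have [[fa sa za]|hn] := pselect [/\ free a, {subset a <= Vm} & size a = h]; last first.
    by exists 0 => fa sa za; case: hn.
  by have [u hu] := upart fa sa za; exists u.
have [u hu] := choice ex.
have [L1 hL1] := plv_cons_ext hN (upart_span hu) (upart_add hu).
(* Index sets through [m] take their row from [L1], the others from [L0]: the former coordinates
   vanish on [Vm], the latter on sequences headed by [e]. *)
pose L := \matrix_i (if m \in nth_subset N h.+1 (i : 'I_(plucker_dim h N).+1)
  then row i L1 else row i L0).
have mergeL (p : 'rV[F]_(plucker_dim h N).+1) (L' : 'M[F]_((plucker_dim h N).+1, d.+1)) :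
    (forall i, p 0 i != 0 -> row i L = row i L') -> map_mx s p *m L = map_mx s p *m L'.
  move=> hp; rewrite !mulmx_sum_row; apply: eq_bigr => i _; rewrite mxE.
  by case: (eqVneq (p 0 i) 0) => [->|/hp-> //]; rewrite rmorph0 !scale0r.
have claimL xs : {subset xs <= Vm} -> plform s L xs = G xs.
  move=> sub; apply: mergeL => i; rewrite rowK; case: ifP => // mS /eqP []; apply: plv_zero_col mS _ => //.
  by move=> x /sub/units_span; apply.
have claimU a : free a -> {subset a <= Vm} -> size a = h -> plform s L (e :: a) = u a.
  move=> fa sa za; rewrite hL1 //; apply: mergeL => i; rewrite rowK; case: ifPn => // mS /eqP[].
  exact: plv_zero_row.
exists L => xs fr sub sz.
have [sV|sV] := pselect {subset xs <= Vm}; first by rewrite claimL //; exact: claim_m.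
have [x xX xV] : exists2 x, x \in <<xs>>%VS & x \notin Vm.
  apply: contrapT => hn; apply: sV => t txs; apply: contrapT => tV; apply: hn.
  by exists t; [apply: memv_span|apply/negP].
have XV : {subset <<xs>>%VS <= <<units F N m.+1>>%VS} by apply/subvP/span_subvP.
have xm0 : x 0 m != 0.
  by apply: contraNneq xV => xm; have := units_succ (XV _ xX); rewrite xm scale0r subr0.
(* A subspace not inside [Vm] is brought to the form [<<v + e :: a>>], with [a] a basis of its
   intersection with [Vm]. *)
pose x1 := (x 0 m)^-1 *: x; pose v := x1 - e.
have x1X : x1 \in <<xs>>%VS by rewrite memvZ.
have vV : v \in Vm.
  by have := units_succ (XV _ x1X); rewrite mxE mulVf // scale1r.
have x1E : x1 = v + e by rewrite subrK.
pose A := (<<xs>> :&: Vm)%VS; pose a : seq V := vbasis A.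
have aA : <<a>>%VS = A := span_basis (vbasisP A).
have fa : free a := basis_free (vbasisP A).
have sa : {subset a <= Vm} by move=> t /vbasis_mem; rewrite memv_cap => /andP[].
have x1A : x1 \notin <<a>>%VS.
  rewrite aA memv_cap negb_and; apply/orP; right; apply: contra e_out => hh.
  by rewrite -(addKr v e) memvD ?memvN // -x1E.
have fxa : free (x1 :: a) by rewrite free_cons x1A.
have eX : <<xs>>%VS = <<x1 :: a>>%VS.
  apply/eqP; rewrite eqEsubv; apply/andP; split; last first.
    rewrite span_cons aA subv_add -memvE x1X /=; exact: capvSl.
  apply/subvP => y yX; rewrite -(subrK (y 0 m *: x1) y) span_cons aA addrC.
  apply: memv_add; first by rewrite memvZ ?memv_line.
  rewrite memv_cap memvB ?memvZ //=.
  have -> : y - y 0 m *: x1 = (y - y 0 m *: e) - y 0 m *: v.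
    by rewrite x1E scalerDr opprD addrA addrAC.
  by rewrite memvB ?memvZ //; exact: units_succ (XV _ yX).
have za : size a = h.
  by move: fr fxa => /eqP + /eqP; rewrite -eX => ->; rewrite sz => -[].
have zxa : size (x1 :: a) = h.+1 by rewrite /= za.
apply: (@hc_plform _ _ _ _ _ s L (x1 :: a) xs) => //.
have [hu1 hu2] := hu a fa sa za.
rewrite x1E.
have [va|va] := boolP (v \in <<a>>%VS).
  have -> : <<(v + e)%R :: a>>%VS = <<e :: a>>%VS.
    apply: span_exchange; last by rewrite -x1E.
    by rewrite span_cons addrC memv_add // memv_line.
  rewrite /plform plv_add plv_cons_dep // add0r; move: hu1; rewrite -claimU //.
rewrite /plform plv_add map_mxD mulmxDl.
have := hu2 v vV va; rewrite -claimU // -claimL //; exact: sub_cons.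
Qed.

End OneMoreCoordinate.

(** * Orthogonal complements, hyperplanes and the generalised cross product *)

Section Orthogonal.
Variables (F : fieldType) (q : nat).
Local Notation W := 'rV[F]_q.
Implicit Types (U : {vspace W}) (x y v : W).

Definition dotp x y : F := (x *m y^T) 0 0.

Lemma dotpC x y : dotp x y = dotp y x.
Proof. by rewrite /dotp !mxE; apply: eq_bigr => i _; rewrite !mxE mulrC. Qed.

Lemma dotp_linr x a y z : dotp x (a *: y + z) = a * dotp x y + dotp x z.
Proof. by rewrite /dotp linearP /= mulmxDr -scalemxAr !mxE. Qed.

Definition basis_rows U : 'M[F]_(\dim U, q) := \matrix_(i, j) (vbasis U)`_i 0 j.

Definition ort U : {vspace W} := lker (linfun (mulmxr (basis_rows U)^T : W -> 'rV_(\dim U))).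

Lemma ortP U x : reflect (forall u, u \in U -> dotp x u = 0) (x \in ort U).
Proof.
rewrite memv_ker lfunE /=; apply: (iffP eqP) => h.
  move=> u; rewrite -(span_basis (vbasisP U)).
  apply: (span_ind (R := fun u => dotp x u = 0)).
  - by rewrite /dotp trmx0 mulmx0 mxE.
  - by move=> y z hy hz; rewrite -[y]scale1r dotp_linr hy hz mulr0 addr0.
  move=> c e eU; rewrite -[c *: e]addr0 dotp_linr.
  have -> : dotp x 0 = 0 by rewrite /dotp trmx0 mulmx0 mxE.
  have lt : (index e (vbasis U) < \dim U)%N by rewrite -[X in (_ < X)%N](size_tuple (vbasis U)) index_mem.
  have := congr1 (fun M : 'rV_ _ => M 0 (Ordinal lt)) h; rewrite !mxE.
  rewrite (_ : \sum_ _ _ = dotp x e) => [->|]; first by rewrite mulr0 addr0.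
  by rewrite /dotp !mxE; apply: eq_bigr => i _; rewrite !mxE /= nth_index.
apply/rowP => i; rewrite !mxE.
rewrite -[RHS](h (vbasis U)`_i); last by rewrite vbasis_mem // mem_nth // size_tuple.
by rewrite /dotp !mxE; apply: eq_bigr => j _; rewrite !mxE.
Qed.

Lemma basis_rows_free U : row_free (basis_rows U).
Proof.
apply/inj_row_free => v v0; have /freeP fr : free (vbasis U) := basis_free (vbasisP U).
apply/rowP => i; rewrite mxE; apply: (fr (fun i => v 0 i)).
rewrite -[RHS]v0; apply/rowP => j; rewrite summxE !mxE; apply: eq_bigr => k _.
by rewrite !mxE.
Qed.

Lemma dim_ort U : (\dim (ort U) + \dim U)%N = q.
Proof.
have := limg_ker_dim (linfun (mulmxr (basis_rows U)^T : W -> 'rV_(\dim U))) fullv.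
have dW : \dim {:W} = q by rewrite dimvf /dim /= mul1n.
rewrite capfv -/(ort U) dW => eq_q; rewrite -[RHS]eq_q; congr addn.
have -> : (linfun (mulmxr (basis_rows U)^T : W -> 'rV_(\dim U)) @: fullv)%VS = fullv.
  apply/eqP; rewrite eqEsubv subvf; apply/subvP => y _.
  have /row_freeP[B hB] := basis_rows_free U.
  apply/memv_imgP; exists (y *m B^T); first exact: memvf.
  by rewrite lfunE /= -mulmxA -trmx_mul hB trmx1 mulmx1.
by rewrite dimvf /dim /= mul1n.
Qed.

Lemma ortK U : ort (ort U) = U.
Proof.
apply/eqP; rewrite eq_sym eqEdim; apply/andP; split.
  by apply/subvP => u uU; apply/ortP => x /ortP/(_ u uU); rewrite dotpC.
have := dim_ort U; have := dim_ort (ort U); lia.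
Qed.

Lemma ort_sub U1 U2 : (U1 <= U2)%VS -> (ort U2 <= ort U1)%VS.
Proof. by move=> s; apply/subvP => x /ortP hx; apply/ortP => u uU; apply: hx; apply: (subvP s). Qed.

End Orthogonal.

Section HyperplanesOfASubspace.
Variables (F : fieldType) (h N : nat).
Hypothesis hN : (h < N)%N.
Local Notation q := h.+2.
Local Notation V := 'rV[F]_N.+1.
Implicit Types (U : {vspace 'rV[F]_q}) (v w y : 'rV[F]_q) (x : V).

Definition emb_mx : 'M[F]_(q, N.+1) := pid_mx q.
Definition emb : 'Hom('rV[F]_q, V) := linfun (mulmxr emb_mx).

Lemma emb_mxK : emb_mx *m emb_mx^T = 1%:M.
Proof. by rewrite /emb_mx tr_pid_mx mul_pid_mx minnn (minn_idPr _) ?pid_mx_1. Qed.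

Lemma embK y : emb y *m emb_mx^T = y.
Proof. by rewrite lfunE /= -mulmxA emb_mxK mulmx1. Qed.

Lemma emb_inj : injective emb.
Proof. by move=> y z e; rewrite -(embK y) e embK. Qed.

Lemma ker_emb : lker emb = 0%VS.
Proof. by apply/eqP/lker0P; exact: emb_inj. Qed.

Lemma dim_emb U : \dim (emb @: U) = \dim U.
Proof. by apply: limg_dim_eq; rewrite ker_emb capv0. Qed.

Lemma emb_sub U1 U2 : (emb @: U1 <= emb @: U2)%VS = (U1 <= U2)%VS.
Proof. by apply: limg_ker0; rewrite ker_emb. Qed.

Lemma units_emb x : x \in <<units F N q>>%VS -> emb (x *m emb_mx^T) = x.
Proof.
move=> /units_span hx; rewrite lfunE /= -mulmxA; apply/rowP => j.
rewrite /emb_mx tr_pid_mx mul_pid_mx !minnn mxE.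
have [hj|hj] := leqP q j.
  rewrite hx // big1 // => i _; rewrite mxE.
  by case: eqP => [->|]; rewrite ?(ltnNge j) ?hj mulr0.
rewrite (bigD1 j) //= big1 ?addr0 => [|i /negPf ij]; rewrite mxE.
  by rewrite eqxx hj mulr1.
by rewrite (_ : (i == j :> nat) = false) ?mulr0.
Qed.

(* The hyperplanes of an [h+2]-dimensional space form its dual projective space. *)
Definition perp v : {vspace V} := (emb @: ort <[v]>)%VS.

Lemma dim_perp v : v != 0 -> \dim (perp v) = h.+1.
Proof. by move=> v0; rewrite dim_emb; have := dim_ort <[v]>%VS; rewrite dim_vline v0; lia. Qed.

Lemma dim1_line (vT : vectType F) (A : {vspace vT}) : \dim A = 1%N -> exists2 u, u != 0 & A = <[u]>%VS.
Proof.
move=> dA; have p0 : vpick A != 0 by rewrite vpick0 -dimv_eq0 dA.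
exists (vpick A) => //; apply/eqP; rewrite eq_sym eqEdim -memvE memv_pick dim_vline p0 dA //.
Qed.

(** [ort] reverses inclusions, so the hyperplanes containing [ort L] are the complements of the
    points of [L]: a pencil of hyperplanes becomes a line of the dual space. *)
Lemma pemb_perp (P : geometry) (f : {vspace V} -> pt P) : gembed h.+1 f ->
  pemb (fun v => f (perp v)).
Proof.
move=> [finj fline]; split.
- move=> v w v0 w0 /finj; rewrite !dim_perp // => /(_ erefl erefl) /eqP.
  rewrite eqEsubv !emb_sub => /andP[s _]; rewrite memvE.
  by have := ort_sub s; rewrite !ortK.
- move=> c v c0; congr (f (emb @: ort _)%VS).
  have [->|v0] := eqVneq v 0; first by rewrite scaler0.
  by apply: vline_eq => //; apply/vlineP; exists c^-1; rewrite scalerA mulVf // scale1r.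
move=> L dL.
have [|||l hl lP] := fline (emb @: ort L)%VS (emb @: fullv)%VS.
- by rewrite emb_sub subvf.
- by rewrite dim_emb; have := dim_ort L; rewrite dL; lia.
- by rewrite dim_emb dimvf /dim /= mul1n.
exists l => // z; split.
  move=> /lP[X [/andP[sX Xs] dX ->]].
  have eX : X = (emb @: (emb @^-1: X))%VS.
    by rewrite lpreimK // (subv_trans Xs) // limgS ?subvf.
  have dY : \dim (emb @^-1: X)%VS = h.+1 by have := dX; rewrite {1}eX dim_emb.
  have [u u0 uE] : exists2 u, u != 0 & ort (emb @^-1: X)%VS = <[u]>%VS.
    by apply: dim1_line; have := dim_ort (emb @^-1: X)%VS; rewrite dY; lia.
  exists u; split=> //; last by rewrite /perp -uE ortK -eX.
  by rewrite memvE -uE -[L in (_ <= L)%VS]ortK ort_sub // -emb_sub -eX.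
move=> [u [uL u0 ->]]; apply/lP; exists (perp u); rewrite dim_perp //; split=> //.
by rewrite !emb_sub subvf ort_sub // -memvE.
Qed.

End HyperplanesOfASubspace.

Section CrossProduct.
Variables (F : fieldType) (h : nat).
Local Notation W := 'rV[F]_h.+2.
Implicit Types (y : W) (ys : seq W).

(** The generalised cross product: in dimension [h.+2] the vector [plv h.+1] has a single entry, the
    determinant, and the entries of [cross] are the cofactors of its first row. *)
Definition cross ys : W := \row_j plv h.+1 ((delta_mx 0 j : W) :: ys) 0 0.

Lemma crossE ys j : cross ys 0 j = plv h.+1 ((delta_mx 0 j : W) :: ys) 0 0.
Proof. by rewrite mxE. Qed.

Lemma cross_dot ys y : dotp y (cross ys) = plv h.+1 (y :: ys) 0 0.
Proof.
have p0 : plv h.+1 ((0 : W) :: ys) 0 0 = 0 by rewrite -(scale0r 0) plvZ scale0r mxE.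
have pD (x z : W) : plv h.+1 (x + z :: ys) 0 0 = plv h.+1 (x :: ys) 0 0 + plv h.+1 (z :: ys) 0 0.
  by rewrite plv_add mxE.
rewrite [y in RHS]row_sum_delta (big_morph (fun x : W => plv h.+1 (x :: ys) 0 0) pD p0).
by rewrite /dotp mxE; apply: eq_bigr => j _; rewrite plvZ !mxE.
Qed.

Lemma cross_neq0 ys : free ys -> size ys = h.+1 -> cross ys != 0.
Proof.
move=> fy sy; have [z _ zn] : exists2 z : W, z \in {:W}%VS & z \notin <<ys>>%VS.
  by apply: vspace_out; rewrite (eqP fy) sy dimvf /dim /= mul1n.
have fz : free (z :: ys) by rewrite free_cons zn.
have /rV0Pn[i] := plv_neq0 fz (congr1 S sy).
have -> : i = 0.
  by apply: val_inj; have := ltn_ord i; rewrite [X in (_ < X)%N]pdimS // binn ltnS leqn0 => /eqP.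
apply: contraNneq => c0; rewrite -cross_dot c0 /dotp trmx0 mulmx0 mxE //.
Qed.

Lemma cross_perp ys y : size ys = h.+1 -> y \in <<ys>>%VS -> y \in ort <[cross ys]>%VS.
Proof.
move=> sy yL; apply/ortP => _ /vlineP[c ->].
rewrite -[c *: _]addr0 dotp_linr cross_dot plv_cons_dep // mxE mulr0 add0r.
by rewrite /dotp trmx0 mulmx0 mxE.
Qed.

End CrossProduct.

(** * The coordinate formula for embeddings of one Grassmann space *)

Section GrassmannTheorem.
Variables (F : fieldType) (h N d : nat).
Hypothesis hN : (0 < h < N)%N.
Local Notation V := 'rV[F]_N.+1.
Variable (T : {vspace V} -> pt (PG F d)).
Hypothesis hT : gembed h.+1 T.

Let h0 : (0 < h)%N. Proof. by case/andP: hN. Qed.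
Let hltN : (h < N)%N. Proof. by case/andP: hN. Qed.

Let down (xs : seq V) : seq 'rV[F]_h.+2 := [seq x *m (emb_mx F h N)^T | x <- xs].

Lemma up_down xs : {subset xs <= <<units F N h.+2>>%VS} -> map (emb F h N) (down xs) = xs.
Proof.
move=> sub; rewrite -map_comp -[RHS]map_id; apply/eq_in_map => x /sub xV /=.
exact: units_emb.
Qed.

Lemma free_down xs : {subset xs <= <<units F N h.+2>>%VS} -> free xs -> free (down xs).
Proof.
move=> sub; rewrite -{1}(up_down sub) /free -limg_span size_map.
by rewrite dim_emb.
Qed.

Lemma perp_cross xs : free xs -> {subset xs <= <<units F N h.+2>>%VS} -> size xs = h.+1 ->
  cross (down xs) != 0 /\ <<xs>>%VS = perp N (cross (down xs)).
Proof.
move=> fx sub sx; have fd := free_down sub fx; have sd : size (down xs) = h.+1 by rewrite size_map.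
have c0 := cross_neq0 fd sd; split=> //.
apply/eqP; rewrite eqEdim dim_perp // (eqP fx) sx leqnn andbT.
rewrite -{1}(up_down sub) -limg_span /perp emb_sub //.
by apply/subvP => y; apply: cross_perp.
Qed.

Lemma lmx_down k xs : lmx k (down xs) = lmx k xs *m (emb_mx F h N)^T.
Proof.
apply/matrixP => i j; rewrite !mxE.
have [hi|hi] := ltnP i (size xs).
  by rewrite (nth_map 0) // mxE; apply: eq_bigr => l _; rewrite !mxE.
rewrite !nth_default ?size_map // mxE big1 // => l _; rewrite !mxE nth_default // mxE mul0r //.
Qed.

(** The fundamental theorem gives a formula in the normal vector of a hyperplane. The cross product
    of a basis is such a vector and is alternating in the basis, so [plv_ext] rewrites the formula
    in terms of Plücker vectors. *)
Lemma base_coordinates : exists (s : {rmorphism F -> F}) (L : 'M[F]_((plucker_dim h N).+1, d.+1)),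
  bijective s /\ forall xs, free xs -> {subset xs <= <<units F N h.+2>>%VS} -> size xs = h.+1 ->
  hc (T <<xs>>%VS) (plform s L xs).
Proof.
have hp := pemb_perp hltN hT.
have [|s [L' [s_bij hL']]] := fundamental_theorem hp; first by rewrite !ltnS.
pose u xs := map_mx s (cross (down xs)) *m L'.
have [||L hL] := @plv_ext F h N (ltnW hltN) _ h.+2 s u.
- move=> xs ys c fx fy sx sy zx zy e c0 hc1.
  have ysub : {subset ys <= <<xs>>%VS} by move=> y yys; rewrite e memv_span.
  have [P eP] := lmx_span zx zy ysub.
  have cP : c = \det P.
    apply/eqP; have := hc1; rewrite (plv_mul eP) => /eqP; rewrite -subr_eq0 -scalerBl scaler_eq0.
    by rewrite (negPf (plv_neq0 fx zx)) orbF subr_eq0 eq_sym.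
  have eP' : lmx h.+1 (down ys) = P *m lmx h.+1 (down xs) by rewrite !lmx_down eP mulmxA.
  rewrite /u scalemxAl -map_mxZ; congr (map_mx s _ *m _).
  by apply/rowP => j; rewrite [RHS]mxE !crossE (plv_cons_mul eP') [LHS]mxE cP.
- move=> x y ds fr sub sz; rewrite /u -mulmxDl -map_mxD; congr (map_mx s _ *m _).
  by apply/rowP => j; rewrite [RHS]mxE !crossE /= mulmxDl plv_add2 // [LHS]mxE.
exists s, L; split=> // xs fx sub sx.
have [c0 e] := perp_cross fx sub sx.
by rewrite /plform -hL // e /u; apply: hL'.
Qed.

Theorem grassmann_embedding : exists (s : {rmorphism F -> F}) (L : 'M[F]_((plucker_dim h N).+1, d.+1)),
  bijective s /\ forall xs, free xs -> size xs = h.+1 -> hc (T <<xs>>%VS) (plform s L xs).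
Proof.
have [s [L0 [s_bij hL0]]] := base_coordinates.
have claim k : (h.+2 + k <= N.+1)%N -> exists L : 'M[F]_((plucker_dim h N).+1, d.+1),
    forall xs, free xs -> {subset xs <= <<units F N (h.+2 + k)>>%VS} -> size xs = h.+1 ->
    hc (T <<xs>>%VS) (plform s L xs).
  elim: k => [|k IH] hk; first by exists L0; rewrite addn0.
  rewrite addnS in hk *; have [L hL] := IH (ltnW hk).
  apply: (@one_more_coordinate F h N d T hT (ltnW hltN) (Ordinal hk) s L) => //.
  by rewrite leq_addr.
have [|L hL] := claim (N.+1 - h.+2)%N; first by rewrite subnKC.
exists s, L; split=> // xs fx sx; apply: hL => // x xx.
by apply/units_span => j; rewrite subnKC // leqNgt ltn_ord.
Qed.

End GrassmannTheorem.

(** * Connectedness of Grassmann spaces *)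

Section Connectivity.
Variables (F : fieldType) (vT : vectType F).
Implicit Types (A B C D X : {vspace vT}).

Lemma subspace_between C X n : (C <= X)%VS -> (\dim C <= n)%N -> (n <= \dim X)%N ->
  exists D, [/\ (C <= D)%VS, (D <= X)%VS & \dim D = n].
Proof.
move=> CX /subnK => <-; elim: (n - _)%N => [|k IH] hk; first by exists C.
have [D [CD DX dD]] := IH (ltnW hk).
have [v vX vD] : exists2 v, v \in X & v \notin D by apply: vspace_out; rewrite dD.
exists (D + <[v]>)%VS; rewrite (subv_trans CD) ?addvSl // subv_add DX -memvE vX.
by rewrite dim_add_line // dD.
Qed.

(** Induction on the codimension of [X0 :&: X] in [X]: a hyperplane [D] of [X0] through this
    intersection is joined to a vector of [X] outside [X0]. The result is adjacent to [X0] and meets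
    [X] in a larger subspace. *)
Lemma grassmann_connected h (Q : {vspace vT} -> Prop) X0 X :
  (forall x y ds, free (x :: y :: ds) -> size ds = h -> Q <<x :: ds>>%VS -> Q <<y :: ds>>%VS) ->
  \dim X0 = h.+1 -> \dim X = h.+1 -> Q X0 -> Q X.
Proof.
move=> hQ + dX; have [k] := ubnP (h.+1 - \dim (X0 :&: X))%N.
elim: k X0 => // k IH X0 hk dX0 Q0.
have [le|lt] := leqP h.+1 (\dim (X0 :&: X)).
  have /eqP e1 : (X0 :&: X == X0)%VS by rewrite eqEdim capvSl dX0.
  have /eqP e2 : (X0 :&: X == X)%VS by rewrite eqEdim capvSr dX.
  by rewrite -e2 e1.
have [b bX bn] : exists2 b, b \in X & b \notin (X0 :&: X)%VS by apply: vspace_out; rewrite dX.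
have bX0 : b \notin X0 by move: bn; rewrite memv_cap bX andbT.
have [D [CD DX0 dD]] : exists D, [/\ (X0 :&: X <= D)%VS, (D <= X0)%VS & \dim D = h].
  by apply: subspace_between; rewrite ?capvSl // dX0.
have [a aX0 aD] : exists2 a, a \in X0 & a \notin D by apply: vspace_out; rewrite dX0 dD.
pose ds := vbasis D : seq vT.
have dsD : <<ds>>%VS = D := span_basis (vbasisP D).
have fd : free ds := basis_free (vbasisP D).
have sd : size ds = h by rewrite size_tuple.
have fa : free (a :: ds) by rewrite free_cons dsD aD.
have eX0 : <<a :: ds>>%VS = X0.
  apply/eqP; rewrite eqEdim dX0 (eqP fa) /= sd leqnn andbT span_cons dsD.
  by rewrite subv_add -memvE aX0.
have fba : free (b :: a :: ds) by rewrite free_cons eX0 bX0.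
have [fb _] := free_consr fba.
apply: (IH <<b :: ds>>%VS).
- have bC : b \notin (X0 :&: X)%VS by [].
  have : ((X0 :&: X) + <[b]> <= <<b :: ds>> :&: X)%VS.
    rewrite subv_add subv_cap capvSr andbT span_cons dsD (subv_trans CD (addvSr _ _)) /=.
    by rewrite subv_cap addvSl -memvE.
  move/dimvS; rewrite dim_add_line //; move: hk lt; set i := \dim _; set j := \dim _; lia.
- by rewrite (eqP fb) /= sd.
- by apply: (hQ a b) => //; rewrite ?eX0 // free_consC.
Qed.

End Connectivity.

(** * Embeddings of products of Grassmann spaces *)

Section ProductEmbeddings.
Variables (F : fieldType) (h' N' h N : nat).
Local Notation V' := 'rV[F]_N'.+1.
Local Notation V := 'rV[F]_N.+1.

(** The third clause, joint injectivity, does not follow from injectivity in each argument; it is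
    the source of skew lines. *)
Definition pembed (P : geometry) (B : {vspace V'} -> {vspace V} -> pt P) :=
  [/\ forall X', \dim X' = h'.+1 -> gembed h.+1 (B X'),
      forall X, \dim X = h.+1 -> gembed h'.+1 (B^~ X)
    & forall X' Y' X Y, \dim X' = h'.+1 -> \dim Y' = h'.+1 -> \dim X = h.+1 -> \dim Y = h.+1 ->
        B X' X = B Y' Y -> X' = Y' /\ X = Y].
End ProductEmbeddings.

Section SkewLines.
Variables (F : fieldType) (h' N' h N d : nat).
Hypothesis hN' : (0 < h' < N')%N.
Hypothesis hN : (0 < h < N)%N.
Local Notation V' := 'rV[F]_N'.+1.
Local Notation V := 'rV[F]_N.+1.
Variable (B : {vspace V'} -> {vspace V} -> pt (PG F d)).
Hypothesis hB : pembed h' h B.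

(** A nonzero vector common to both lines would represent a point [B P X = B Q Y], against joint
    injectivity. So the relation splits into one for each line, and on each line the two vectors are
    independent. *)
Lemma skew_lines P Q x y es ps pt qs qt a b c e : \dim P = h'.+1 -> \dim Q = h'.+1 -> P <> Q ->
  free (x :: y :: es) -> size es = h ->
  hc (B P <<x :: es>>%VS) ps -> hc (B P <<y :: es>>%VS) pt ->
  hc (B Q <<x :: es>>%VS) qs -> hc (B Q <<y :: es>>%VS) qt ->
  a *: ps + b *: pt + c *: qs + e *: qt = 0 -> [/\ a = 0, b = 0, c = 0 & e = 0].
Proof.
move=> dP dQ PQ fr sz hps hpt hqs hqt E; have [hB1 _ hB3] := hB.
have fp := T_free (hB1 _ dP) fr sz hps hpt.
have fq := T_free (hB1 _ dQ) fr sz hqs hqt.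
pose z := a *: ps + b *: pt.
have zE : z = (- c) *: qs + (- e) *: qt.
  by apply/eqP; rewrite -subr_eq0 -[X in _ == X]E; apply/eqP/rowP => i; rewrite !mxE; ring.
have z0 : z = 0.
  apply/eqP; apply: contraT => z0; case: PQ.
  have [|X dX hX] := T_onto (hB1 _ dP) fr sz hps hpt z0; first by apply/mem_span2P; exists a, b.
  have [|Y dY hY] := T_onto (hB1 _ dQ) fr sz hqs hqt z0.
    by apply/mem_span2P; exists (- c), (- e).
  by have [] := hB3 _ _ _ _ dP dQ dX dY (hc_inj hX hY (memv_line z)).
have [a0 b0] := lc_free2 fp z0.
have [c0 e0] : - c = 0 /\ - e = 0 by apply: (lc_free2 fq); rewrite -zE.
by move/eqP: c0; move/eqP: e0; rewrite !oppr_eq0 => /eqP-> /eqP->.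
Qed.

End SkewLines.

Lemma exists_free_seq (F : fieldType) N k : (k <= N.+1)%N ->
  exists xs : seq 'rV[F]_N.+1, free xs /\ size xs = k.
Proof.
move=> hk; exists [seq (delta_mx 0 s : 'rV[F]_N.+1) | s <- take k (enum 'I_N.+1)]; split.
  by apply: free_unitv; rewrite take_uniq ?enum_uniq.
by rewrite size_map size_takel // size_enum_ord.
Qed.

Section CompanionAutomorphism.
Variables (F : fieldType) (h' N' h N d : nat).
Hypothesis hN' : (0 < h' < N')%N.
Hypothesis hN : (0 < h < N)%N.
Local Notation V' := 'rV[F]_N'.+1.
Local Notation V := 'rV[F]_N.+1.
Variable (B : {vspace V'} -> {vspace V} -> pt (PG F d)).
Hypothesis hB : pembed h' h B.

Lemma plform_lin (s : {rmorphism F -> F}) q (L : 'M[F]_(_, q)) c (x y : V) es :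
  plform s L (x + c *: y :: es : seq V) =
  plform s L (x :: es) + s c *: plform (h := h) s L (y :: es).
Proof. by rewrite /plform plv_add plvZ map_mxD map_mxZ mulmxDl -scalemxAl. Qed.

Lemma free_addl (vT : vectType F) (x y : vT) c es : free (x :: y :: es) -> free (x + c *: y :: es).
Proof.
rewrite free_cons => /andP[+ fy]; move: (fy); rewrite !free_cons => /andP[_ ->].
rewrite andbT; apply: contra => hh.
rewrite -(addrK (c *: y) x); apply: memvB; last by rewrite memvZ // memv_span // mem_head.
by rewrite span_cons (subvP (addvSr _ _)).
Qed.

Definition has_companion (s : {rmorphism F -> F}) (X' : {vspace V'}) :=
  exists L : 'M[F]_((plucker_dim h N).+1, d.+1), forall xs, free xs -> size xs = h.+1 ->
    hc (B X' <<xs>>%VS) (plform s L xs).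

(* The pencil through [P] and [Q] contains a third point, which relates the
   parametrisations of the skew lines [B P l] and [B Q l]; comparing coefficients
   shows that the automorphisms at [P] and [Q] agree. *)
Lemma companion_adjacent (s : {rmorphism F -> F}) x y ds : free (x :: y :: ds) -> size ds = h' ->
  has_companion s <<x :: ds>>%VS -> has_companion s <<y :: ds>>%VS.
Proof.
move=> fr sd [LP hP]; have [hB1 hB2 hB3] := hB.
have [fx fy] := free_consr fr.
have fz : free (x + y :: ds) by have := free_addl 1 fr; rewrite scale1r.
have [dP dQ dZ] := And3 (dim_free_cons fx sd) (dim_free_cons fy sd) (dim_free_cons fz sd).
have [sQ [LQ [_ hQ]]] := grassmann_embedding hN (hB1 _ dQ).
have [sZ [LZ [_ hZ]]] := grassmann_embedding hN (hB1 _ dZ).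
have PQ : <<x :: ds>>%VS <> <<y :: ds>>%VS.
  by move=> e; move: fr; rewrite free_cons -e memv_span ?mem_head.
have ZQ : <<(x + y)%R :: ds>>%VS <> <<y :: ds>>%VS.
  move=> e; move: fr; rewrite free_cons -{1}[x](addrK y) memvB //.
    by rewrite -e memv_span ?mem_head.
  by rewrite memv_span ?mem_head.
have [|[|a0 [|a1 es]] [fre //= sze]] := @exists_free_seq F N h.+2.
  by case/andP: hN.
case: sze => sze.
have combo xs : free xs -> size xs = h.+1 ->
    plform sZ LZ xs \in <<[:: plform s LP xs; plform sQ LQ xs]>>%VS.
  move=> fxs sxs; have dX : \dim <<xs>>%VS = h.+1 by rewrite (eqP fxs).
  apply: (T_line (hB2 _ dX) fr sd (w := x + y)); [| |exact: hP|exact: hQ|exact: hZ].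
    by rewrite memvD // memv_span // !inE eqxx ?orbT.
  by move: fz; rewrite free_cons => /andP[].
have [f0 f1] := free_consr fre; have z0 := congr1 S sze.
have [al [be e0]] := mem_span2P _ _ _ (combo _ f0 z0).
have [ga [de e1]] := mem_span2P _ _ _ (combo _ f1 z0).
have rel c : [/\ sZ c * ga = al * s c & sZ c * de = be * sQ c].
  have fc := free_addl c fre.
  have [k [l]] := mem_span2P _ _ _ (combo _ fc z0); rewrite !plform_lin e0 e1 => E.
  have [i1 i2 i3 i4] : [/\ al - k = 0, sZ c * ga - k * s c = 0, be - l = 0 & sZ c * de - l * sQ c = 0].
    apply: (skew_lines hB dP dQ PQ fre sze (hP _ f0 z0) (hP _ f1 z0) (hQ _ f0 z0) (hQ _ f1 z0)).
    by move/eqP: E; rewrite -subr_eq0 => /eqP <-; apply/rowP => i; rewrite !mxE; ring.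
  by rewrite (subr0_eq i2) (subr0_eq i4) (subr0_eq i1) (subr0_eq i3).
have inj xs k : free xs -> size xs = h.+1 -> forall P P' (z : 'rV[F]_d.+1) (z' : 'rV[F]_d.+1),
    \dim P = h'.+1 -> \dim P' = h'.+1 -> P <> P' ->
    hc (B P <<xs>>%VS) z -> hc (B P' <<xs>>%VS) z' -> z <> k *: z'.
  move=> fxs sxs A A' z z' dA dA' AA' hz hz' zE; apply: AA'.
  have dX : \dim <<xs>>%VS = h.+1 by rewrite (eqP fxs).
  have [] // := hB3 _ _ _ _ dA dA' dX dX _.
  by apply: (hc_inj hz hz'); rewrite zE memvZ ?memv_line.
have al0 : al != 0.
  apply/eqP => a0'; apply: (inj _ be f0 z0 _ _ _ _ dZ dQ ZQ (hZ _ f0 z0) (hQ _ f0 z0)).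
  by rewrite e0 a0' scale0r add0r.
have ZP : <<(x + y)%R :: ds>>%VS <> <<x :: ds>>%VS.
  move=> e; move: fr; rewrite free_consC free_cons -{1}[y](addrK x) memvB //.
    by rewrite -e addrC memv_span ?mem_head.
  by rewrite memv_span ?mem_head.
have be0 : be != 0.
  apply/eqP => b0'; apply: (inj _ al f0 z0 _ _ _ _ dZ dP ZP (hZ _ f0 z0) (hP _ f0 z0)).
  by rewrite e0 b0' scale0r addr0.
(* The case [c = 1] identifies [ga] with [al] and [de] with [be]; both [s] and [sQ] then equal
   [sZ]. *)
have [g1 d1] := rel 1; rewrite !rmorph1 !mulr1 !mul1r in g1 d1.
have ss c : s c = sQ c.
  have [r1 r2] := rel c; rewrite g1 in r1; rewrite d1 in r2.
  by rewrite (mulfI al0 (esym (etrans (mulrC _ _) r1))) (mulfI be0 (esym (etrans (mulrC _ _) r2))).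
exists LQ => xs fxs sxs; rewrite /plform (_ : map_mx s _ = map_mx sQ (plv h xs)).
  exact: hQ.
by apply/matrixP => i j; rewrite !mxE ss.
Qed.

Lemma common_companion : exists s : {rmorphism F -> F}, bijective s /\
  forall X', \dim X' = h'.+1 -> has_companion s X'.
Proof.
have [|xs0 [f0 z0]] := @exists_free_seq F N' h'.+1; first by case/andP: hN' => _ /ltnW.
have d0 : \dim <<xs0>>%VS = h'.+1 by rewrite (eqP f0).
have [hB1 _ _] := hB; have [s [L [s_bij hL]]] := grassmann_embedding hN (hB1 _ d0).
exists s; split=> // X' dX'.
apply: (grassmann_connected (Q := has_companion s) _ d0 dX'); last by exists L.
exact: companion_adjacent.
Qed.

End CompanionAutomorphism.

Section ProductTheorem.
Variables (F : fieldType) (h' N' h N d : nat).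
Hypothesis hN' : (0 < h' < N')%N.
Hypothesis hN : (0 < h < N)%N.
Local Notation V' := 'rV[F]_N'.+1.
Local Notation V := 'rV[F]_N.+1.
Variable (B : {vspace V'} -> {vspace V} -> pt (PG F d)).
Hypothesis hB : pembed h' h B.
Local Notation p' := (plucker_dim h' N').
Local Notation p := (plucker_dim h N).

Definition tensor_vec (u : 'rV[F]_p'.+1) (v : 'rV[F]_p.+1) : 'rV[F]_(p'.+1 * p.+1) :=
  mxvec (u^T *m v).

Theorem product_embedding : exists (s t : {rmorphism F -> F}) (L : 'M[F]_(p'.+1 * p.+1, d.+1)),
  [/\ bijective s, bijective t & forall xs' xs, free xs' -> size xs' = h'.+1 ->
    free xs -> size xs = h.+1 -> hc (B <<xs'>>%VS <<xs>>%VS)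
      (tensor_vec (map_mx s (plv h' xs')) (map_mx t (plv h xs)) *m L)].
Proof.
have [hB1 hB2 hB3] := hB.
have [t [t_bij ht]] := common_companion hN' hN hB.
have [|xs0 [f0 z0]] := @exists_free_seq F N h.+1; first by case/andP: hN => _ /ltnW.
have d0 : \dim <<xs0>>%VS = h.+1 by rewrite (eqP f0).
have [s [L0 [s_bij hL0]]] := grassmann_embedding hN' (hB2 _ d0).
have dimS (vT : vectType F) (xs : seq vT) k : free xs -> size xs = k -> \dim <<xs>>%VS = k.
  by move=> /eqP-> ->.
have exL xs' : exists L : 'M[F]_(p.+1, d.+1), free xs' -> size xs' = h'.+1 ->
    (forall xs, free xs -> size xs = h.+1 -> hc (B <<xs'>>%VS <<xs>>%VS) (plform t L xs)) /\
    plform t L xs0 = plform s L0 xs'.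
  have [[fx zx]|hn] := pselect (free xs' /\ size xs' = h'.+1); last first.
    by exists 0 => ? ?; case: hn.
  have [L hL] := ht _ (dimS _ _ _ fx zx).
  have [c c0 hc1] := hc_scale (hL _ f0 z0) (hL0 _ fx zx).
  (* The factor left free in the matrix is fixed at [xs0], where the formula for the first factor
     prescribes the vector itself. *)
  exists (c *: L) => _ _; rewrite {2}/plform -scalemxAr -/(plform t L xs0) hc1; split=> // xs fxs zxs.
  have hxs := hL _ fxs zxs; rewrite /plform -scalemxAr.
  apply: (hcI _ _ hxs); last by rewrite memvZ ?memv_line.
  by rewrite scaler_eq0 negb_or c0 (hc_neq0 hxs).
have [Lf hLf] := choice exL.
pose U xs' xs := plform t (Lf xs') xs.
have hU xs' xs : free xs' -> size xs' = h'.+1 -> free xs -> size xs = h.+1 ->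
    hc (B <<xs'>>%VS <<xs>>%VS) (U xs' xs).
  by move=> fx zx; case: (hLf _ fx zx) => + _; apply.
have U0 xs' : free xs' -> size xs' = h'.+1 -> U xs' xs0 = plform s L0 xs'.
  by move=> fx zx; case: (hLf _ fx zx).
have UD xs' x y es : U xs' (x + y :: es) = U xs' (x :: es) + U xs' (y :: es).
  by rewrite /U /plform plv_add map_mxD mulmxDl.
have Uspan xs ys : free xs -> free ys -> size xs = h.+1 -> size ys = h.+1 ->
    <<xs>>%VS = <<ys>>%VS -> exists c, forall xs', U xs' ys = c *: U xs' xs.
  move=> fx fy zx zy e; have [c c0 hc1] := plv_span fx fy zx zy e.
  by exists (t c) => zs; rewrite /U /plform hc1 map_mxZ scalemxAl.
(* A linear relation between the vectors [U xs' xs], for [xs'] in a given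
   list, propagates from [xs0] to every [xs] along lines. *)
have spread (rel : seq V -> Prop) :
    (forall xs ys, free xs -> free ys -> size xs = h.+1 -> size ys = h.+1 ->
       <<xs>>%VS = <<ys>>%VS -> rel xs -> rel ys) ->
    rel xs0 ->
    (forall x y es, free (x :: y :: es) -> size es = h -> rel (x :: es) -> rel (y :: es)) ->
    forall xs, free xs -> size xs = h.+1 -> rel xs.
  move=> relS rel0 relA xs fx zx.
  pose Q X := forall ys, free ys -> size ys = h.+1 -> <<ys>>%VS = X -> rel ys.
  apply: (grassmann_connected (Q := Q) (h := h) (X0 := <<xs0>>%VS) (X := <<xs>>%VS)) => //.
  - move=> x y es fr ze Qx ys fy zy e; have [fxe fye] := free_consr fr.
    apply: (relS (y :: es)) => //; first by rewrite /= ze.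
    by apply: (relA x) => //; apply: Qx; rewrite //= ze.
  - exact: dimS.
  - by move=> ys fy zy e; apply: (relS xs0).
have all_units (zs : seq V') : {subset zs <= <<units F N' N'.+1>>%VS}.
  by move=> z _; apply/units_span => j; rewrite leqNgt ltn_ord.
have hN'le : (h' <= N')%N by case/andP: hN' => _ /ltnW.
have hNle : (h <= N)%N by case/andP: hN => _ /ltnW.
have sep (L1 L2 : 'M[F]_(p.+1, d.+1)) : (forall xs, free xs -> size xs = h.+1 ->
    plform t L1 xs = plform t L2 xs) -> L1 = L2.
  move=> e; apply/eqP; rewrite -subr_eq0; apply/eqP; apply: (plv_separates hNle (s := t)).
  by move=> xs fx zx; rewrite mulmxBr; apply/eqP; rewrite subr_eq0; apply/eqP/e.
have [||L' hL'] := @plv_ext F h' N' hN'le _ N'.+1 s (fun xs' => mxvec (Lf xs')).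
- move=> xs' ys' c fx fy _ _ zx zy e c0 hc1; rewrite -linearZ /=; congr mxvec.
  apply: sep => xs fxs zxs; rewrite /plform -scalemxAr -!/(plform _ _ _) -!/(U _ _).
  apply: (spread (fun xs => U ys' xs = s c *: U xs' xs)) => //.
  + move=> as_ bs fa fb za zb /(Uspan _ _ fa fb za zb)[k hk] r.
    by rewrite !hk r !scalerA mulrC.
  + by rewrite !U0 // /plform hc1 map_mxZ scalemxAl.
  (* The vectors of [xs'] and [ys'] are proportional at [x], at [y] and at [x + y]; since both are
     additive, the three factors agree, and the one at [x] is [s c]. *)
  move=> x y es fr ze r; have [fxe fye] := free_consr fr.
  have fxy : free (x + y :: es) by have := free_addl 1 fr; rewrite scale1r.
  have zs := congr1 S ze.
  have [k _ kE] := hc_scale (hU _ _ fx zx fye zs) (eq_ind _ (fun X => hc (B X _) _)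
    (hU _ _ fy zy fye zs) _ (esym e)).
  have [l _ lE] := hc_scale (hU _ _ fx zx fxy zs) (eq_ind _ (fun X => hc (B X _) _)
    (hU _ _ fy zy fxy zs) _ (esym e)).
  have frr := T_free (hB1 _ (dimS _ _ _ fx zx)) fr ze (hU _ _ fx zx fxe zs) (hU _ _ fx zx fye zs).
  have [e1 e2] : s c - l = 0 /\ k - l = 0.
    apply: (lc_free2 frr); move/eqP: lE; rewrite !UD r kE -subr_eq0 => /eqP <-.
    by apply/rowP => i; rewrite !mxE; ring.
  by rewrite kE (subr0_eq e2) (subr0_eq e1).
- move=> x y ds fr _ zd; rewrite -linearD /=; congr mxvec.
  apply: sep => xs fxs zxs; rewrite /plform mulmxDr -!/(plform _ _ _) -!/(U _ _).
  have [fx fy] := free_consr fr; have zs' := congr1 S zd.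
  have fz : free (x + y :: ds) by have := free_addl 1 fr; rewrite scale1r.
  have [dP dQ] := (dimS _ _ _ fx zs', dimS _ _ _ fy zs').
  have PQ : <<x :: ds>>%VS <> <<y :: ds>>%VS.
    by move=> e; move: fr; rewrite free_cons -e memv_span ?mem_head.
  have combo as_ : free as_ -> size as_ = h.+1 -> exists k l,
      U (x + y :: ds) as_ = k *: U (x :: ds) as_ + l *: U (y :: ds) as_.
    move=> fa za; apply/mem_span2P; apply: (T_line (hB2 _ (dimS _ _ _ fa za)) fr zd (w := x + y)).
    - by rewrite memvD // memv_span // !inE eqxx ?orbT.
    - by move: fz; rewrite free_cons => /andP[].
    - exact: hU.
    - exact: hU.
    - exact: hU.
  apply: (spread (fun xs => U (x + y :: ds) xs = U (x :: ds) xs + U (y :: ds) xs)) => //.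
  + move=> as_ bs fa fb za zb /(Uspan _ _ fa fb za zb)[k hk] r.
    by rewrite !hk r scalerDr.
  + by rewrite !U0 // /plform plv_add map_mxD mulmxDl.
  (* In the pencil of the first factor the coefficients are 1, 1 at [a], some [k], [l] at [b] and
     [k'], [l'] at [a + b]; independence of the four vectors on the two skew lines makes all of them
     1. *)
  move=> a b es fre ze r; have [fae fbe] := free_consr fre; have zs := congr1 S ze.
  have fab : free (a + b :: es) by have := free_addl 1 fre; rewrite scale1r.
  have [k [l kl]] := combo _ fbe zs; have [k' [l' kl']] := combo _ fab zs.
  have [e1 e2 e3 e4] : [/\ 1 - k' = 0, k - k' = 0, 1 - l' = 0 & l - l' = 0].
    apply: (skew_lines hB dP dQ PQ fre ze (hU _ _ fx zs' fae zs) (hU _ _ fx zs' fbe zs)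
      (hU _ _ fy zs' fae zs) (hU _ _ fy zs' fbe zs)).
    move/eqP: kl'; rewrite !UD r kl -subr_eq0 => /eqP <-.
    by apply/rowP => i; rewrite !mxE; ring.
  by rewrite kl (subr0_eq e2) (subr0_eq e4) -(subr0_eq e1) -(subr0_eq e3) !scale1r.
(* [M j] is the bilinear form giving coordinate [j] in terms of the two Plücker vectors; as a vector
   it becomes column [j] of the matrix acting on tensors. *)
pose M (j : 'I_d.+1) : 'M[F]_(p'.+1, p.+1) :=
  \matrix_(i', i) vec_mx (row i' L') i j.
exists s, t, (\matrix_j mxvec (M j))^T; split=> // xs' xs fx' zx' fx zx.
rewrite (_ : _ *m _ = U xs' xs); first exact: hU.
have LE : Lf xs' = vec_mx (map_mx s (plv h' xs') *m L') by rewrite -hL' // mxvecK.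
rewrite /U /plform LE; move: (map_mx s _) (map_mx t _) => u v.
apply/rowP => j; rewrite /tensor_vec.
have -> : (mxvec (u^T *m v) *m (\matrix_j mxvec (M j))^T) 0 j =
    (mxvec (u^T *m v) *m (mxvec (M j))^T) 0 0.
  by rewrite !mxE; apply: eq_bigr => k _; rewrite !mxE.
rewrite mxvec_dotmul !mxE; apply: eq_bigr => i _; rewrite !mxE mulrC; congr (_ * _).
by apply: eq_bigr => i' _; rewrite !mxE.
Qed.

End ProductTheorem.

(** * Projective dimension and collineations in coordinates *)

Section Dimension.
Variables (P : geometry) (hP : projective_space P) (F : fieldType) (n : nat).
Variables (psi : 'rV[F]_n -> pt P) (hpsi : pemb psi).
Implicit Types (v u w : 'rV[F]_n).

Definition points_of (U : {vspace 'rV[F]_n}) : set (pt P) :=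
  [set z | exists u, [/\ u \in U, u != 0 & z = psi u]].

Lemma points_of_subspace U : subspace (points_of U).
Proof.
move=> _ _ l [v [vU v0 ->]] [w [wU w0 ->]] vw hl lv lw z lz.
have fr : free [:: v; w].
  by rewrite free2E w0; apply: contra_notN vw => h; apply/esym/(pemb_eq hpsi w0 v0).
have [u [uL u0 ->]] := pemb_colP hP hpsi fr (ex_intro _ l (And4 hl lv lw lz)).
exists u; split=> //; case/mem_span2P: uL => a [b ->].
by rewrite memvD // memvZ.
Qed.

Lemma proj_span_points (vs : seq 'rV[F]_n) (M : set (pt P)) :
  (forall v, v \in vs -> v != 0 -> M (psi v)) ->
  points_of <<vs>>%VS `<=` proj_span M.
Proof.
move=> hM _ [u [uL u0 ->]] W [subW MW].
have : u = 0 \/ W (psi u).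
  move: uL; apply: (span_ind (R := fun u => u = 0 \/ W (psi u))); first by left.
    move=> x y [->|Wx]; first by rewrite add0r.
    move=> [->|Wy]; first by rewrite addr0; right.
    have [->|xy0] := eqVneq (x + y) 0; [by left|right].
    have [x0|x0] := eqVneq x 0; first by rewrite x0 add0r.
    have [y0|y0] := eqVneq y 0; first by rewrite y0 addr0.
    have [fr|fr] := boolP (free [:: x; y]); last first.
      move: fr; rewrite free2E y0 negbK /= => /vlineP[k xE].
      have -> : x + y = (k + 1) *: y by rewrite scalerDl scale1r -xE.
      rewrite (pemb_scale hpsi) //; apply: contraNneq xy0 => k1.
      by rewrite xE -{2}[y]scale1r -scalerDl k1 scale0r.
    have [|l [hl lx ly lz]] := pemb_col hpsi fr xy0.
      by rewrite memvD // memv_span // !inE eqxx ?orbT.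
    apply: (subW (psi x) (psi y) l) => //.
    by apply: (pemb_neq hpsi); rewrite free2C.
  move=> c e evs; have [->|c0] := eqVneq c 0; first by left; rewrite scale0r.
  have [->|e0] := eqVneq e 0; first by left; rewrite scaler0.
  by right; rewrite (pemb_scale hpsi) //; apply/MW/hM.
by case=> // u00; rewrite u00 eqxx in u0.
Qed.

Lemma points_of_mem U v : v != 0 -> points_of U (psi v) -> v \in U.
Proof.
move=> v0 [w [wU w0 e]]; have /vlineP[c ->] := (pemb_eq hpsi w0 v0).1 (esym e).
by rewrite memvZ.
Qed.

Hypothesis psi_surj : forall z, inU psi z.

(** In coordinates, projective spans are linear spans, so a projective basis lifts to a basis of the
    vector space. Hence the arbitrary choice of a basis size in [pdim] is harmless. *)
Lemma basis_size k (b : 'I_k -> pt P) : proj_basis setT b -> k = n.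
Proof.
move=> [indep gen].
have ex (i : 'I_k) : exists vi, vi != 0 /\ b i = psi vi.
  by have [w w0 e] := psi_surj (b i); exists w.
have [v hv] := choice ex.
pose vs := [seq v i | i <- enum 'I_k].
have szv : size vs = k by rewrite size_map size_enum_ord.
have full : <<vs>>%VS = fullv.
  apply/eqP; rewrite eqEsubv subvf; apply/subvP => u _.
  have [->|u0] := eqVneq u 0; first exact: mem0v.
  apply: points_of_mem => //; have : proj_span (range b) (psi u) by rewrite gen.
  apply; split; first exact: points_of_subspace.
  move=> _ [i _ <-]; have [vi0 ->] := hv i; exists (v i); split=> //.
  by apply/memv_span/map_f; rewrite mem_enum.
have fr : free vs.
  apply: contraT; rewrite freeNE => /existsP[[i lt] /= iL].
  have ik : (i < k)%N by rewrite card_ord in lt.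
  have vsi l (lk : (l < k)%N) : vs`_l = v (Ordinal lk).
    have e : l = nat_of_ord (nth (Ordinal lk) (enum 'I_k) l) by rewrite nth_enum_ord.
    rewrite (nth_map (Ordinal lk)) ?size_enum_ord //; congr v; apply: val_inj.
    by rewrite /= -e.
  have [] := indep (Ordinal ik); have [vi0 ->] := hv (Ordinal ik).
  apply: (proj_span_points (vs := drop i.+1 vs)); last first.
    by exists (v (Ordinal ik)); split=> //; rewrite -vsi.
  move=> w /(nthP 0)[l]; rewrite size_drop szv => hl <- _; rewrite nth_drop.
  have lk : (i.+1 + l < k)%N by lia.
  rewrite (vsi _ lk); exists (Ordinal lk); last by have [_ ->] := hv (Ordinal lk).
  by move=> /(congr1 val) /=; lia.
by move/eqP: fr; rewrite full szv dimvf /dim /= mul1n.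
Qed.

Lemma basis_exists : exists b : 'I_n -> pt P, proj_basis setT b.
Proof.
have d0 (i : 'I_n) : (delta_mx 0 i : 'rV[F]_n) != 0.
  by apply/eqP => /matrixP/(_ 0 i)/eqP; rewrite !mxE !eqxx oner_eq0.
exists (fun i => psi (delta_mx 0 i)); split.
  move=> i hi; pose ws := [seq (delta_mx 0 j : 'rV[F]_n) | j <- enum 'I_n & j != i].
  have : points_of <<ws>>%VS (psi (delta_mx 0 i)).
    apply: hi; split; first exact: points_of_subspace.
    move=> _ [j /eqP ji <-]; exists (delta_mx 0 j); split=> //.
    by apply/memv_span/map_f; rewrite mem_filter ji mem_enum.
  move=> /(points_of_mem (d0 i)) h.
  suff /eqP : (delta_mx 0 i : 'rV[F]_n) 0 i = 0 by rewrite mxE !eqxx oner_eq0.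
  move: h; apply: (span_ind (R := fun u : 'rV[F]_n => u 0 i = 0)); first by rewrite mxE.
    by move=> x y hx hy; rewrite mxE hx hy addr0.
  move=> c _ /mapP[j + ->]; rewrite mem_filter => /andP[ji _]; rewrite !mxE eqxx /=.
  by rewrite eq_sym (negPf ji) mulr0.
apply/seteqP; split=> // z _; have [v v0 ->] := psi_surj z.
apply: (proj_span_points (vs := [seq (delta_mx 0 j : 'rV[F]_n) | j <- enum 'I_n])).
  by move=> _ /mapP[j _ ->] _; exists j.
exists v; split=> //; rewrite (row_sum_delta v); apply: memv_suml => j _.
by apply/memvZ/memv_span/map_f; rewrite mem_enum.
Qed.

Lemma pdim_setT : pdim [set: pt P] = (n%:Z - 1)%:E.
Proof.
rewrite /pdim; set sizes := [set k | _]; have hn : sizes n by exact: basis_exists.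
case: asboolP => [_|[]]; last by exists n.
congr ((_%:Z - 1)%:E); have [b] := xgetPex 0%N (ex_intro _ n hn : exists k, sizes k).
exact: basis_size.
Qed.

End Dimension.

Section CollineationOfPemb.
Variables (P : geometry) (hP : projective_space P) (F : fieldType) (d : nat).
Variables (psi : 'rV[F]_d.+1 -> pt P) (hpsi : pemb psi).

Definition collineation_of (Z : pt (PG F d)) : pt P := psi (rep Z).

Lemma collineation_hc Z z : hc Z z -> collineation_of Z = psi z.
Proof.
move=> hz; apply/(pemb_eq hpsi (rep_neq0 Z) (hc_neq0 hz)).
exact: hc_mem hz (hc_rep Z).
Qed.

Hypothesis psi_surj : forall z, inU psi z.

Lemma collineation_iso : isomorphism collineation_of.
Proof.
have ex z : exists Z, collineation_of Z = z.
  have [v v0 ->] := psi_surj z; exists (vpoint v0).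
  by rewrite (@collineation_hc _ v).
have [g hg] := choice ex.
have gK : cancel collineation_of g.
  move=> Z; have := hg (collineation_of Z).
  move=> /(pemb_eq hpsi (rep_neq0 _) (rep_neq0 _)).1 h.
  by apply/esym; apply: (hc_inj (hc_rep _) (hc_rep _)).
have img (L : subsp F d 2) l : (forall z, l z <-> exists u, [/\ u \in val L, u != 0 & z = psi u]) ->
    l = collineation_of @` [set X : subsp F d 1 | (val X <= val L)%VS].
  move=> lP; apply/seteqP; split=> z.
    move=> /lP[u [uL u0 ->]]; exists (vpoint u0); first by rewrite /= -memvE.
    exact: collineation_hc.
  move=> [X /= XL <-]; apply/lP; exists (rep X); split=> //; last exact: rep_neq0.
  by rewrite memvE -val_rep.
exists g; split=> //.
  move=> _ [L ->]; have [_ _ h] := hpsi; have [l hl lP] := h (val L) (eqP (valP L)).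
  by rewrite -(img L l).
move=> l hl; have [_ h2 _] := hP; have [x [y [_ [lx ly _ [xy _ _]]]]] := h2 l hl.
have [[v v0 xE] [w w0 yE]] := (psi_surj x, psi_surj y).
have fr : free [:: v; w].
  rewrite free2E w0; apply: contra_notN xy => h; rewrite xE yE; apply/esym.
  exact/(pemb_eq hpsi w0 v0).
have dL : \dim <<[:: v; w]>>%VS == 2%N by rewrite (eqP fr).
have [m hm mP] := pemb_line hpsi fr.
have lm : l = m.
  apply: (line_uniq hP (X := x) (Y := y)) => //; apply/mP.
  - by exists v; rewrite memv_span ?inE ?eqxx.
  - by exists w; rewrite memv_span ?inE ?eqxx ?orbT.
exists (mk_subsp dL); rewrite lm (img (mk_subsp dL) m) //.
apply/seteqP; split=> Z.
  by move=> [_ [X XL <-] <-]; rewrite gK.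
by move=> ZL; exists (collineation_of Z); rewrite ?gK //; exists Z.
Qed.

End CollineationOfPemb.

Section StandardPemb.
Variables (F : fieldType) (d : nat).

Lemma delta00_neq0 : (delta_mx 0 0 : 'rV[F]_d.+1) != 0.
Proof. by apply/eqP => /matrixP/(_ 0 0)/eqP; rewrite !mxE !eqxx oner_eq0. Qed.

(* The point spanned by [v]; the value at [v = 0] is junk. *)
Definition pgpt (v : 'rV[F]_d.+1) : pt (PG F d) :=
  odflt (vpoint delta00_neq0) (insub <[v]>%VS : option (subsp F d 1)).

Lemma hc_pgpt v : v != 0 -> hc (pgpt v) v.
Proof. by move=> v0; rewrite /hc /pgpt insubT ?dim_vline ?v0. Qed.

Lemma pgpt_hc Z z : hc Z z -> pgpt z = Z.
Proof. by move=> hz; apply: (hc_inj (hc_pgpt (hc_neq0 hz)) hz); rewrite memv_line. Qed.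

Lemma pemb_pgpt : pemb pgpt.
Proof.
split.
- move=> v w v0 w0 e; apply: hc_mem (hc_pgpt v0); rewrite e; exact: hc_pgpt.
- move=> c v c0; have [->|v0] := eqVneq v 0; first by rewrite scaler0.
  apply: pgpt_hc; apply: (hcI _ _ (hc_pgpt v0)); last by rewrite memvZ ?memv_line.
  by rewrite scaler_eq0 negb_or c0.
move=> L dL; exists [set X : subsp F d 1 | (val X <= L)%VS].
  by exists (mk_subsp (introT eqP dL)).
move=> Z; split=> /= [ZL|[u [uL u0 ->]]]; last by rewrite [val _](hc_pgpt u0) -memvE.
exists (rep Z); rewrite memvE -val_rep rep_neq0; split=> //.
by rewrite (pgpt_hc (hc_rep Z)).
Qed.

Lemma pgpt_surj Z : inU pgpt Z.
Proof. by exists (rep Z); rewrite ?rep_neq0 // (pgpt_hc (hc_rep Z)). Qed.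

End StandardPemb.

(** * From linear morphisms to point maps on pairs of subspaces *)

Section EmbeddingsAndLines.
Variables (S P : geometry) (hS : semilinear_space S) (hP : projective_space P).
Variables (eta : gmap (pt S) (pt P)) (heta : embedding eta).

(** On both sides the join of two distinct collinear points is the line through them, so the join
    condition makes the image of [l] a full line, not merely a part of one. *)
Lemma embedding_line l : lines S l -> exists2 m, lines P m &
  forall z, m z <-> exists2 X, l X & eta X = Some z.
Proof.
move=> hl; have [S2 _ S3] := hS; have [[L1 _] gl inj] := heta.
have [X [Y [XY lX lY]]] := S2 _ hl.
have [x ex] : exists x, eta X = Some x by case e : (eta X) (gl X) => [x|] // _; exists x.
have [y ey] : exists y, eta Y = Some y by case e : (eta Y) (gl Y) => [y|] // _; exists y.
have xy : x <> y by move=> h; apply: XY; apply: inj; rewrite ex ey h.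
have [h1 _ _] := hP; have [m [[hm mx my] _]] := h1 _ _ xy.
have jl : join [set X] [set Y] = l.
  apply/seteqP; split=> Z.
    move=> [[->//|->//]|[k [hk [X1 [X2 [-> -> _ kX kY]]]] kZ]].
    rewrite (_ : l = k) //; apply: contrapT => lk; apply: XY.
    exact: (S3 l k hl hk lk).
  by move=> lZ; right; exists l => //; split=> //; exists X, Y.
have jm : join (gimage eta [set X]) (gimage eta [set Y]) = m.
  have -> : gimage eta [set X] = [set x].
    apply/seteqP; split=> [z [_ -> /=]|_ ->]; first by rewrite ex => -[].
    by exists X.
  have -> : gimage eta [set Y] = [set y].
    apply/seteqP; split=> [z [_ -> /=]|_ ->]; first by rewrite ey => -[].
    by exists Y.
  apply/seteqP; split=> Z.
    move=> [[->//|->//]|[k [hk [X1 [X2 [-> -> _ kX kY]]]] kZ]].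
    by rewrite (line_uniq hP xy hm mx my hk kX kY).
  by move=> mZ; right; exists m => //; split=> //; exists x, y.
have hXY : collinear X Y by exists l.
have := L1 _ _ hXY; rewrite jl jm => e.
by exists m => // z; rewrite -e.
Qed.

End EmbeddingsAndLines.

Section ProductOfGrassmannians.
Variables (F : fieldType) (h' N' h N : nat).
Hypothesis hN' : (0 < h' < N')%N.
Hypothesis hN : (0 < h < N)%N.
Local Notation V' := 'rV[F]_N'.+1.
Local Notation V := 'rV[F]_N.+1.
Local Notation S := (prod_geometry (grassmann F h' N') (grassmann F h N)).
Variables (P : geometry) (hP : projective_space P).
Variables (eta : gmap (pt S) (pt P)) (heta : embedding eta) (p0 : pt P).

(* [eta] as a function of two subspaces; the value is the junk point [p0] in
   wrong dimensions. *)
Definition eta_vs (X' : {vspace V'}) (X : {vspace V}) : pt P :=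
  if insub X' : option (subsp F N' h'.+1) is Some a' then
    if insub X : option (subsp F N h.+1) is Some a then odflt p0 (eta (a', a)) else p0
  else p0.

Lemma eta_vsE (a' : subsp F N' h'.+1) (a : subsp F N h.+1) :
  eta (a', a) = Some (eta_vs (val a') (val a)).
Proof.
rewrite /eta_vs !valK; have [_ gl _] := heta.
by case: (eta _) (gl (a', a)).
Qed.

Lemma S_semilinear : semilinear_space S.
Proof.
by apply: prod_semilinear; apply: grassmann_semilinear; [case/andP: hN'|case/andP: hN].
Qed.

Lemma pembed_eta : pembed h' h eta_vs.
Proof.
have [_ _ inj] := heta.
have inj2 X' Y' X Y : \dim X' = h'.+1 -> \dim Y' = h'.+1 -> \dim X = h.+1 -> \dim Y = h.+1 ->
    eta_vs X' X = eta_vs Y' Y -> X' = Y' /\ X = Y.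
  move=> /eqP dX' /eqP dY' /eqP dX /eqP dY e.
  have := eta_vsE (mk_subsp dX') (mk_subsp dX); have := eta_vsE (mk_subsp dY') (mk_subsp dY).
  by rewrite /= -e => <- /inj [].
split=> //.
- move=> X' dX'; split=> [X Y dX dY /(inj2 _ _ _ _ dX' dX' dX dY)[] //|A B AB [dA] dB].
  pose a' : subsp F N' h'.+1 := mk_subsp (introT eqP dX').
  pose A1 : subsp F N h := mk_subsp (introT eqP dA).
  pose B1 : subsp F N h.+2 := mk_subsp (introT eqP dB).
  have [|m hm mP] := embedding_line S_semilinear hP heta
      (l := [set a'] `*` [set X : subsp F N h.+1 | (val A1 <= val X <= val B1)%VS]).
    by left; exists a', [set X : subsp F N h.+1 | (val A1 <= val X <= val B1)%VS]; split=> //; exists A1, B1.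
  exists m => // z; split.
    move=> /mP[[b' b] [/= -> hb] e]; exists (val b); rewrite hb (eqP (valP b)); split=> //.
    by move: e; rewrite eta_vsE => -[].
  move=> [X [AXB dX ->]]; apply/mP; exists (a', mk_subsp (introT eqP dX)) => //.
  by rewrite eta_vsE.
- move=> X dX; split=> [X' Y' dX' dY' /(inj2 _ _ _ _ dX' dY' dX dX)[] //|A B AB [dA] dB].
  pose a : subsp F N h.+1 := mk_subsp (introT eqP dX).
  pose A1 : subsp F N' h' := mk_subsp (introT eqP dA).
  pose B1 : subsp F N' h'.+2 := mk_subsp (introT eqP dB).
  have [|m hm mP] := embedding_line S_semilinear hP heta
      (l := [set X : subsp F N' h'.+1 | (val A1 <= val X <= val B1)%VS] `*` [set a]).
    by right; exists [set X : subsp F N' h'.+1 | (val A1 <= val X <= val B1)%VS], a; split=> //; exists A1, B1.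
  exists m => // z; split.
    move=> /mP[[b' b] [/= hb ->] e]; exists (val b'); rewrite hb (eqP (valP b')); split=> //.
    by move: e; rewrite eta_vsE => -[].
  move=> [X' [AXB dX' ->]]; apply/mP; exists (mk_subsp (introT eqP dX'), a) => //.
  by rewrite eta_vsE.
Qed.

End ProductOfGrassmannians.

(** * Finite generation and coordinates on the span of the image *)

Section GeneratedSubspaces.
Variables (F : fieldType) (P : geometry) (U : set (pt P)) (hU : subspace U).

Definition unit_span N (A : {set 'I_N.+1}) : {vspace 'rV[F]_N.+1} :=
  span [seq delta_mx 0 s : 'rV[F]_N.+1 | s <- enum A].

(** A subspace containing the images of two members of a pencil contains those of all members, so
    [generation] reduces the claim to spans of unit vectors. *)
Lemma gembed_generated N h (f : {vspace 'rV[F]_N.+1} -> pt P) : gembed h.+1 f ->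
  (forall A : {set 'I_N.+1}, \dim (unit_span A) = h.+1 -> U (f (unit_span A))) ->
  forall X, \dim X = h.+1 -> U (f X).
Proof.
move=> [finj fl] hA X dX; rewrite -(span_basis (vbasisP X)).
apply: (generation (es := units F N N.+1) (Q := fun X => U (f X)) (j := h.+1)).
- move=> ts /sub_units[ls -> _] /eqP dls zls.
  have e : span [seq (delta_mx 0 s : 'rV[F]_N.+1) | s <- ls] = unit_span [set s in ls]%SET.
    by apply: span_unitv => s; rewrite mem_enum inE.
  by rewrite e; apply: hA; rewrite -e dls.
- move=> x y ds fr _ [sz] Ux Uy; have [fx fy] := free_consr fr.
  have [dx dy] := (dim_free_cons fx sz, dim_free_cons fy sz).
  have dd : (\dim <<ds>>%VS).+1 = h.+1.
    by move: fx; rewrite free_cons => /andP[_ /eqP->]; rewrite sz.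
  have dxy := dim_free_cons fr (congr1 S sz).
  have sub w : w \in <<x :: y :: ds>>%VS -> (<<ds>> <= <<w :: ds>> <= <<x :: y :: ds>>)%VS.
    move=> wL; apply/andP; split; first by rewrite span_cons addvSr.
    apply/span_subvP => t; rewrite inE => /orP[/eqP->//|td].
    by rewrite memv_span // !inE td !orbT.
  have xL : x \in <<x :: y :: ds>>%VS by rewrite memv_span ?mem_head.
  have yL : y \in <<x :: y :: ds>>%VS by rewrite memv_span // !inE eqxx orbT.
  have fz : free (x + y :: ds) by have := free_addl 1 fr; rewrite scale1r.
  have dz := dim_free_cons fz sz.
  have [|l hl lP] := fl <<ds>>%VS <<x :: y :: ds>>%VS _ dd dxy.
    by case/andP: (sub _ xL) => s1 s2; apply: subv_trans s1 s2.
  apply: (hU Ux Uy _ hl); try by apply/lP; eexists; split; [apply: sub| |reflexivity].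
    move=> e; have := finj _ _ dx dy e => exy.
    by move: fr; rewrite free_cons -exy memv_span ?mem_head.
  by apply/lP; exists <<(x + y)%R :: ds>>%VS; split=> //; apply: sub; rewrite memvD.
- exact: basis_free (vbasisP X).
- by move=> z _; apply/units_span => j; rewrite leqNgt ltn_ord.
- by rewrite size_tuple.
Qed.

Lemma pembed_generated N' h' N h (f : {vspace 'rV[F]_N'.+1} -> {vspace 'rV[F]_N.+1} -> pt P) :
  pembed h' h f ->
  (forall (A' : {set 'I_N'.+1}) (A : {set 'I_N.+1}), U (f (unit_span A') (unit_span A))) ->
  forall X' X, \dim X' = h'.+1 -> \dim X = h.+1 -> U (f X' X).
Proof.
move=> [f1 f2 _] hA X' X dX' dX.
apply: (gembed_generated (f2 _ dX)) => // A' dA'.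
by apply: (gembed_generated (f1 _ dA')).
Qed.

End GeneratedSubspaces.

Lemma gembed_comp (F : fieldType) n k (P Q : geometry) (f : {vspace 'rV[F]_n} -> pt P)
  (g : pt P -> pt Q) : injective g -> (forall l, lines P l -> lines Q (g @` l)) ->
  gembed k f -> gembed k (fun X => g (f X)).
Proof.
move=> gi gl [fi fl]; split=> [X Y dX dY /gi|A B AB dA dB]; first exact: fi.
have [l hl lP] := fl A B AB dA dB; exists (g @` l); first exact: gl.
move=> z; split=> [[y /lP[X [? ? ->]] <-]|[X [? ? ->]]]; first by exists X.
by exists (f X) => //; apply/lP; exists X.
Qed.

Section Coordinates.
Variables (F : fieldType) (h' N' h N : nat).
Hypothesis hN' : (0 < h' < N')%N.
Hypothesis hN : (0 < h < N)%N.
Local Notation S := (prod_geometry (grassmann F h' N') (grassmann F h N)).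
Variables (P : geometry) (hP : projective_space P).
Variables (eta : gmap (pt S) (pt P)) (heta : embedding eta) (p0 : pt P).
Hypothesis eta_span : proj_span (gim eta) = setT.
Let B := eta_vs eta p0.

Lemma span_coordinates : exists d (psi : 'rV[F]_d.+1 -> pt P),
  [/\ (3 <= d.+1)%N, pemb psi & forall z, inU psi z].
Proof.
have hB := pembed_eta hN' hN hP heta p0; have [hB1 _ _] := hB.
have [|xs0 [f0 z0]] := @exists_free_seq F N' h'.+1; first by case/andP: hN' => _ /ltnW.
have d0 : \dim <<xs0>>%VS = h'.+1 by rewrite (eqP f0).
have hltN : (h < N)%N by case/andP: hN.
(* [0 < h] provides the three homogeneous coordinates from which the extension by points can
   start. *)
have h3 : (3 <= h.+2)%N by case/andP: hN.
pose es := enum {: {set 'I_N'.+1} * {set 'I_N.+1}}.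
(* The pairs of index sets are not filtered by size: a pair of wrong dimensions contributes the junk
   point [p0], which is merely one more point to adjoin. *)
pose b i := let a := nth (finset.set0, finset.set0) es i in
  B (unit_span F a.1) (unit_span F a.2).
have [m [psi [m3 hpsi hb]]] := pemb_extend_seq hP b (size es) h3 (pemb_perp hltN (hB1 _ d0)).
case: m psi m3 hpsi hb => // d psi m3 hpsi hb.
exists d, psi; split=> // z; have subU := inU_subspace hP hpsi.
have : proj_span (gim eta) z by rewrite eta_span.
apply; split=> // y [[a' a] _]; rewrite (eta_vsE heta p0) => -[<-].
apply: (pembed_generated subU hB _ (eqP (valP a')) (eqP (valP a))) => A' A.
have := hb (index (A', A) es); rewrite index_mem mem_enum => /(_ isT).
by rewrite /b nth_index ?mem_enum.
Qed.

Theorem eta_coordinates : exists d (psi : 'rV[F]_d.+1 -> pt P) (s t : {rmorphism F -> F})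
    (L : 'M[F]_((plucker_dim h' N').+1 * (plucker_dim h N).+1, d.+1)),
  [/\ (3 <= d.+1)%N /\ pemb psi, forall z, inU psi z, bijective s, bijective t &
    forall xs' xs, free xs' -> size xs' = h'.+1 -> free xs -> size xs = h.+1 ->
      let z := tensor_vec (map_mx s (plv h' xs')) (map_mx t (plv h xs)) *m L in
      z != 0 /\ B <<xs'>>%VS <<xs>>%VS = psi z].
Proof.
have [d [psi [d3 hpsi surj]]] := span_coordinates.
have [g [gK Kg _ gl]] := collineation_iso hP hpsi surj.
have [hB1 hB2 hB3] := pembed_eta hN' hN hP heta p0.
have gi : injective g := can_inj Kg.
have hgB : pembed h' h (fun X' X => g (B X' X)).
  split.
  - by move=> X' dX'; apply: gembed_comp => //; apply: hB1.
  - by move=> X dX; apply: (gembed_comp gi gl (f := fun X' => B X' X)); apply: hB2.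
  - by move=> X' Y' X Y dX' dY' dX dY /gi; apply: hB3.
have [s [t [L [s_bij t_bij hL]]]] := product_embedding hN' hN hgB.
exists d, psi, s, t, L; split=> // xs' xs fx' zx' fx zx /=.
have hz := hL xs' xs fx' zx' fx zx; split; first exact: hc_neq0 hz.
by rewrite -(collineation_hc hpsi hz) Kg.
Qed.

End Coordinates.

Lemma inverse_rmorphism (F : fieldType) (s : {rmorphism F -> F}) : bijective s ->
  exists t : {rmorphism F -> F}, cancel s t /\ cancel t s.
Proof.
move=> [g sK gK].
have [||| t tE] := @make_rmorphism F g.
- by move=> x y; apply: (can_inj sK); rewrite rmorphD !gK.
- by move=> x y; apply: (can_inj sK); rewrite rmorphM !gK.
- by apply: (can_inj sK); rewrite rmorph1 gK.
by exists t; split=> x; rewrite tE.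
Qed.

(** * Coordinatewise action of field automorphisms *)

Section CoordinatewiseImage.
Variables (F : fieldType) (n : nat).
Implicit Types (s t : {rmorphism F -> F}) (U W : {vspace 'rV[F]_n}) (xs : seq 'rV[F]_n).

Definition sim s U : {vspace 'rV[F]_n} := <<[seq map_mx s x | x <- vbasis U]>>%VS.

Lemma map_span s xs x : x \in <<xs>>%VS -> map_mx s x \in <<[seq map_mx s x | x <- xs]>>%VS.
Proof.
apply: (span_ind (R := fun x => map_mx s x \in <<[seq map_mx s x | x <- xs]>>%VS)).
- by rewrite map_mx0 mem0v.
- by move=> y z hy hz; rewrite map_mxD memvD.
- by move=> c e exs; rewrite map_mxZ memvZ // memv_span // map_f.
Qed.

Lemma sim_span s xs : sim s <<xs>>%VS = <<[seq map_mx s x | x <- xs]>>%VS.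
Proof.
apply/eqP; rewrite eqEsubv; apply/andP; split; apply/span_subvP => _ /mapP[x xx ->].
  by apply: map_span; apply: vbasis_mem.
by apply: map_span; rewrite (span_basis (vbasisP _)) memv_span.
Qed.

Lemma sim_mem s U x : x \in U -> map_mx s x \in sim s U.
Proof. by move=> xU; apply: map_span; rewrite (span_basis (vbasisP U)). Qed.

Lemma sim_sub s U W : (U <= W)%VS -> (sim s U <= sim s W)%VS.
Proof.
by move=> UW; apply/span_subvP => _ /mapP[x /vbasis_mem xU ->]; apply/sim_mem/(subvP UW).
Qed.

Lemma dim_sim_le s U : (\dim (sim s U) <= \dim U)%N.
Proof. by apply: leq_trans (dim_span _) _; rewrite size_map size_tuple. Qed.

Variables (s t : {rmorphism F -> F}) (sK : cancel s t).

Lemma map_mxK m p (A : 'M[F]_(m, p)) : map_mx t (map_mx s A) = A.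
Proof. by apply/matrixP => i j; rewrite !mxE. Qed.

Lemma simK U : sim t (sim s U) = U.
Proof.
rewrite [sim s U]/sim sim_span -map_comp.
rewrite (eq_map (g := id)) ?map_id; first exact: span_basis (vbasisP U).
by move=> x /=; rewrite map_mxK.
Qed.

Lemma dim_sim U : \dim (sim s U) = \dim U.
Proof. by apply/eqP; rewrite eqn_leq dim_sim_le -{1}[U]simK dim_sim_le. Qed.

Lemma free_map xs : free xs -> free [seq map_mx s x | x <- xs].
Proof. by rewrite /free -sim_span dim_sim size_map. Qed.

End CoordinatewiseImage.

Lemma plv_map (F : fieldType) h N (s : {rmorphism F -> F}) (xs : seq 'rV[F]_N.+1) :
  plv h [seq map_mx s x | x <- xs] = map_mx s (plv h xs).
Proof.
apply/rowP => i; rewrite !mxE -det_map_mx; congr (\det _); apply/matrixP => k j; rewrite !mxE.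
have [lk|lk] := ltnP k (size xs); first by rewrite (nth_map 0) // mxE.
by rewrite !nth_default ?size_map // !mxE rmorph0.
Qed.

Section InducedAutomorphism.
Variables (F : fieldType) (h N : nat) (s t : {rmorphism F -> F}).
Hypotheses (sK : cancel s t) (tK : cancel t s).

Definition sim_subsp k (X : subsp F N k) : subsp F N k :=
  mk_subsp (introT eqP (etrans (dim_sim sK (val X)) (eqP (valP X)))).

End InducedAutomorphism.

Lemma sim_automorphism (F : fieldType) (h N : nat) (s t : {rmorphism F -> F})
  (sK : cancel s t) (tK : cancel t s) :
  @automorphism (grassmann F h N) (@sim_subsp F N s t sK h.+1).
Proof.
have img (s1 t1 : {rmorphism F -> F}) (sK1 : cancel s1 t1) (tK1 : cancel t1 s1) (l : set (pt (grassmann F h N))) :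
    lines (grassmann F h N) l -> lines (grassmann F h N) (@sim_subsp F N s1 t1 sK1 h.+1 @` l).
  move=> [A [B [AB ->]]]; exists (sim_subsp sK1 A), (sim_subsp sK1 B).
  split; first exact: sim_sub.
  apply/seteqP; split=> X.
    by move=> [Y /= /andP[AY YB] <-] /=; rewrite !sim_sub.
  move=> /= /andP[AX XB]; exists (sim_subsp tK1 X); last by apply: val_inj; rewrite /= simK.
  rewrite /= -[X in (X <= _ <= _)%VS](simK sK1) -[X in (_ <= _ <= X)%VS](simK sK1).
  by rewrite !sim_sub.
exists (@sim_subsp F N t s tK h.+1); split.
- by move=> X; apply: val_inj; rewrite /= simK.
- by move=> X; apply: val_inj; rewrite /= simK.
- exact: img.
- exact: img.
Qed.

Section SemilinearPemb.
Variables (P : geometry) (F : fieldType) (n : nat) (phi : 'rV[F]_n -> pt P).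
Variables (s t : {rmorphism F -> F}) (A : 'M[F]_n).
Hypotheses (hphi : pemb phi) (sK : cancel s t) (tK : cancel t s) (Au : A \in unitmx).

Definition semilin v : 'rV[F]_n := map_mx s v *m A.

Lemma semilinK v : map_mx t (semilin v *m invmx A) = v.
Proof. by rewrite mulmxK // map_mxK. Qed.

Lemma semilinKV v : semilin (map_mx t (v *m invmx A)) = v.
Proof. by rewrite /semilin map_mxK // mulmxKV. Qed.

Lemma semilin_eq0 v : (semilin v == 0) = (v == 0).
Proof.
apply/eqP/eqP => [e|->]; last by rewrite /semilin map_mx0 mul0mx.
by rewrite -(semilinK v) e mul0mx map_mx0.
Qed.

(** This is how [s] and [L] are absorbed into the coordinates of [P] and thereby into the
    collineation. *)
Lemma pemb_semilin : pemb (fun v => phi (semilin v)).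
Proof.
have [h1 h2 h3] := hphi; split.
- move=> v w v0 w0 /h1; rewrite !semilin_eq0 => /(_ v0 w0)/vlineP[c e].
  apply/vlineP; exists (t c); rewrite -(semilinK w) e -scalemxAl map_mxZ.
  by rewrite -[in RHS](semilinK v).
- by move=> c v c0; rewrite /semilin map_mxZ -scalemxAl h2 // fmorph_eq0.
move=> L dL; pose g : 'End('rV[F]_n) := linfun (mulmxr A).
have kg : lker g = 0%VS.
  apply/eqP/lker0P => x y; rewrite !lfunE /= => e.
  by rewrite -(mulmxK Au x) e mulmxK.
have [|l hl lP] := h3 (g @: sim s L)%VS.
  by rewrite limg_dim_eq ?kg ?capv0 // (dim_sim sK).
exists l => // z; split.
  move=> /lP[_ [/memv_imgP[x xL ->] u0 ->]]; exists (map_mx t x).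
  have xE : semilin (map_mx t x) = g x by rewrite /semilin map_mxK // lfunE.
  rewrite xE -semilin_eq0 xE u0; split=> //.
  by rewrite -(simK sK L) sim_mem.
move=> [u [uL u0 ->]]; apply/lP; exists (semilin u); rewrite semilin_eq0 u0; split=> //.
apply/memv_imgP; exists (map_mx s u); first exact: sim_mem.
by rewrite lfunE.
Qed.

Lemma semilin_surj : (forall z, inU phi z) -> forall z, inU (fun v => phi (semilin v)) z.
Proof.
move=> surj z; have [v v0 ->] := surj z; exists (map_mx t (v *m invmx A)).
  by rewrite -semilin_eq0 semilinKV.
by rewrite semilinKV.
Qed.

End SemilinearPemb.

(** * Coordinates of the standard embedding *)

Section StandardEmbedding.
Variables (F : fieldType) (h' N' h N : nat).

Lemma segre_hc m' m (A : pt (PG F m')) (B : pt (PG F m)) a b : hc A a -> hc B b ->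
  hc (segre (A, B)) (mxvec (a^T *m b) : 'rV[F]_(segre_dim m' m).+1).
Proof.
move=> hA hB; have [c c0 aE] := hc_scale (hc_rep A) hA; have [e e0 bE] := hc_scale (hc_rep B) hB.
have hS : hc (segre (A, B)) (segre_vec (A, B)) by [].
have E : mxvec (a^T *m b) = (c * e) *: segre_vec (A, B) :> 'rV_(segre_dim m' m).+1.
  have -> : a^T *m b = (c * e) *: ((rep A)^T *m rep B).
    by rewrite aE bE -scalemxAr [(c *: _)^T]linearZ /= -scalemxAl scalerA mulrC.
  have lin p q (k : F) (C : 'M_(p, q)) : mxvec (k *: C) = k *: mxvec C by rewrite linearZ.
  exact: (lin _ _ (c * e) ((rep A)^T *m rep B)).
rewrite E; apply: (hcI _ _ hS); last by rewrite memvZ ?memv_line.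
by rewrite scaler_eq0 negb_or mulf_neq0 ?segre_vec_neq0.
Qed.

Lemma plucker_hc k m (X : pt (grassmann F k m)) xs : free xs -> <<xs>>%VS = val X ->
  hc (plucker X) (plv k xs).
Proof.
move=> fx e; have zx : size xs = k.+1 by rewrite -(eqP fx) e (eqP (valP X)).
have [c c0 hc1] := plv_span (xs := vbasis (val X)) (basis_free (vbasisP (val X))) fx
  (etrans (size_tuple _) (eqP (valP X))) zx (etrans (span_basis (vbasisP (val X))) (esym e)).
have hP : hc (plucker X) (plv k (vbasis (val X))) by [].
rewrite hc1; apply: (hcI _ _ hP); last by rewrite memvZ ?memv_line.
by rewrite scaler_eq0 negb_or c0 (hc_neq0 hP).
Qed.

(** The type ascription is accepted because the predecessor in [segre_dim] is taken of a product of
    successors, so the following successor cancels it by computation. *)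
Lemma std_embedding_hc (X' : pt (grassmann F h' N')) (X : pt (grassmann F h N)) xs' xs :
  free xs' -> <<xs'>>%VS = val X' -> free xs -> <<xs>>%VS = val X ->
  hc (std_embedding (X', X)) (tensor_vec (plv h' xs') (plv h xs)
    : 'rV[F]_(segre_dim (plucker_dim h' N') (plucker_dim h N)).+1).
Proof. by move=> f' e' f e; apply: segre_hc; apply: plucker_hc. Qed.

Lemma map_tensor_vec (s : {rmorphism F -> F}) u v :
  map_mx s (tensor_vec u v) = @tensor_vec F h' N' h N (map_mx s u) (map_mx s v).
Proof. by rewrite /tensor_vec map_mxvec map_mxM map_trmx. Qed.

(** Pairs of coordinate subspaces go to the points of the unit vectors, one for each pair of
    indices, and these span. *)
Lemma std_embedding_spans : (h' <= N')%N -> (h <= N)%N ->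
  proj_span (range (@std_embedding F h' N' h N)) = setT.
Proof.
move=> hN' hN; apply/seteqP; split=> // Z _.
have [z z0 ->] := pgpt_surj Z.
pose M := (segre_dim (plucker_dim h' N') (plucker_dim h N)).+1.
pose vs := [seq (delta_mx 0 k : 'rV[F]_M) | k <- enum 'I_M].
suff : forall v, v \in vs -> v != 0 -> range (@std_embedding F h' N' h N) (pgpt v).
  move=> /(proj_span_points (@pemb_pgpt _ _)); apply.
  exists z; split=> //; rewrite (row_sum_delta z); apply: memv_suml => j _.
  by apply/memvZ/memv_span/map_f; rewrite mem_enum.
move=> _ /mapP[k _ ->] _.
case/mxvec_indexP: (k : 'I_((plucker_dim h' N').+1 * (plucker_dim h N).+1)) => i' i.
have [xs' [c' [fx' zx' c'0 e']]] := plv_delta F hN' i'.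
have [xs [c [fx zx c0 e]]] := plv_delta F hN i.
have dx' : \dim <<xs'>>%VS == h'.+1 by rewrite (eqP fx') zx'.
have dx : \dim <<xs>>%VS == h.+1 by rewrite (eqP fx) zx.
exists (mk_subsp dx', mk_subsp dx) => //; apply/esym/pgpt_hc.
have := @std_embedding_hc (mk_subsp dx') (mk_subsp dx) xs' xs fx' erefl fx erefl.
have -> : tensor_vec (plv h' xs') (plv h xs) = (c' * c) *: delta_mx 0 (mxvec_index i' i).
  rewrite /tensor_vec e' e -scalemxAr [(c' *: _)^T]linearZ /= trmx_delta -scalemxAl scalerA mulrC mul_delta_mx.
  by rewrite linearZ /= mxvec_delta.
move=> hz; apply: (hcI _ _ hz).
  by apply/eqP => /matrixP/(_ 0 (mxvec_index i' i))/eqP; rewrite !mxE !eqxx oner_eq0.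
by apply/vlineP; exists (c' * c)^-1; rewrite scalerA mulVf ?scale1r // mulf_neq0.
Qed.

End StandardEmbedding.

Lemma subsp_basis (F : fieldType) m k (X : subsp F m k) :
  exists xs, [/\ free xs, size xs = k & <<xs>>%VS = val X].
Proof.
exists (vbasis (val X)); split; first exact: basis_free (vbasisP _).
  by rewrite size_tuple (eqP (valP X)).
exact: span_basis (vbasisP _).
Qed.

Lemma row_full_surj (F : fieldType) m n (A : 'M[F]_(m, n)) :
  (forall u : 'rV_n, u != 0 -> exists w : 'rV_m, u = w *m A) -> row_full A.
Proof.
move=> hA; rewrite -sub1mx; apply/row_subP => i; have [->|u0] := eqVneq (row i (1%:M : 'M[F]_n)) 0.
  exact: sub0mx.
by have [w ->] := hA _ u0; apply: submxMl.
Qed.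

Lemma isomorphism_comp (S T R : geometry) (f : pt S -> pt T) (g : pt T -> pt R) :
  isomorphism f -> isomorphism g -> isomorphism (g \o f).
Proof.
move=> [f1 [fK Kf fl f1l]] [g1 [gK Kg gl g1l]]; exists (f1 \o g1).
split; [exact: can_comp|exact: can_comp| |].
  by move=> l hl; rewrite -image_comp; apply/gl/fl.
by move=> l hl; rewrite -image_comp; apply/f1l/g1l.
Qed.

Lemma pemb_comp (P Q : geometry) (F : fieldType) n (phi : 'rV[F]_n -> pt P) (g : pt P -> pt Q) :
  isomorphism g -> pemb phi -> pemb (g \o phi).
Proof.
move=> [g1 [gK _ gl _]] [h1 h2 h3]; split.
- by move=> v w v0 w0 /= /(can_inj gK); apply: h1.
- by move=> c v c0 /=; rewrite h2.
move=> L dL; have [l hl lP] := h3 L dL; exists (g @` l); first exact: gl.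
move=> z; split=> [[_ /lP[u [uL u0 ->]] <-]|[u [uL u0 ->]]]; first by exists u.
by exists (phi u) => //; apply/lP; exists u.
Qed.

Section CoordinatewisePoints.
Variables (F : fieldType) (s t : {rmorphism F -> F}) (sK : cancel s t).

Lemma sim_subsp_span m k (X : subsp F m k) xs : <<xs>>%VS = val X ->
  val (sim_subsp sK X) = <<[seq map_mx s x | x <- xs]>>%VS.
Proof. by move=> e; rewrite /= -e sim_span. Qed.

Lemma hc_sim d (Z : pt (PG F d)) z : hc Z z ->
  hc (sim_subsp sK Z : pt (PG F d)) (map_mx s z).
Proof.
by move=> hz; rewrite /hc /= -span_seq1 -/(map (map_mx s) [:: z]) -sim_span span_seq1 -hz.
Qed.

(** Minors and products of coordinates are polynomials with integer coefficients, hence commute with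
    a field morphism applied entrywise. *)
Lemma sim_std_embedding h' N' h N (X' : pt (grassmann F h' N')) (X : pt (grassmann F h N)) :
  sim_subsp sK (std_embedding (X', X)) =
  std_embedding (sim_subsp sK X' : pt (grassmann F h' N'), sim_subsp sK X : pt (grassmann F h N)).
Proof.
have [[xs' [fx' _ e']] [xs [fx _ e]]] := (subsp_basis X', subsp_basis X).
have h1 := hc_sim (std_embedding_hc fx' e' fx e).
have h2 := @std_embedding_hc F h' N' h N (sim_subsp sK X') (sim_subsp sK X) _ _
  (free_map sK fx') (esym (sim_subsp_span e')) (free_map sK fx) (esym (sim_subsp_span e)).
apply: (hc_inj h1 h2); rewrite !plv_map map_tensor_vec; exact: memv_line.
Qed.

End CoordinatewisePoints.

(** Composing the standard coordinates with [kappa] gives coordinates again, to which the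
    fundamental theorem applies; surjectivity of [kappa] makes the square matrix invertible. *)
Lemma collineation_semilinear (F : fieldType) d (kappa : pt (PG F d) -> pt (PG F d)) :
  (3 <= d.+1)%N -> isomorphism kappa ->
  exists (s : {rmorphism F -> F}) (A : 'M[F]_d.+1), [/\ bijective s, A \in unitmx &
    forall Z z, hc Z z -> hc (kappa Z) (map_mx s z *m A)].
Proof.
move=> d3 hk; have [s [A [sb hA]]] := fundamental_theorem (pemb_comp hk (@pemb_pgpt F d)) d3.
exists s, A; split=> //; last first.
  by move=> Z z hz; rewrite -(pgpt_hc hz); apply/hA/(hc_neq0 hz).
rewrite -row_full_unit; apply: row_full_surj => u u0.
have [k1 [_ Kk _ _]] := hk; have [z z0 zE] := pgpt_surj (k1 (pgpt u)).
have := hA z z0; rewrite /= -zE Kk => /(hc_mem (hc_pgpt u0))/vlineP[c ->].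
by exists (c *: map_mx s z); rewrite scalemxAl.
Qed.

(** * Classification of the embeddings and of their images *)

Section Main.
Variables (F : fieldType) (h' N' h N : nat).
Hypothesis hN' : (0 < h' < N')%N.
Hypothesis hN : (0 < h < N)%N.
Local Notation S := (prod_geometry (grassmann F h' N') (grassmann F h N)).
Local Notation D := (segre_dim (plucker_dim h' N') (plucker_dim h N)).
Local Notation phi := (@std_embedding F h' N' h N).
Variables (P : geometry) (hP : projective_space P).
Variables (eta : gmap (pt S) (pt P)) (heta : embedding eta).
Hypothesis eta_rk : (rk (fun X => Some (phi X)) <= rk eta)%E.
Hypothesis eta_span : proj_span (gim eta) = setT.

Lemma rk_std_embedding : rk (fun X => Some (phi X)) = (D.+1%:Z - 1)%:E.
Proof.
rewrite /rk (_ : gim _ = range phi); last first.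
  by apply/seteqP; split=> [z [X _ [<-]]|z [X _ <-]]; exists X.
rewrite std_embedding_spans; [|by case/andP: hN' => _ /ltnW|by case/andP: hN => _ /ltnW].
exact (pdim_setT (PG_projective F D) (@pemb_pgpt F D) (@pgpt_surj F D)).
Qed.

(** The rank hypothesis gives [D <= d]. Conversely, the points of the row space of [L] form a
    subspace containing the image of [eta], hence all of [P]; so [L] has rank [d.+1], which is at
    most its number [D.+1] of rows. *)
Lemma eta_square_coordinates (p0 : pt P) :
  exists (psi : 'rV[F]_D.+1 -> pt P) (s t : {rmorphism F -> F}) (L : 'M[F]_D.+1),
  [/\ (3 <= D.+1)%N /\ pemb psi, forall z, inU psi z, bijective s /\ bijective t, L \in unitmx &
    forall xs' xs, free xs' -> size xs' = h'.+1 -> free xs -> size xs = h.+1 ->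
      eta_vs eta p0 <<xs'>> <<xs>> =
      psi ((tensor_vec (map_mx s (plv h' xs')) (map_mx t (plv h xs)) : 'rV[F]_D.+1) *m L)].
Proof.
have [d [psi [s [t [L [[d3 hpsi] surj sb tb hL]]]]]] := eta_coordinates hN' hN hP heta p0 eta_span.
have Dd : (D <= d)%N.
  move: eta_rk; rewrite rk_std_embedding /rk eta_span (pdim_setT hP hpsi surj) lee_fin; lia.
have full : row_full L.
  apply: row_full_surj => u u0; pose W := limg (linfun (mulmxr L : 'rV_(_ * _) -> _)).
  have : u \in W.
    apply: (points_of_mem hpsi) => //.
    have : proj_span (gim eta) (psi u) by rewrite eta_span.
    apply; split; first exact: points_of_subspace.
    move=> z [[X' X] _]; rewrite (eta_vsE heta p0) => -[<-].
    have [[xs' [fx' zx' <-]] [xs [fx zx <-]]] := (subsp_basis X', subsp_basis X).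
    have [z0 ->] := hL xs' xs fx' zx' fx zx; eexists; split; [|exact: z0|reflexivity].
    by apply/memv_imgP; eexists; [exact: memvf|rewrite lfunE].
  by move=> /memv_imgP[w _ ->]; exists w; rewrite lfunE.
have dD : d = D.
  have := rank_leq_row L; rewrite (eqP full) => le.
  by apply/eqP; rewrite eqn_leq Dd andbT -ltnS.
subst d; exists psi, s, t, L; split=> //; first by rewrite -row_full_unit.
by move=> xs' xs fx' zx' fx zx; have [_ ->] := hL xs' xs fx' zx' fx zx.
Qed.

(** The inequality is recorded for [embedding_image], which applies the fundamental theorem to a
    collineation of [PG F D]. *)
Lemma embedding_classification : (3 <= D.+1)%N /\
  exists (alpha : pt (grassmann F h N) -> pt (grassmann F h N)) (psi : pt (PG F D) -> pt P),
   [/\ automorphism alpha, isomorphism psi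
     & forall X' X, eta (X', X) = Some (psi (phi (X', alpha X)))].
Proof.
(* Only a junk value for [eta_vs] is wanted here; any value of [eta] will do. *)
have [p0 _] : exists p0 : pt P, True.
  have [[xs' [fx' zx']] [xs [fx zx]]] : (exists xs' : seq 'rV[F]_N'.+1, free xs' /\ size xs' = h'.+1) /\
      (exists xs : seq 'rV[F]_N.+1, free xs /\ size xs = h.+1).
    by split; [have [|xs' []] := @exists_free_seq F N' h'.+1|have [|xs []] := @exists_free_seq F N h.+1];
      (try by case/andP: hN' => _ /ltnW); (try by case/andP: hN => _ /ltnW); eexists; split; eassumption.
  have dx' : \dim <<xs'>>%VS == h'.+1 by rewrite (eqP fx') zx'.
  have dx : \dim <<xs>>%VS == h.+1 by rewrite (eqP fx) zx.
  have [_ gl _] := heta.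
  by case e : (eta (mk_subsp dx', mk_subsp dx)) (gl (mk_subsp dx', mk_subsp dx)) => [p|] // _; exists p.
have [psi [s [t [L [[d3 hpsi] surj [sb tb] Lu hL]]]]] := eta_square_coordinates p0.
split=> //.
have [[s1 [sK s1K]] [t1 [tK t1K]]] := (inverse_rmorphism sb, inverse_rmorphism tb).
(* Applying [s] to the whole tensor afterwards gives [s] on the first factor and
   [s (s1 (t x)) = t x] on the second. *)
pose r : {rmorphism F -> F} := s1 \o t; pose r1 : {rmorphism F -> F} := t1 \o s.
have rK : cancel r r1 by move=> x; rewrite /r /r1 /= s1K tK.
have r1K : cancel r1 r by move=> x; rewrite /r /r1 /= t1K sK.
have hsl := pemb_semilin hpsi sK s1K Lu.
exists (@sim_subsp F N r r1 rK h.+1), (collineation_of (fun v => psi (semilin s L v))); split.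
- exact: sim_automorphism rK r1K.
- by apply: collineation_iso => //; apply: semilin_surj.
move=> X' X; rewrite (eta_vsE heta p0); congr Some.
have [[xs' [fx' zx' e']] [xs [fx zx e]]] := (subsp_basis X', subsp_basis X).
rewrite -e' -e hL //.
have hz := @std_embedding_hc F h' N' h N X' (sim_subsp rK X) _ _ fx' e' (free_map rK fx)
  (esym (sim_subsp_span rK e)).
rewrite (collineation_hc hsl hz) plv_map /semilin map_tensor_vec.
congr (psi (tensor_vec _ _ *m _)); apply/rowP => i; rewrite !mxE /r /=.
by rewrite s1K.
Qed.

(** For any [theta], the collineation [theta1 \o psi] is a field automorphism followed by an
    invertible matrix. The automorphism and [alpha] only permute the points of the standard image,
    so the matrix alone is the projectivity sought. *)
Lemma embedding_image (theta : pt (PG F D) -> pt P) : isomorphism theta ->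
  proj_equiv theta (gim eta) (range phi).
Proof.
move=> [theta1 [thK Kth thl th1l]].
have [d3 [alpha [psi [[alpha1 [_ Kalpha _ _]] hpsi etaE]]]] := embedding_classification.
have hk : isomorphism (theta1 \o psi) by apply: isomorphism_comp => //; exists theta.
have [s [A [sb Au hA]]] := collineation_semilinear d3 hk.
have [s1 [sK s1K]] := inverse_rmorphism sb.
pose g : 'End('rV[F]_D.+1) := linfun (mulmxr A).
have kg : lker g = 0%VS.
  apply/eqP/lker0P => x y; rewrite !lfunE /= => e.
  by rewrite -(mulmxK Au x) e mulmxK.
have dg (Z : pt (PG F D)) : \dim (g @: val Z)%VS == 1%N.
  by rewrite limg_dim_eq ?kg ?capv0 // (eqP (valP Z)).
exists (fun Z => mk_subsp (dg Z)); first by exists g; rewrite ?kg.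
have step Z : psi Z = theta (mk_subsp (dg (sim_subsp sK Z))).
  rewrite -[LHS]Kth; congr theta; have hz := hc_rep Z.
  apply: (hc_inj (hA _ _ hz) _ (memv_line _)).
  by apply: etrans (congr1 (lfun_img g) (hc_sim sK hz)) _; rewrite limg_line lfunE.
apply/seteqP; split=> z.
  move=> [[X' X] _]; rewrite etaE => -[<-]; rewrite step sim_std_embedding.
  by eexists; [eexists; [|reflexivity]|].
move=> [_ [[X' X] _ <-] <-] /=.
(* For the reverse inclusion the preimage undoes the coordinatewise action on both factors and then
   [alpha] on the second. *)
exists (sim_subsp s1K X', alpha1 (sim_subsp s1K X)) => //; rewrite etaE Kalpha step sim_std_embedding.
have simKK k m (U : subsp F m k) : sim_subsp sK (sim_subsp s1K U) = U.
  by apply: val_inj; rewrite /= simK.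
by rewrite !simKK.
Qed.

End Main.

End GrassmannProducts.

Theorem theorem2p3 (F : fieldType) (h' N' h N : nat)
    (hN' : (0 < h' < N')%N) (hN : (0 < h < N)%N) :
  let n' := 'C(N'.+1, h'.+1).-1 in
  let n := 'C(N.+1, h.+1).-1 in
  let Gamma' := grassmann F h' N' in
  let Gamma := grassmann F h N in
  let Pbar := PG F ((n'.+1 * n.+1).-1)%N in
  let phi : pt (prod_geometry Gamma' Gamma) -> pt Pbar :=
    @std_embedding F h' N' h N in
  forall (P' : geometry) (eta : gmap (pt (prod_geometry Gamma' Gamma)) (pt P')),
  projective_space P' ->
  embedding eta ->
  (rk (fun X => Some (phi X)) <= rk eta)%E ->
  proj_span (gim eta) = setT ->
  (exists (alpha : pt Gamma -> pt Gamma) (psi : pt Pbar -> pt P'),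
     [/\ automorphism alpha, isomorphism psi
       & forall X' X, eta (X', X) = Some (psi (phi (X', alpha X)))]) /\
  (forall theta : pt Pbar -> pt P', isomorphism theta ->
     proj_equiv theta (gim eta) (range phi)).
Proof.
move=> n' n Gamma' Gamma Pbar phi P' eta hP heta hrk hspan; split.
  exact (proj2 (GrassmannProducts.embedding_classification hN' hN hP heta hrk hspan)).
move=> theta htheta.
exact (GrassmannProducts.embedding_image hN' hN hP heta hrk hspan htheta).
Qed.
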